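(* Let $\lambda<0$ and let $\boldsymbol\phi(\lambda)=(\phi_1(\lambda),\dots,\phi_P(\lambda))^{\mathsf T}\in\mathbb{C}^P$. The function $$\Phi(x;\lambda)=-\frac{i}{\epsilon}e^{ih(x;\lambda)/\epsilon}\int_{-\infty}^xe^{-ih(z;\lambda)/\epsilon}\sum_{p=1}^P\frac{\phi_p(\lambda)}{z-z_p}\,dz$$ is both nontrivial and analytic in the closed upper half $x$-plane if and only if $D(\lambda):=\det(\mathbf{A}^<(\lambda))=0$ and $\boldsymbol\phi(\lambda)$ is a nontrivial nullvector of $\mathbf{A}^<(\lambda)$; moreover such a nullvector is unique up to a constant multiple (i.e. $\dim\ker\mathbf{A}^<(\lambda)=1$ whenever $D(\lambda)=0$). Here $\mathbf{A}^<(\lambda)\in\mathbb{C}^{P\times P}$ has components $$A^<_{mp}(\lambda):=\int_{C_m^<}\frac{e^{-ih(z;\lambda)/\epsilon}}{z-z_p}\,dz,\qquad \lambda<0.$$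
   Context: A star denotes complex conjugation. Let $\epsilon>0$, $P\ge 1$, let $c_1,\dots,c_P$ be nonzero complex numbers with $\sum_{p=1}^P(c_p+c_p^* )=0$, and let $z_1,\dots,z_P\in\mathbb{C}$ satisfy $\mathrm{Im}\{z_p\}>0$ and $\mathrm{Re}\{z_1\}<\dots<\mathrm{Re}\{z_P\}$. Define $$f(x):=\sum_{p=1}^P\Big[c_p\big(\mathrm{Log}(i(x-z_p))+\tfrac{\pi i}{2}\big)+c_p^*\big(\mathrm{Log}(-i(x-z_p^* ))-\tfrac{\pi i}{2}\big)\Big],\qquad h(x;\lambda):=\lambda x+f(x),$$ with $\mathrm{Log}$ the principal branch; thus $f'=u_0$ where $u_0(x)=\sum_{p}\big(\frac{c_p}{x-z_p}+\frac{c_p^*}{x-z_p^*}\big)$. The domain of analyticity of $f$ is $G:=\mathbb{C}\setminus\bigcup_{p}\big(\{z_p+it:t\ge 0\}\cup\{z_p^*-it:t\ge0\}\big)$. Subdomains: $G_0:=\{\mathrm{Re}\{x\}<\mathrm{Re}\{z_1\}\}$, $G_P:=\{\mathrm{Re}\{x\}>\mathrm{Re}\{z_P\}\}$, and for $1\le m\le P-1$, $G_m$ is the set of points with $|x|>R$ ($R$ large and fixed) in the upper half-plane lying between the upward cuts from $z_m$ and $z_{m+1}$. The integral in $\Phi$ is a convergent improper integral over a path in $G$ from $-\infty$ to $x\in G$ (equivalently, since $\lambda<0$, starting from $i\infty$ in $G_0$). ''Analytic in the closed upper half $x$-plane'' means that $\Phi$, a priori defined for $x\in G$, extends to a function analytic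 in a neighborhood of $\{\mathrm{Im}\{x\}\ge0\}$. Contours: $C_m^<:=U_m^<$ unless $ic_m/\epsilon$ is a strictly negative integer, in which case $C_m^<:=\ell_0(z_m)$. $U_m^<$ runs in $G$ from $i\infty$ in $G_0$ to $i\infty$ in $G_m$; $\ell_0(z_m)$ originates at $i\infty$ in $G_0$, runs in $G$, and terminates at $z_m$. *)

(* Defs.v *)
(* Analysis is Coquelicot's, over Stdlib's R and C = R * R; linear algebra is
   MathComp's, through the field structure put on C below. *)
From HB Require Import structures.
From mathcomp Require Import all_boot all_order all_algebra boolp.
From Stdlib Require Import Reals Lra.
From Coquelicot Require Import Coquelicot.

Set Implicit Arguments.
Unset Strict Implicit.
Unset Printing Implicit Defensive.

Local Open Scope ring_scope.
Local Open Scope R_scope.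
Local Open Scope C_scope.

Fact C_eqP : Equality.axiom (fun x y : C => if Ceq_dec x y then true else false).
Proof. by move=> x y; case: (Ceq_dec x y) => h; constructor. Qed.
HB.instance Definition _ := hasDecEq.Build C C_eqP.
HB.instance Definition _ : hasChoice C := gen_choiceMixin C.
HB.instance Definition _ :=
  GRing.isZmodule.Build C Cplus_assoc Cplus_comm Cplus_0_l
    (fun x : C => eq_trans (Cplus_comm (- x) x) (Cplus_opp_r x)).
Fact C_1_neq0 : (RtoC 1 : C) != RtoC 0.
Proof. by apply/eqP; exact: C1_nz. Qed.
HB.instance Definition _ :=
  GRing.Zmodule_isComNzRing.Build C Cmult_assoc Cmult_comm Cmult_1_l
    Cmult_plus_distr_r C_1_neq0.
Fact C_mulVx (x : C) : x != RtoC 0 -> Cinv x * x = RtoC 1.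
Proof. by move/eqP; exact: Cinv_l. Qed.
Fact C_inv0 : Cinv (RtoC 0) = RtoC 0.
Proof. by rewrite /Cinv /= /RtoC; congr pair; rewrite /Rdiv; ring. Qed.
HB.instance Definition _ :=
  GRing.ComNzRing_isField.Build C C_mulVx C_inv0.

Definition Cexp (w : C) : C :=
  (exp (Re w) * cos (Im w), exp (Re w) * sin (Im w))%R.

(* Principal argument, in (-PI, PI]: half-angle formula off the negative axis *)
Definition Carg (w : C) : R :=
  match Req_EM_T (Cmod w + Re w) 0 with
  | left _ => PI
  | right _ => (2 * atan (Im w / (Cmod w + Re w)))%R
  end.

Definition Log (w : C) : C := (ln (Cmod w), Carg w).

Lemma Carg_bound (w : C) : (- PI < Carg w <= PI)%R.
Proof.
rewrite /Carg; case: Req_EM_T => h; have hPI := PI_RGT_0; first lra.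
by have [] := atan_bound (Im w / (Cmod w + Re w)); lra.
Qed.

Lemma Cexp_Log (w : C) : w <> 0 -> Cexp (Log w) = w.
Proof.
move=> w0; have hr : (0 < Cmod w)%R by apply/Cmod_gt_0.
rewrite /Cexp /Log /= exp_ln // /Carg.
have hsq : (Cmod w * Cmod w = Re w * Re w + Im w * Im w)%R.
  have -> : (Re w * Re w + Im w * Im w = fst w ^ 2 + snd w ^ 2)%R.
    by rewrite /Re /Im /=; ring.
  apply: sqrt_sqrt; apply: Rplus_le_le_0_compat; exact: pow2_ge_0.
case: w w0 hr hsq => x y; rewrite /Re /Im /=.
set r := Cmod _ => w0 hr hsq.
case: Req_EM_T => h.
  rewrite cos_PI sin_PI; have hx : x = (- r)%R by lra.
  have hy : (y * y = 0)%R by rewrite hx in hsq; nra.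
  have -> : y = 0%R by case: (Rmult_integral _ _ hy).
  by rewrite hx; congr pair; ring.
set a := atan _.
have hc : cos a <> 0%R.
  have [h1 h2] := atan_bound (y / (r + x)); rewrite -/a in h1 h2.
  by apply/Rgt_not_eq/cos_gt_0; lra.
have ht : (sin a = y / (r + x) * cos a)%R.
  by rewrite -{1}(tan_atan (y / (r + x))) -/a /tan; field.
have h1 : (sin a * sin a + cos a * cos a = 1)%R.
  by have := sin2_cos2 a; rewrite /Rsqr.
have hk : (y * y = (r - x) * (r + x))%R by lra.
have hca : (2 * r * (cos a * cos a) = r + x)%R.
  move: h1; rewrite ht => h1.
  apply: (Rmult_eq_reg_r (r + x)) => //.
  have <- : ((y * y + (r + x) * (r + x)) * (cos a * cos a) =
             2 * r * (cos a * cos a) * (r + x))%R by rewrite hk; ring.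
  have -> : ((y * y + (r + x) * (r + x)) * (cos a * cos a) =
    (r + x) * (r + x) * (y / (r + x) * cos a * (y / (r + x) * cos a)
      + cos a * cos a))%R by field.
  by rewrite h1; ring.
congr pair.
  by rewrite cos_2a_cos -[RHS]/x; lra.
rewrite sin_2a ht.
have -> : (r * (2 * (y / (r + x) * cos a) * cos a) =
           y / (r + x) * (2 * r * (cos a * cos a)))%R by ring.
by rewrite hca; field.
Qed.

(* The index type 'I_n.+1 enumerates the P = n + 1 >= 1 poles, so that
   p : 'I_n.+1 stands for the pole with one-based number p + 1. *)

Definition f_pot n (c z : 'I_n.+1 -> C) (x : C) : C :=
  \sum_(p < n.+1)
     (c p * (Log (Ci * (x - z p)) + (PI / 2)%R * Ci) +
      Cconj (c p) * (Log (- Ci * (x - Cconj (z p))) - (PI / 2)%R * Ci))%C.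

Definition h_phase n (c z : 'I_n.+1 -> C) (lam : R) (x : C) : C :=
  lam * x + f_pot c z x.

Definition dom_G n (z : 'I_n.+1 -> C) (x : C) : Prop :=
  forall p : 'I_n.+1,
    ~ (exists t : R, (0 <= t)%R /\ x = z p + Ci * t) /\
    ~ (exists t : R, (0 <= t)%R /\ x = Cconj (z p) - Ci * t).

Definition dom_G0 n (z : 'I_n.+1 -> C) (x : C) : Prop :=
  (Re x < Re (z ord0))%R.

(* The subdomain immediately to the right of the upward cut from z m; it has
   one-based number m + 1, and is G_P when m is the last index. *)
Definition dom_G_right n (z : 'I_n.+1 -> C) (Rad : R) (m : 'I_n.+1) (x : C)
    : Prop :=
  match insub m.+1 : option 'I_n.+1 with
  | Some q =>
      (Rad < Cmod x)%R /\ (0 < Im x)%R /\ (Re (z m) < Re x < Re (z q))%R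
  | None => (Re (z m) < Re x)%R
  end.

Definition velocity (g : R -> C) (t : R) : C :=
  (Derive (fun s => Re (g s)) t, Derive (fun s => Im (g s)) t).

Definition piecewise_C1 (g : R -> C) : Prop :=
  (forall t : R, continuous g t) /\
  exists s : list R,
    (forall t : R, ~ List.In t s ->
       ex_derive (fun u => Re (g u)) t /\ ex_derive (fun u => Im (g u)) t /\
       continuous (velocity g) t) /\
    (forall t : R, List.In t s ->
       (exists l : C, filterlim (velocity g) (at_left t) (locally l)) /\
       (exists l : C, filterlim (velocity g) (at_right t) (locally l))).

(* All contours are parametrised by the whole line; an endpoint, finite or not,
   is a limit as the parameter tends to -oo or +oo. *)
Definition contour_int (F : C -> C) (g : R -> C) : C :=
  RInt_gen (V := C_R_CompleteNormedModule)
    (fun t => F (g t) * velocity g t)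
    (Rbar_locally m_infty) (Rbar_locally p_infty).

Definition contour_in (D : C -> Prop) (g : R -> C) : Prop :=
  piecewise_C1 g /\ forall t : R, D (g t).

Definition starts_at_minus_infty (g : R -> C) : Prop :=
  filterlim (fun t => Re (g t)) (Rbar_locally m_infty) (Rbar_locally m_infty) /\
  exists M : R, Rbar_locally m_infty (fun t => (Rabs (Im (g t)) <= M)%R).

Definition starts_at_i_infty_in (D : C -> Prop) (g : R -> C) : Prop :=
  filterlim (fun t => Im (g t)) (Rbar_locally m_infty) (Rbar_locally p_infty) /\
  Rbar_locally m_infty (fun t => D (g t)).

Definition ends_at_i_infty_in (D : C -> Prop) (g : R -> C) : Prop :=
  filterlim (fun t => Im (g t)) (Rbar_locally p_infty) (Rbar_locally p_infty) /\
  Rbar_locally p_infty (fun t => D (g t)).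

Definition ends_at (x : C) (g : R -> C) : Prop :=
  filterlim g (Rbar_locally p_infty) (locally x).

Definition is_path_to n (z : 'I_n.+1 -> C) (x : C) (g : R -> C) : Prop :=
  contour_in (dom_G z) g /\ starts_at_minus_infty g /\ ends_at x g.

Definition is_U n (z : 'I_n.+1 -> C) (Rad : R) (m : 'I_n.+1) (g : R -> C)
    : Prop :=
  contour_in (dom_G z) g /\ starts_at_i_infty_in (dom_G0 z) g /\
  ends_at_i_infty_in (dom_G_right z Rad m) g.

Definition is_ell0 n (z : 'I_n.+1 -> C) (m : 'I_n.+1) (g : R -> C) : Prop :=
  contour_in (dom_G z) g /\ starts_at_i_infty_in (dom_G0 z) g /\
  ends_at (z m) g.

Definition strictly_negative_integer (w : C) : Prop :=
  exists k : nat, w = - RtoC (INR k.+1).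

Definition is_C_contour n (eps : R) (c z : 'I_n.+1 -> C) (Rad : R)
    (m : 'I_n.+1) (g : R -> C) : Prop :=
  (~ strictly_negative_integer (Ci * c m / eps) -> is_U z Rad m g) /\
  (strictly_negative_integer (Ci * c m / eps) -> is_ell0 z m g).

Definition A_mat n (eps : R) (c z : 'I_n.+1 -> C) (lam : R)
    (Cl : 'I_n.+1 -> R -> C) : 'M[C]_n.+1 :=
  \matrix_(m < n.+1, p < n.+1)
    contour_int
      (fun w => (Cexp (- Ci * h_phase c z lam w / eps) / (w - z p))%C) (Cl m).

(* ell x is the path from -oo to x used to evaluate the integral *)
Definition Phi_fun n (eps : R) (c z : 'I_n.+1 -> C) (lam : R)
    (phi : 'cV[C]_n.+1) (ell : C -> R -> C) (x : C) : C :=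
  - (Ci / eps) * Cexp (Ci * h_phase c z lam x / eps) *
  contour_int
    (fun w => Cexp (- Ci * h_phase c z lam w / eps) *
              \sum_(p < n.+1) (phi p ord0 / (w - z p))%C)
    (ell x).

Definition analytic_on (U : C -> Prop) (F : C -> C) : Prop :=
  open U /\
  forall x : C, U x -> ex_derive (K := C_AbsRing) (V := C_NormedModule) F x.

(* F, defined a priori on D, extends to a function analytic in a neighbourhood
   of the closed upper half-plane. *)
Definition analytic_in_closed_uhp (D : C -> Prop) (F : C -> C) : Prop :=
  exists (U : C -> Prop) (Psi : C -> C),
    (forall x : C, (0 <= Im x)%R -> U x) /\ analytic_on U Psi /\
    (forall x : C, D x -> U x -> Psi x = F x).

Definition nontrivial_on (D : C -> Prop) (F : C -> C) : Prop :=
  exists x : C, D x /\ F x <> 0.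

(* Main.v *)
(* Write e = exp(-ih/eps) and w = sum_p phi_p/(x - z_p), and let H be the
   primitive of e w on G that tends to 0 at i oo in G_0, so that
   Phi = -(i/eps) H/e and Phi' = (i/eps)((lam + u0) Phi - w).  Since lam < 0, e w
   decays exponentially upwards and H has a limit L_m at i oo in each G_m; L_m
   is the m-th component of A phi, except when i c_m/eps is a negative integer,
   where that component is the limit of H at z_m.

   Turning the cut from z_m downwards gives a branch e' of e, holomorphic above
   z_m, with e = e' on the left and e = q e' on the right of the cut,
   q = exp(2 pi c_m/eps), and a primitive H' of e' w vanishing at i oo.  Then H/e
   is (H' + L)/e' on the left and (H' + L'/q)/e' on the right of the cut, where
   L and L' are the limits of H on the two sides, so Phi continues across all
   the cuts if and only if all the limits vanish.  At z_m itself, e behaves like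
   r^b with b = Im c_m/eps; for b <= 0 the singularity is removable, while for
   b > 0 one needs H -> 0, which is automatic when q <> 1 and is the m-th
   equation when i c_m/eps is a negative integer.

   Simplicity is Wu's identity.  If the kernel has dimension at least 2, it
   contains some phi <> 0 with sum_p phi_p = 0.  On the real axis u0 is real, so
   (t |Phi|^2)' = |Phi|^2 - (2/eps) Im (t w^* Phi), and t w^* Phi is the boundary
   value of a function analytic in the upper half-plane, of order t^-2 at
   infinity.  Hence the integral of |Phi|^2 over R vanishes, so Phi = 0 on R,
   w = 0 and phi = 0. *)

Require Import Defs.
From mathcomp Require Import all_boot all_order all_algebra.
From mathcomp Require boolp.
From Stdlib Require Import Reals Lra.
From Coquelicot Require Import Coquelicot.

Set Implicit Arguments.
Unset Strict Implicit.
Unset Printing Implicit Defensive.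

Local Open Scope ring_scope.

(** * Complex differentiation *)

Section ComplexCalculus.

Local Open Scope R_scope.
Local Open Scope C_scope.

(** The obstacle is the endpoint of a cut. Across the open cut, continuation is a comparison of
    constants, but at [z m] the primitive has a branch point whose order [b] may have either sign.
    Riemann's theorem only asks for [(x - z m) Phi -> 0] there, and this holds with half a power of
    [r = |x - z m|] to spare: for [b > 0] the primitive is [O(r^b)] once its limit vanishes; for
    [b <= 0] it is [O(r^(b - 1/2))], the half power absorbing the logarithm that appears at [b = 0].
    If [q <> 1] and the limits at [i oo] vanish, let [M] be the limit of the primitive at [z m]: its
    boundary values on the two sides of the cut are [u] and [q u], both close to [M], whence
    [(q - 1) M = 0]. The identity for simplicity needs a zero sum because
    [t / (t - a) = 1 + a / (t - a)]: the factor [t] that produces [|Phi|^2] would otherwise cost the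
    weight its decay at infinity. Holomorphy always includes a continuous derivative, so primitives
    along L-shaped paths and differentiation under the integral sign replace Goursat's theorem. *)

Definition cder (f : C -> C) (x l : C) : Prop :=
  forall e : R, (0 < e)%R -> exists d : R, (0 < d)%R /\
    forall y, (Cmod (y - x) < d)%R ->
      (Cmod (f y - f x - l * (y - x)) <= e * Cmod (y - x))%R.

Definition ccont (f : C -> C) (x : C) : Prop :=
  forall e : R, (0 < e)%R -> exists d : R, (0 < d)%R /\
    forall y, (Cmod (y - x) < d)%R -> (Cmod (f y - f x) < e)%R.

Definition rder (g : R -> C) (t : R) (v : C) : Prop :=
  is_derive (fun s => Re (g s)) t (Re v) /\
  is_derive (fun s => Im (g s)) t (Im v).

Definition copen (D : C -> Prop) : Prop :=
  forall x, D x -> exists d : R, (0 < d)%R /\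
    forall y, (Cmod (y - x) < d)%R -> D y.

(* [D] is open, [df] is a continuous derivative of [f] on [D]. *)
Definition hol (D : C -> Prop) (f df : C -> C) : Prop :=
  copen D /\ (forall x, D x -> cder f x (df x)) /\
  (forall x, D x -> ccont df x).

Lemma Rlt_minl (x a b : R) : (x < Rmin a b)%R -> (x < a)%R.
Proof. by have := Rmin_l a b; lra. Qed.

Lemma Rlt_minr (x a b : R) : (x < Rmin a b)%R -> (x < b)%R.
Proof. by have := Rmin_r a b; lra. Qed.

Lemma C_ext (x y : C) : Re x = Re y -> Im x = Im y -> x = y.
Proof. by case: x => a b; case: y => c d /= -> ->. Qed.

Lemma im_le_Cmod (x : C) : (Rabs (Im x) <= Cmod x)%R.
Proof. apply: Rle_trans (Rmax_Cmod x); exact: Rmax_r. Qed.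

Lemma Cmod_le_abs (x : C) : (Cmod x <= Rabs (Re x) + Rabs (Im x))%R.
Proof.
have {1}-> : x = RtoC (Re x) + Ci * RtoC (Im x).
  by apply: C_ext; rewrite /Re /Im /=; ring.
apply: Rle_trans (Cmod_triangle _ _) _.
by rewrite Cmod_mult Cmod_Ci !Cmod_R; lra.
Qed.

Lemma Cmod_sub_sym (x y : C) : Cmod (x - y) = Cmod (y - x).
Proof. by rewrite -Cmod_opp; congr Cmod; ring. Qed.

Lemma Cmod_triangle_sub (x y : C) : (Cmod (x - y) <= Cmod x + Cmod y)%R.
Proof.
by apply: Rle_trans (Cmod_triangle x (- y)) _; rewrite Cmod_opp; lra.
Qed.

Lemma Cmod_ge_sub (x y : C) : (Cmod x - Cmod y <= Cmod (x - y))%R.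
Proof.
have := Cmod_triangle (x - y) y.
by rewrite (_ : x - y + y = x); [lra | ring].
Qed.

Lemma Cmod_xx (x : C) : Cmod (x - x) = 0%R.
Proof. by rewrite (_ : x - x = 0); [exact: Cmod_0 | ring]. Qed.

Lemma ccont_const (a x : C) : ccont (fun _ => a) x.
Proof. by move=> e e0; exists 1%R; split=> [|y _]; [lra | rewrite Cmod_xx]. Qed.

Lemma ccont_id (x : C) : ccont (fun y => y) x.
Proof. by move=> e e0; exists e. Qed.

Lemma cder_ccont f x l : cder f x l -> ccont f x.
Proof.
move=> h e e0; have [d [d0 hd]] := h _ Rlt_0_1.
have hM : (0 < 1 + Cmod l)%R by have := Cmod_ge_0 l; lra.
exists (Rmin d (e / (1 + Cmod l))); split.
  by apply: Rmin_pos => //; apply: Rdiv_lt_0_compat.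
move=> y hy; have hy1 := Rlt_minl hy.
have hy2 := Rlt_minr hy.
have h3 := hd _ hy1.
have -> : f y - f x = (f y - f x - l * (y - x)) + l * (y - x) by ring.
apply: Rle_lt_trans (Cmod_triangle _ _) _; rewrite Cmod_mult.
have : (Cmod (y - x) * (1 + Cmod l) < e)%R.
  by apply/Rlt_div_r.
lra.
Qed.

Lemma ccont_bounded f x : ccont f x -> exists d : R, (0 < d)%R /\
  forall y, (Cmod (y - x) < d)%R -> (Cmod (f y) < 1 + Cmod (f x))%R.
Proof.
move=> h; have [d [d0 hd]] := h _ Rlt_0_1.
exists d; split=> // y /hd hy.
by have := Cmod_ge_sub (f y) (f x); lra.
Qed.

Lemma ccont_add f g x : ccont f x -> ccont g x -> ccont (fun y => f y + g y) x.
Proof.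
move=> hf hg e e0; have e2 : (0 < e / 2)%R by lra.
have [d [d0 hd]] := hf _ e2; have [d' [d0' hd']] := hg _ e2.
exists (Rmin d d'); split; first exact: Rmin_pos.
move=> y hy; have h1 := hd _ (Rlt_minl hy).
have h2 := hd' _ (Rlt_minr hy).
have -> : f y + g y - (f x + g x) = (f y - f x) + (g y - g x) by ring.
by apply: Rle_lt_trans (Cmod_triangle _ _) _; lra.
Qed.

Lemma ccont_mul f g x : ccont f x -> ccont g x -> ccont (fun y => f y * g y) x.
Proof.
move=> hf hg e e0.
have [d1 [d10 hd1]] := ccont_bounded hf.
set M := (1 + Cmod (f x))%R in hd1; set N := (1 + Cmod (g x))%R.
have hM : (0 < M)%R by rewrite /M; have := Cmod_ge_0 (f x); lra.
have hN : (0 < N)%R by rewrite /N; have := Cmod_ge_0 (g x); lra.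
have eM : (0 < e / 2 / M)%R by apply: Rdiv_lt_0_compat; lra.
have eN : (0 < e / 2 / N)%R by apply: Rdiv_lt_0_compat; lra.
have [d [d0 hd]] := hf _ eN; have [d' [d0' hd']] := hg _ eM.
exists (Rmin d1 (Rmin d d')); split; first by repeat apply: Rmin_pos.
move=> y hy; have h0 := hd1 _ (Rlt_minl hy).
have hy' := Rlt_minr hy.
have h1 := hd _ (Rlt_le_trans _ _ _ hy' (Rmin_l _ _)).
have h2 := hd' _ (Rlt_le_trans _ _ _ hy' (Rmin_r _ _)).
have -> : f y * g y - f x * g x = f y * (g y - g x) + (f y - f x) * g x by ring.
apply: Rle_lt_trans (Cmod_triangle _ _) _; rewrite !Cmod_mult.
have b1 : (Cmod (f y) * Cmod (g y - g x) <= M * Cmod (g y - g x))%R.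
  by apply: Rmult_le_compat_r; [exact: Cmod_ge_0 | lra].
have b2 : (Cmod (f y - f x) * Cmod (g x) <= Cmod (f y - f x) * N)%R.
  by apply: Rmult_le_compat_l; [exact: Cmod_ge_0 | rewrite /N; lra].
have b3 : (M * Cmod (g y - g x) < e / 2)%R.
  by rewrite Rmult_comm; apply/Rlt_div_r.
have b4 : (Cmod (f y - f x) * N < e / 2)%R.
  by apply/Rlt_div_r.
lra.
Qed.

Lemma ccont_comp f g x : ccont f x -> ccont g (f x) -> ccont (fun y => g (f y)) x.
Proof.
move=> hf hg e /hg [d [d0 hd]]; have [d' [d0' hd']] := hf _ d0.
by exists d'; split=> // y /hd' /hd.
Qed.

Lemma ccont_ext_loc f g x : (exists d : R, (0 < d)%R /\
    forall y, (Cmod (y - x) < d)%R -> f y = g y) -> ccont f x -> ccont g x.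
Proof.
move=> [d [d0 hd]] hf e /hf [d' [d0' hd']].
exists (Rmin d d'); split; first exact: Rmin_pos.
move=> y hy; rewrite -(hd y (Rlt_minl hy)).
rewrite -(hd x) ?Cmod_xx //; apply: hd'.
exact: (Rlt_minr hy).
Qed.

Lemma cder_ext_loc f g x l : (exists d : R, (0 < d)%R /\
    forall y, (Cmod (y - x) < d)%R -> f y = g y) -> cder f x l -> cder g x l.
Proof.
move=> [d [d0 hd]] hf e /hf [d' [d0' hd']].
exists (Rmin d d'); split; first exact: Rmin_pos.
move=> y hy; rewrite -(hd y (Rlt_minl hy)).
rewrite -(hd x) ?Cmod_xx //; apply: hd'.
exact: (Rlt_minr hy).
Qed.

Lemma cder_const (a x : C) : cder (fun _ => a) x 0.
Proof.
move=> e e0; exists 1%R; split=> [|y _]; first lra.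
rewrite (_ : a - a - 0 * (y - x) = 0); last ring.
by rewrite Cmod_0; apply: Rmult_le_pos; [lra | exact: Cmod_ge_0].
Qed.

Lemma cder_id (x : C) : cder (fun y => y) x 1.
Proof.
move=> e e0; exists 1%R; split=> [|y _]; first lra.
rewrite (_ : y - x - 1 * (y - x) = 0); last ring.
by rewrite Cmod_0; apply: Rmult_le_pos; [lra | exact: Cmod_ge_0].
Qed.

Lemma cder_add f g x l k :
  cder f x l -> cder g x k -> cder (fun y => f y + g y) x (l + k).
Proof.
move=> hf hg e e0; have e2 : (0 < e / 2)%R by lra.
have [d [d0 hd]] := hf _ e2; have [d' [d0' hd']] := hg _ e2.
exists (Rmin d d'); split; first exact: Rmin_pos.
move=> y hy; have h1 := hd _ (Rlt_minl hy).
have h2 := hd' _ (Rlt_minr hy).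
have -> : f y + g y - (f x + g x) - (l + k) * (y - x) =
  (f y - f x - l * (y - x)) + (g y - g x - k * (y - x)) by ring.
by apply: Rle_trans (Cmod_triangle _ _) _; lra.
Qed.

(* Caratheodory's form of differentiability, through which the product, chain
   and inverse-function rules become statements about continuous functions. *)
Lemma cder_slope f x l :
  cder f x l <-> exists q, (forall y, f y = f x + q y * (y - x)) /\
                           q x = l /\ ccont q x.
Proof.
split.
  move=> h; pose q y := if Ceq_dec y x then l else (f y - f x) / (y - x).
  have qx : q x = l by rewrite /q; case: Ceq_dec.
  exists q; split; last split=> //.
    move=> y; rewrite /q; case: Ceq_dec => [yx|n] /=; first by rewrite yx; ring.
    field => n'; apply: n; rewrite -(Cplus_0_l x) -n'; ring.
  move=> e e0; have e2 : (0 < e / 2)%R by lra.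
  have [d [d0 hd]] := h _ e2; exists d; split=> // y /hd hy.
  rewrite qx {1}/q; case: Ceq_dec => [_|n] /=; first by rewrite Cmod_xx.
  have n' : y - x <> 0 by move=> n'; apply: n; rewrite -(Cplus_0_l x) -n'; ring.
  have yx : (0 < Cmod (y - x))%R by apply/Cmod_gt_0.
  have -> : (f y - f x) / (y - x) - l = (f y - f x - l * (y - x)) / (y - x).
    by field.
  rewrite Cmod_div //; apply: Rle_lt_trans (_ : e / 2 < e)%R; last lra.
  apply: (Rmult_le_reg_r _ _ _ yx).
  by rewrite /Rdiv Rmult_assoc Rinv_l ?Rmult_1_r; lra.
move=> [q [hq [qx cq]]] e /cq [d [d0 hd]]; exists d; split=> // y /hd hy.
rewrite hq (_ : _ - l * _ = (q y - q x) * (y - x)); last by rewrite qx; ring.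
by rewrite Cmod_mult; apply: Rmult_le_compat_r; [exact: Cmod_ge_0 | lra].
Qed.

Lemma cder_mul f g x l k : cder f x l -> cder g x k ->
  cder (fun y => f y * g y) x (l * g x + f x * k).
Proof.
move=> hf hg; have cg := cder_ccont hg.
move/cder_slope: hf => [q [hq [qx cq]]]; move/cder_slope: hg => [r [hr [rx cr]]].
apply/cder_slope; exists (fun y => q y * g y + f x * r y); split; last split.
- by move=> y; rewrite (hq y) (hr y); ring.
- by rewrite qx rx.
- by apply: ccont_add; apply: ccont_mul => //; apply: ccont_const.
Qed.

Lemma cder_scal f x l a : cder f x l -> cder (fun y => a * f y) x (a * l).
Proof.
move=> hf; have := cder_mul (cder_const a x) hf.
by rewrite (_ : 0 * f x + a * l = a * l); last ring.
Qed.

Lemma cder_comp f g x l k :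
  cder f x l -> cder g (f x) k -> cder (fun y => g (f y)) x (k * l).
Proof.
move=> hf; have cf := cder_ccont hf.
move/cder_slope: hf => [q [hq [qx cq]]] /cder_slope [r [hr [rx cr]]].
apply/cder_slope; exists (fun y => r (f y) * q y); split; last split.
- by move=> y; rewrite (hr (f y)) {2}(hq y); ring.
- by rewrite qx rx.
- apply: ccont_mul => //; exact: ccont_comp cf cr.
Qed.

Lemma ccont_inv (x : C) : x <> 0 -> ccont Cinv x.
Proof.
move=> x0 e e0; have hx : (0 < Cmod x)%R by apply/Cmod_gt_0.
set r := Cmod x in hx *.
exists (Rmin (r / 2) (e * (r * r) / 2)); split.
  apply: Rmin_pos; [lra | apply: Rdiv_lt_0_compat; last lra].
  by apply: Rmult_lt_0_compat => //; apply: Rmult_lt_0_compat.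
move=> y hy; have h1 := Rlt_minl hy.
have h2 := Rlt_minr hy.
have hyr : (r / 2 < Cmod y)%R.
  by have := Cmod_ge_sub x y; rewrite Cmod_sub_sym -/r; lra.
have y0 : y <> 0 by apply/Cmod_gt_0; lra.
have -> : / y - / x = - (y - x) / (x * y) by field.
have xy0 : x * y <> 0 by exact: Cmult_neq_0.
rewrite Cmod_div // Cmod_opp Cmod_mult -/r.
have hp : (0 < r * Cmod y)%R by nra.
apply: (Rmult_lt_reg_r _ _ _ hp).
rewrite /Rdiv Rmult_assoc Rinv_l ?Rmult_1_r; last lra.
apply: Rlt_trans h2 _.
have : (r * (r / 2) < r * Cmod y)%R by apply: Rmult_lt_compat_l.
by move=> h; have := Rmult_lt_compat_l _ _ _ e0 h; lra.
Qed.

Lemma cder_inv f x l : cder f x l -> f x <> 0 ->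
  cder (fun y => / f y) x (- l / (f x * f x)).
Proof.
move=> hf fx0.
have h : cder Cinv (f x) (- / (f x * f x)).
  set a := f x in fx0 *; apply/cder_slope.
  (* With [/ 0 = 0], the slope of the inverse between [a] and [0] is [(0 - / a) / (0 - a)], hence
     the value [/ a / a] at [y = 0]. *)
  exists (fun y => if Ceq_dec y 0 then / a / a else - (/ y * / a)).
  split; last split.
  - move=> y; case: Ceq_dec => [y0|n] /=; first rewrite y0.
      by rewrite C_inv0; field.
    by field.
  - by case: Ceq_dec => [a0|n] /=; [case: fx0 | field].
  - apply: (@ccont_ext_loc (fun y => - (1) * (/ y * / a))).
      exists (Cmod a); split; first exact/Cmod_gt_0.
      move=> y hy; case: Ceq_dec => [y0|n] /=; last ring.
      by move: hy; rewrite y0 (_ : 0 - a = - a) ?Cmod_opp; [lra | ring].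
    apply: ccont_mul; first exact: ccont_const.
    by apply: ccont_mul; [exact: ccont_inv | exact: ccont_const].
have := cder_comp hf h.
by rewrite (_ : - / (f x * f x) * l = - l / (f x * f x)) // /Cdiv; ring.
Qed.

End ComplexCalculus.

(** * Differentiation along curves *)

Section RealCurves.

Local Open Scope R_scope.
Local Open Scope C_scope.

Lemma is_derive_eps (f : R -> R) (t l : R) : is_derive f t l <->
  forall e : R, (0 < e)%R -> exists d : R, (0 < d)%R /\
    forall s, (Rabs (s - t) < d)%R ->
      (Rabs (f s - f t - l * (s - t)) <= e * Rabs (s - t))%R.
Proof.
split.
  move=> /is_derive_Reals h e e0; have [d hd] := h e e0.
  exists d; split=> [|s hs]; first exact: cond_pos.
  case: (Req_dec s t) => [->|n].
    by rewrite !Rminus_diag !Rmult_0_r Rminus_diag !Rabs_R0; lra.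
  have n' : (s - t)%R <> 0%R by lra.
  have := hd (s - t)%R n' hs.
  rewrite (_ : t + (s - t) = s)%R; last ring.
  have -> : ((f s - f t) / (s - t) - l = (f s - f t - l * (s - t)) / (s - t))%R.
    by field.
  rewrite Rabs_div // => /Rlt_le /Rle_div_l; apply; exact: Rabs_pos_lt.
move=> h; apply/is_derive_Reals => e e0.
have e2 : (0 < e / 2)%R by lra.
have [d [d0 hd]] := h _ e2; exists (mkposreal d d0) => k k0 /= hk.
have := hd (t + k)%R; rewrite (_ : t + k - t = k)%R; last ring.
move=> /(_ hk) h1.
have -> : ((f (t + k) - f t) / k - l = (f (t + k) - f t - l * k) / k)%R.
  by field.
rewrite Rabs_div //; apply: Rle_lt_trans (_ : e / 2 < e)%R; last lra.
by apply/Rle_div_l => //; exact: Rabs_pos_lt.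
Qed.

Lemma rder_eps (g : R -> C) (t : R) (v : C) : rder g t v <->
  forall e : R, (0 < e)%R -> exists d : R, (0 < d)%R /\
    forall s, (Rabs (s - t) < d)%R ->
      (Cmod (g s - g t - v * RtoC (s - t)) <= e * Rabs (s - t))%R.
Proof.
have hr s : Re (g s - g t - v * RtoC (s - t)) =
    (Re (g s) - Re (g t) - Re v * (s - t))%R.
  by rewrite /Re /=; ring.
have hi s : Im (g s - g t - v * RtoC (s - t)) =
    (Im (g s) - Im (g t) - Im v * (s - t))%R.
  by rewrite /Im /=; ring.
split.
  move=> [/is_derive_eps h1 /is_derive_eps h2] e e0.
  have e2 : (0 < e / 2)%R by lra.
  have [d [d0 hd]] := h1 _ e2; have [d' [d0' hd']] := h2 _ e2.
  exists (Rmin d d'); split; first exact: Rmin_pos.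
  move=> s hs; have k1 := hd _ (Rlt_minl hs).
  have k2 := hd' _ (Rlt_minr hs).
  by apply: Rle_trans (Cmod_le_abs _) _; rewrite hr hi; lra.
move=> h; split; apply/is_derive_eps => e /h [d [d0 hd]]; exists d; split=> // s.
  by move=> /hd; apply: Rle_trans; rewrite -hr; exact: re_le_Cmod.
by move=> /hd; apply: Rle_trans; rewrite -hi; exact: im_le_Cmod.
Qed.

Lemma rder_comp f (g : R -> C) t l v :
  cder f (g t) l -> rder g t v -> rder (fun s => f (g s)) t (l * v).
Proof.
move=> hf /rder_eps hg; apply/rder_eps => e e0.
have hl := Cmod_ge_0 l; have hv := Cmod_ge_0 v.
set N := (1 + Cmod l)%R; set M := (1 + Cmod v)%R.
have hN : (0 < N)%R by rewrite /N; lra.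
have hM : (0 < M)%R by rewrite /M; lra.
have e1 : (0 < e / 2 / M)%R by apply: Rdiv_lt_0_compat; lra.
have e2 : (0 < Rmin 1 (e / 2 / N))%R.
  by apply: Rmin_pos; [lra | apply: Rdiv_lt_0_compat; lra].
have [d [d0 hd]] := hf _ e1; have [d' [d0' hd']] := hg _ e2.
exists (Rmin d' (d / M)); split.
  by apply: Rmin_pos => //; apply: Rdiv_lt_0_compat.
move=> s hs; have k1 := hd' _ (Rlt_minl hs).
have k2 := Rlt_minr hs.
have hp := Rabs_pos (s - t).
have k3 : (Cmod (g s - g t - v * RtoC (s - t)) <= Rabs (s - t))%R.
  apply: Rle_trans k1 _; have := Rmin_l 1 (e / 2 / N).
  by move=> h; have := Rmult_le_compat_r _ _ _ hp h; lra.
have k4 : (Cmod (g s - g t - v * RtoC (s - t)) <= e / 2 / N * Rabs (s - t))%R.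
  apply: Rle_trans k1 _; apply: Rmult_le_compat_r => //; exact: Rmin_r.
have k5 : (Cmod (g s - g t) <= M * Rabs (s - t))%R.
  have -> : g s - g t = (g s - g t - v * RtoC (s - t)) + v * RtoC (s - t).
    by ring.
  apply: Rle_trans (Cmod_triangle _ _) _.
  by rewrite Cmod_mult Cmod_R /M; lra.
have k6 : (Cmod (g s - g t) < d)%R.
  by apply: Rle_lt_trans k5 _; rewrite Rmult_comm; apply/Rlt_div_r.
have k7 := hd _ k6.
have -> : f (g s) - f (g t) - l * v * RtoC (s - t) =
  (f (g s) - f (g t) - l * (g s - g t)) + l * (g s - g t - v * RtoC (s - t)).
  by ring.
apply: Rle_trans (Cmod_triangle _ _) _; rewrite Cmod_mult.
have k8 : (e / 2 / M * Cmod (g s - g t) <= e / 2 * Rabs (s - t))%R.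
  apply: Rle_trans (Rmult_le_compat_l _ _ _ (Rlt_le _ _ e1) k5) _.
  by apply: Req_le; field; lra.
have k9 : (Cmod l * Cmod (g s - g t - v * RtoC (s - t)) <= e / 2 * Rabs (s - t))%R.
  apply: Rle_trans (_ : N * (e / 2 / N * Rabs (s - t)) <= _)%R; last first.
    by apply: Req_le; field; lra.
  apply: Rmult_le_compat => //; first exact: Cmod_ge_0.
  by rewrite /N; lra.
lra.
Qed.

Lemma rder_hline (b t : R) : rder (fun s => (s, b) : C) t 1.
Proof. by split; rewrite /Re /Im /=; auto_derive. Qed.

Lemma rder_vline (a t : R) : rder (fun s => (a, s) : C) t Ci.
Proof. by split; rewrite /Re /Im /=; auto_derive. Qed.

Lemma rder_add (g k : R -> C) t u v :
  rder g t u -> rder k t v -> rder (fun s => g s + k s) t (u + v).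
Proof. by move=> [h1 h2] [k1 k2]; split; apply: is_derive_plus. Qed.

Lemma rder_ext (g k : R -> C) t v :
  (forall s, g s = k s) -> rder g t v -> rder k t v.
Proof.
by move=> h [h1 h2]; split; [move: h1 | move: h2]; apply: is_derive_ext => s;
   rewrite h.
Qed.

Lemma rder_unique (g : R -> C) t u v : rder g t u -> rder g t v -> u = v.
Proof.
move=> [h1 h2] [k1 k2]; apply: C_ext.
  by rewrite -(is_derive_unique _ _ _ h1) (is_derive_unique _ _ _ k1).
by rewrite -(is_derive_unique _ _ _ h2) (is_derive_unique _ _ _ k2).
Qed.

Lemma is_derive_continuity_pt (f : R -> R) x l : is_derive f x l -> continuity_pt f x.
Proof.
move=> h; apply/continuity_pt_filterlim.
by apply: ex_derive_continuous; exists l.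
Qed.

(* The derivative of [t |-> Re (conj (K b - K a) * K t) - |K b - K a| * m t] is
   nonpositive. *)
Lemma mean_value_ineq (K dK : R -> C) (m dm : R -> R) (a b : R) :
  (a <= b)%R ->
  (forall t, (a <= t <= b)%R -> rder K t (dK t)) ->
  (forall t, (a <= t <= b)%R -> is_derive m t (dm t)) ->
  (forall t, (a <= t <= b)%R -> (Cmod (dK t) <= dm t)%R) ->
  (Cmod (K b - K a) <= m b - m a)%R.
Proof.
move=> ab hK hm hb; set w := K b - K a.
have mono (f df : R -> R) : (forall t, (a <= t <= b)%R -> is_derive f t (df t)) ->
    (forall t, (a <= t <= b)%R -> (0 <= df t)%R) -> (f a <= f b)%R.
  move=> hf h0; have [|x|c [hc e]] := @MVT_gen f a b df; rewrite ?Rmin_left ?Rmax_right //.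
  - by move=> x hx; apply: hf; lra.
  - by move=> /hf /is_derive_continuity_pt.
  rewrite Rmin_left // Rmax_right // in hc.
  have := Rmult_le_pos _ _ (h0 _ hc) (_ : 0 <= b - a)%R; lra.
case: (Req_dec (Cmod w) 0) => [w0|n].
  rewrite w0; have := mono m dm hm _; suff : (m a <= m b)%R by lra.
  by apply: mono hm _ => t /hb; have := Cmod_ge_0 (dK t); lra.
pose psi t := (Cmod w * m t - (Re w * Re (K t) + Im w * Im (K t)))%R.
pose dpsi t := (Cmod w * dm t - (Re w * Re (dK t) + Im w * Im (dK t)))%R.
have h : (psi a <= psi b)%R.
  apply: (mono psi dpsi) => t ht.
    have [k1 k2] := hK _ ht; apply: is_derive_minus.
      by apply: is_derive_scal; exact: hm.
    by apply: is_derive_plus; apply: is_derive_scal.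
  rewrite /dpsi.
  have -> : (Re w * Re (dK t) + Im w * Im (dK t) = Re (Cconj w * dK t))%R.
    by rewrite /Re /Im /=; ring.
  have h1 := Rle_trans _ _ _ (Rle_abs _) (re_le_Cmod (Cconj w * dK t)).
  rewrite Cmod_mult Cmod_conj in h1.
  by have := Rmult_le_compat_l _ _ _ (Cmod_ge_0 w) (hb _ ht); lra.
have e : (Re w * Re (K b) + Im w * Im (K b) - (Re w * Re (K a) + Im w * Im (K a))
    = Cmod w * Cmod w)%R.
  have -> : (Cmod w * Cmod w = Re w ^ 2 + Im w ^ 2)%R by rewrite -Cmod2_alt; ring.
  have -> : Re w = (Re (K b) - Re (K a))%R by rewrite /w /Re /=; ring.
  have -> : Im w = (Im (K b) - Im (K a))%R by rewrite /w /Im /=; ring.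
  by ring.
have w0 : (0 < Cmod w)%R by have := Cmod_ge_0 w; lra.
apply: (Rmult_le_reg_l _ _ _ w0); rewrite /psi in h; lra.
Qed.

Lemma mean_value_bound (K dK : R -> C) (M a b : R) :
  (forall t, (Rmin a b <= t <= Rmax a b)%R -> rder K t (dK t)) ->
  (forall t, (Rmin a b <= t <= Rmax a b)%R -> (Cmod (dK t) <= M)%R) ->
  (Cmod (K b - K a) <= M * Rabs (b - a))%R.
Proof.
have main u v : (u <= v)%R -> (forall t, (u <= t <= v)%R -> rder K t (dK t)) ->
    (forall t, (u <= t <= v)%R -> (Cmod (dK t) <= M)%R) ->
    (Cmod (K v - K u) <= M * (v - u))%R.
  move=> uv h1 h2.
  have := @mean_value_ineq K dK (fun t => (M * t)%R) (fun _ => M) u v uv h1 _ h2.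
  rewrite Rmult_minus_distr_l; apply=> t _; auto_derive => //; ring.
case: (Rle_dec a b) => ab.
  by rewrite Rmin_left // Rmax_right // Rabs_pos_eq; [exact: main | lra].
rewrite Rmin_right ?Rmax_left; try lra.
by rewrite Cmod_sub_sym Rabs_minus_sym Rabs_pos_eq; [apply: main; lra | lra].
Qed.

Lemma rder_zero_const (K : R -> C) (a b : R) :
  (forall t, (Rmin a b <= t <= Rmax a b)%R -> rder K t 0) -> K a = K b.
Proof.
move=> h; have := @mean_value_bound K (fun _ => 0) 0 a b h _.
rewrite Rmult_0_l => k; symmetry.
have /Cmod_eq_0 e : Cmod (K b - K a) = 0%R.
  by apply: Rle_antisym; [apply: k => t _; rewrite Cmod_0; lra | exact: Cmod_ge_0].
by rewrite -(Cplus_0_l (K a)) -e; ring.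
Qed.

(** The increment is split at the corner [(a, y)] into a horizontal and a vertical step. On each,
    the mean value inequality is applied to [f] minus the candidate linear part; the derivative of
    the difference is [df - l] up to a factor [Ci], which is small because [df] is continuous at
    [z]. *)
Lemma cder_of_partials (f df : C -> C) (z : C) :
  (exists d : R, (0 < d)%R /\ forall y, (Cmod (y - z) < d)%R ->
     rder (fun s => f (s, Im y)) (Re y) (df y) /\
     rder (fun s => f (Re y, s)) (Im y) (Ci * df y)) ->
  ccont df z -> cder f z (df z).
Proof.
move=> [d0 [d00 hd0]] hc e e0.
have e2 : (0 < e / 2)%R by lra.
have [d1 [d10 hd1]] := hc _ e2.
exists (Rmin d0 d1); split; first exact: Rmin_pos.
case: z hd0 hc hd1 => a b hd0 hc hd1 [x y] hy.
set l := df (a, b).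
have hxy : (Rabs (x - a) <= Cmod ((x, y) - (a, b) : C))%R := re_le_Cmod ((x, y) - (a, b)).
have hxy' : (Rabs (y - b) <= Cmod ((x, y) - (a, b) : C))%R := im_le_Cmod ((x, y) - (a, b)).
set N := Cmod ((x, y) - (a, b)) in hxy hxy' hy *.
have mid u v s : (Rmin u v <= s <= Rmax u v)%R -> (Rabs (s - u) <= Rabs (v - u))%R.
  by move=> h; move: h; rewrite /Rmin /Rmax; case: Rle_dec => ? ?; rewrite /Rabs;
     do 2 case: Rcase_abs => ?; lra.
have near s t : (Rabs (s - a) <= Rabs (x - a))%R -> (Rabs (t - b) <= Rabs (y - b))%R ->
    (Cmod ((s, t) - (a, b) : C) <= N)%R.
  move=> h1 h2; rewrite /N /Cmod /=; apply: sqrt_le_1_alt.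
  have := Rsqr_le_abs_1 _ _ h1; have := Rsqr_le_abs_1 _ _ h2; rewrite /Rsqr; lra.
have N1 := Rlt_minl hy.
have N2 := Rlt_minr hy.
have h1 : (Cmod (f (x, y) - l * x - (f (a, y) - l * a)) <= e / 2 * Rabs (x - a))%R.
  apply: (@mean_value_bound (fun s => f (s, y) - l * s) (fun s => df (s, y) - l)) => s hs.
    have hn := near s y (mid _ _ _ hs) (Rle_refl _).
    apply: rder_add; first by have [] := hd0 (s, y) (Rle_lt_trans _ _ _ hn N1).
    split; rewrite /Re /Im /=; auto_derive => //; ring.
  have hn := near s y (mid _ _ _ hs) (Rle_refl _).
  by apply: Rlt_le; exact: hd1 (Rle_lt_trans _ _ _ hn N2).
have aa : (Rabs (a - a) <= Rabs (x - a))%R.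
  by rewrite Rminus_diag Rabs_R0; exact: Rabs_pos.
have h2 : (Cmod (f (a, y) - Ci * l * y - (f (a, b) - Ci * l * b)) <= e / 2 * Rabs (y - b))%R.
  apply: (@mean_value_bound (fun s => f (a, s) - Ci * l * s) (fun s => Ci * df (a, s) - Ci * l)) => s hs.
    have hn := near a s aa (mid _ _ _ hs).
    apply: rder_add; first by have [] := hd0 (a, s) (Rle_lt_trans _ _ _ hn N1).
    split; rewrite /Re /Im /=; auto_derive => //; ring.
  have hn := near a s aa (mid _ _ _ hs).
  rewrite (_ : Ci * df (a, s) - Ci * l = Ci * (df (a, s) - l)); last ring.
  rewrite Cmod_mult Cmod_Ci Rmult_1_l.
  by apply: Rlt_le; exact: hd1 (Rle_lt_trans _ _ _ hn N2).
have -> : f (x, y) - f (a, b) - l * ((x, y) - (a, b)) =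
    (f (x, y) - l * x - (f (a, y) - l * a)) +
    (f (a, y) - Ci * l * y - (f (a, b) - Ci * l * b)).
  have -> : ((x, y) - (a, b) : C) = (RtoC x - RtoC a) + Ci * (RtoC y - RtoC b).
    by apply: C_ext; rewrite /Re /Im /=; ring.
  by ring.
apply: Rle_trans (Cmod_triangle _ _) _.
have := Rmult_le_compat_l _ _ _ (Rlt_le _ _ e2) hxy.
have := Rmult_le_compat_l _ _ _ (Rlt_le _ _ e2) hxy'.
lra.
Qed.

End RealCurves.

(** * Exponential and principal logarithm *)

Section ExpLog.

Local Open Scope R_scope.
Local Open Scope C_scope.

Lemma Cexp_add (x y : C) : Cexp (x + y) = Cexp x * Cexp y.
Proof.
by apply: C_ext; rewrite /Cexp /Re /Im /= exp_plus ?cos_plus ?sin_plus; ring.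
Qed.

Lemma Cexp_0 : Cexp 0 = 1.
Proof. by apply: C_ext; rewrite /Cexp /Re /Im /= exp_0 ?cos_0 ?sin_0; ring. Qed.

Lemma Cmod_Cexp (x : C) : Cmod (Cexp x) = exp (Re x).
Proof.
rewrite /Cmod /=.
have -> : (exp (Re x) * cos (Im x) * (exp (Re x) * cos (Im x) * 1) +
  exp (Re x) * sin (Im x) * (exp (Re x) * sin (Im x) * 1) = Rsqr (exp (Re x)))%R.
  have h := sin2_cos2 (Im x); rewrite /Rsqr in h *.
  transitivity (exp (Re x) * exp (Re x) *
    (sin (Im x) * sin (Im x) + cos (Im x) * cos (Im x)))%R; first by ring.
  by rewrite h; ring.
by apply: sqrt_Rsqr; exact/Rlt_le/exp_pos.
Qed.

Lemma Cexp_neq0 (x : C) : Cexp x <> 0.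
Proof. by apply/Cmod_gt_0; rewrite Cmod_Cexp; exact: exp_pos. Qed.

Lemma Cexp_opp (x : C) : Cexp (- x) = / Cexp x.
Proof.
have n := @Cexp_neq0 x.
have e : Cexp x * Cexp (- x) = 1 by rewrite -Cexp_add -Cexp_0; congr Cexp; ring.
by rewrite -[Cexp (- x)]Cmult_1_l -(Cinv_l _ n) -Cmult_assoc e; ring.
Qed.

Lemma ccont_pair (f : C -> C) (x : C) :
  continuous (fun y : C => Re (f y)) x -> continuous (fun y : C => Im (f y)) x ->
  ccont f x.
Proof.
move=> h1 h2 e e0.
have e2 : (0 < e / 2)%R by lra.
have /h1 [d1 hd1] : locally (Re (f x)) (fun v => (Rabs (v - Re (f x)) < e / 2)%R).
  by exists (mkposreal _ e2) => v.
have /h2 [d2 hd2] : locally (Im (f x)) (fun v => (Rabs (v - Im (f x)) < e / 2)%R).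
  by exists (mkposreal _ e2) => v.
exists (Rmin d1 d2); split; first by apply: Rmin_pos; exact: cond_pos.
move=> y hy.
have hre := re_le_Cmod (y - x); have him := im_le_Cmod (y - x).
have k1 := Rlt_minl hy.
have k2 := Rlt_minr hy.
have b1 : (Rabs (Re (f y) - Re (f x)) < e / 2)%R.
  apply: hd1; split; rewrite /ball /= /AbsRing_ball /abs /minus /plus /opp /=.
    exact: Rle_lt_trans hre k1.
  exact: Rle_lt_trans him k1.
have b2 : (Rabs (Im (f y) - Im (f x)) < e / 2)%R.
  apply: hd2; split; rewrite /ball /= /AbsRing_ball /abs /minus /plus /opp /=.
    exact: Rle_lt_trans hre k2.
  exact: Rle_lt_trans him k2.
apply: Rle_lt_trans (Cmod_le_abs _) _.
rewrite (_ : Re (f y - f x) = Re (f y) - Re (f x))%R; last by rewrite /Re /=; ring.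
rewrite (_ : Im (f y - f x) = Im (f y) - Im (f x))%R; last by rewrite /Im /=; ring.
lra.
Qed.

Lemma continuous_Re (x : C) : continuous (fun y : C => Re y) x.
Proof. exact: continuous_fst. Qed.

Lemma continuous_Im (x : C) : continuous (fun y : C => Im y) x.
Proof. exact: continuous_snd. Qed.

Lemma continuous_Rcomp (f : C -> R) (g : R -> R) (x : C) :
  continuous f x -> ex_derive g (f x) -> continuous (fun y => g (f y)) x.
Proof.
move=> hf hg; apply: (@continuous_comp _ _ _ f g x) => //.
exact: ex_derive_continuous.
Qed.

Lemma ccont_Cexp (x : C) : ccont Cexp x.
Proof.
apply: ccont_pair; rewrite /Cexp /Re /Im /=.
  apply: (@continuous_mult C_UniformSpace R_AbsRing).
    by apply: (@continuous_Rcomp (fun y : C => y.1) exp);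
       [exact: continuous_Re | auto_derive].
  by apply: (@continuous_Rcomp (fun y : C => y.2) cos);
     [exact: continuous_Im | auto_derive].
apply: (@continuous_mult C_UniformSpace R_AbsRing).
  by apply: (@continuous_Rcomp (fun y : C => y.1) exp);
     [exact: continuous_Re | auto_derive].
by apply: (@continuous_Rcomp (fun y : C => y.2) sin);
   [exact: continuous_Im | auto_derive].
Qed.

Lemma cder_Cexp (x : C) : cder Cexp x (Cexp x).
Proof.
apply: cder_of_partials; last exact: ccont_Cexp.
exists 1%R; split; first lra.
by move=> y _; split; split; rewrite /Cexp /Re /Im /=; auto_derive => //; ring.
Qed.

Definition slit (w : C) : Prop := (0 < Re w)%R \/ Im w <> 0%R.

Lemma slit_arg_den w : slit w -> (0 < Cmod w + Re w)%R.
Proof.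
move=> hw; have h := re_le_Cmod w; have h' := Rle_abs (- Re w).
rewrite Rabs_Ropp in h'; case: hw => hw; first by have := Cmod_ge_0 w; lra.
have hsq : (Cmod w * Cmod w = Re w * Re w + Im w * Im w)%R.
  have -> : (Cmod w * Cmod w = Re w ^ 2 + Im w ^ 2)%R by rewrite -Cmod2_alt; ring.
  by ring.
have hi : (0 < Im w * Im w)%R by exact: Rsqr_pos_lt.
case: (Req_dec (Cmod w + Re w) 0) => [e|n]; last lra.
have e' : Cmod w = (- Re w)%R by lra.
by rewrite e' in hsq; lra.
Qed.

Lemma slit_neq0 w : slit w -> w <> 0.
Proof.
by move=> hw e; move: hw; rewrite e /slit /Re /Im /=; case; lra.
Qed.

Lemma continuous_Cmod (x : C) : continuous (fun y : C => Cmod y) x.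
Proof.
move=> P [e he]; exists (mkposreal _ (Rdiv_lt_0_compat _ _ (cond_pos e) Rlt_0_2)) => y [h1 h2].
apply: he; rewrite /ball /= /AbsRing_ball /abs /minus /plus /opp /= in h1 h2 *.
apply: Rle_lt_trans (_ : Cmod (y - x) < e)%R.
  apply: Rabs_le; have := Cmod_ge_sub y x; have := Cmod_ge_sub x y.
  rewrite (Cmod_sub_sym x); lra.
apply: Rle_lt_trans (Cmod_le_abs _) _.
rewrite /Re /Im /=; lra.
Qed.

Lemma copen_slit : copen slit.
Proof.
move=> w [h|h].
  exists (Re w); split=> // y hy; left.
  have := Rle_trans _ _ _ (Rle_abs (- Re (y - w)%C)) _.
  rewrite Rabs_Ropp => /(_ _ (re_le_Cmod (y - w))).
  by rewrite (_ : Re (y - w) = Re y - Re w)%R; [lra | rewrite /Re /=; ring].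
have h0 := Rabs_pos_lt _ h.
exists (Rabs (Im w)); split=> // y hy; right => e.
have := im_le_Cmod (y - w).
rewrite (_ : Im (y - w) = - Im w)%R; last by move: e; rewrite /Im /= => ->; ring.
by rewrite Rabs_Ropp; lra.
Qed.

Lemma Carg_slit w : slit w -> Carg w = (2 * atan (Im w / (Cmod w + Re w)))%R.
Proof.
by move=> /slit_arg_den h; rewrite /Carg; case: Req_EM_T => //; lra.
Qed.

Lemma ccont_Log w : slit w -> ccont Log w.
Proof.
move=> hw; have [d [d0 hd]] := copen_slit hw.
apply: (@ccont_ext_loc (fun y : C => (ln (Cmod y), 2 * atan (Im y / (Cmod y + Re y)))%R : C)).
  exists d; split=> // y /hd hy; rewrite /Log Carg_slit //.
have hc := slit_arg_den hw.
apply: ccont_pair.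
  apply: (@continuous_Rcomp (fun y : C => Cmod y) ln).
    exact: continuous_Cmod.
  have := proj1 (Cmod_gt_0 w) (slit_neq0 hw).
  by move=> ?; auto_derive.
apply: (@continuous_Rcomp (fun y : C => (Im y / (Cmod y + Re y))%R)
  (fun v => 2 * atan v)%R); last by auto_derive.
apply: (@continuous_mult C_UniformSpace R_AbsRing); first exact: continuous_Im.
apply: (@continuous_Rcomp (fun y : C => (Cmod y + Re y)%R) Rinv).
  apply: (@continuous_plus C_UniformSpace R_AbsRing R_NormedModule).
    exact: continuous_Cmod.
  exact: continuous_Re.
by auto_derive; lra.
Qed.

Lemma neq0_loc (f : C -> C) x : ccont f x -> f x <> 0 ->
  exists d : R, (0 < d)%R /\ forall y, (Cmod (y - x) < d)%R -> f y <> 0.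
Proof.
move=> hf /Cmod_gt_0 h0; have [d [d0 hd]] := hf _ h0.
exists d; split=> // y /hd; rewrite Cmod_sub_sym => hy e.
by have := Cmod_ge_sub (f x) (f y); rewrite e Cmod_0; move: hy; rewrite e; lra.
Qed.

(** Inverse function rule in Caratheodory's form. The slope [r] of [Cexp] at [Log w] gives
    [y - w = r (Log y) * (Log y - Log w)] for [y <> 0]; as [r (Log y)] is nonzero near [w], its
    inverse is a continuous slope of [Log]. *)
Lemma cder_Log w : slit w -> cder Log w (/ w).
Proof.
move=> hw; have w0 := slit_neq0 hw; have cl := ccont_Log hw.
have /cder_slope [r [hr [rw cr]]] := cder_Cexp (Log w).
rewrite Cexp_Log // in hr rw.
have cq : ccont (fun y => r (Log y)) w by exact: ccont_comp cl cr.
have rw0 : r (Log w) <> 0 by rewrite rw.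
have [d [d0 hd]] := neq0_loc cq rw0.
have [d' [d0' hd']] := @neq0_loc (fun y => y) w (@ccont_id w) w0.
pose g y := Log w + / r (Log y) * (y - w).
apply: (@cder_ext_loc g).
  exists (Rmin d d'); split; first exact: Rmin_pos.
  move=> y hy; have h1 := hd' _ (Rlt_minr hy).
  have h2 := hd _ (Rlt_minl hy).
  have := hr (Log y); rewrite Cexp_Log // => e.
  by rewrite /g {2}e; field.
apply/cder_slope; exists (fun y => / r (Log y)); split; last split.
- by move=> y; rewrite /g; ring.
- by rewrite rw.
- by apply: (@ccont_comp (fun y => r (Log y)) Cinv) => //; apply: ccont_inv; rewrite rw.
Qed.

End ExpLog.

(** * Integrals of complex-valued functions and primitives *)

Section Integrals.

Local Open Scope R_scope.
Local Open Scope C_scope.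

Definition rcont (g : R -> C) (t : R) : Prop :=
  forall e : R, (0 < e)%R -> exists d : R, (0 < d)%R /\
    forall s, (Rabs (s - t) < d)%R -> (Cmod (g s - g t) < e)%R.

Lemma rcont_continuous (g : R -> C) t : rcont g t ->
  continuous (fun s => Re (g s)) t /\ continuous (fun s => Im (g s)) t.
Proof.
move=> h; split=> P [e he]; have [d [d0 hd]] := h e (cond_pos e);
  exists (mkposreal d d0) => s hs; apply: he; apply: Rle_lt_trans (hd s hs).
  exact: re_le_Cmod (g s - g t).
exact: im_le_Cmod (g s - g t).
Qed.

Lemma continuous_rcont (g : R -> C) t :
  continuous (fun s => Re (g s)) t -> continuous (fun s => Im (g s)) t -> rcont g t.
Proof.
move=> h1 h2 e e0; have e2 : (0 < e / 2)%R by lra.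
have /h1 [d1 hd1] : locally (Re (g t)) (fun v => (Rabs (v - Re (g t)) < e / 2)%R).
  by exists (mkposreal _ e2) => v.
have /h2 [d2 hd2] : locally (Im (g t)) (fun v => (Rabs (v - Im (g t)) < e / 2)%R).
  by exists (mkposreal _ e2) => v.
exists (Rmin d1 d2); split; first by apply: Rmin_pos; exact: cond_pos.
move=> s hs; have k1 := hd1 _ (Rlt_minl hs).
have k2 := hd2 _ (Rlt_minr hs).
apply: Rle_lt_trans (Cmod_le_abs _) _.
have -> : Re (g s - g t) = (Re (g s) - Re (g t))%R by rewrite /Re /=; ring.
have -> : Im (g s - g t) = (Im (g s) - Im (g t))%R by rewrite /Im /=; ring.
lra.
Qed.

Lemma rder_rcont (g : R -> C) t v : rder g t v -> rcont g t.
Proof.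
move=> [h1 h2]; apply: continuous_rcont; apply: ex_derive_continuous.
  by exists (Re v).
by exists (Im v).
Qed.

Lemma rcont_comp f (g : R -> C) t : ccont f (g t) -> rcont g t ->
  rcont (fun s => f (g s)) t.
Proof.
move=> hf hg e /hf [d [d0 hd]]; have [d' [d0' hd']] := hg _ d0.
by exists d'; split=> // s /hd' /hd.
Qed.

Lemma rcont_scal (g : R -> C) a t : rcont g t -> rcont (fun s => a * g s) t.
Proof.
move=> hg; apply: (@rcont_comp (fun y => a * y)) => //.
by apply: ccont_mul; [exact: ccont_const | exact: ccont_id].
Qed.

(** Kept componentwise so that the theory of real integrals applies to each part; [is_Cint_pair]
    returns to integrals of pairs. *)
Definition is_Cint (g : R -> C) (a b : R) (l : C) : Prop :=
  is_RInt (fun t => Re (g t)) a b (Re l) /\ is_RInt (fun t => Im (g t)) a b (Im l).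

Definition Cint (g : R -> C) (a b : R) : C :=
  (RInt (fun t => Re (g t)) a b, RInt (fun t => Im (g t)) a b).

Lemma is_Cint_unique g a b l : is_Cint g a b l -> Cint g a b = l.
Proof.
by move=> [h1 h2]; apply: C_ext; rewrite /Cint /=; exact: is_RInt_unique.
Qed.

Lemma is_Cint_rcont (g : R -> C) a b :
  (forall t, (Rmin a b <= t <= Rmax a b)%R -> rcont g t) -> is_Cint g a b (Cint g a b).
Proof.
move=> h; split; apply: RInt_correct; apply: ex_RInt_continuous => t ht.
  by have [] := rcont_continuous (h t ht).
by have [] := rcont_continuous (h t ht).
Qed.

Lemma is_Cint_ext (g k : R -> C) a b l :
  (forall t, (Rmin a b < t < Rmax a b)%R -> g t = k t) -> is_Cint g a b l -> is_Cint k a b l.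
Proof.
by move=> h [h1 h2]; split; [move: h1 | move: h2]; apply: is_RInt_ext => t ht; rewrite h.
Qed.

Lemma is_Cint_scal (g : R -> C) a b l u :
  is_Cint g a b l -> is_Cint (fun t => u * g t) a b (u * l).
Proof.
move=> [h1 h2]; split.
  apply: (is_RInt_ext (fun t => minus (scal (Re u) (Re (g t))) (scal (Im u) (Im (g t))))).
    by move=> t _; rewrite /minus /plus /opp /scal /= /mult /Re /Im /=; ring.
  have -> : Re (u * l) = minus (scal (Re u) (Re l)) (scal (Im u) (Im l)).
    by rewrite /minus /plus /opp /scal /= /mult /Re /Im /=; ring.
  by apply: is_RInt_minus; apply: is_RInt_scal.
apply: (is_RInt_ext (fun t => plus (scal (Re u) (Im (g t))) (scal (Im u) (Re (g t))))).
  by move=> t _; rewrite /plus /scal /= /mult /Re /Im /=; ring.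
have -> : Im (u * l) = plus (scal (Re u) (Im l)) (scal (Im u) (Re l)).
  by rewrite /plus /scal /= /mult /Re /Im /=; ring.
by apply: is_RInt_plus; apply: is_RInt_scal.
Qed.

Lemma is_Cint_add (g k : R -> C) a b l m :
  is_Cint g a b l -> is_Cint k a b m -> is_Cint (fun t => g t + k t) a b (l + m).
Proof. by move=> [h1 h2] [k1 k2]; split; apply: is_RInt_plus. Qed.

Lemma is_Cint_pair (g : R -> C) a b l :
  is_Cint g a b l -> is_RInt (V := C_R_NormedModule) g a b l.
Proof.
move=> [h1 h2]; rewrite (surjective_pairing l).
exact: (@is_RInt_fct_extend_pair R_NormedModule R_NormedModule g a b l.1 l.2).
Qed.

Lemma Cint_bound (g : R -> C) a b l M : (a <= b)%R ->
  (forall t, (a <= t <= b)%R -> (Cmod (g t) <= M)%R) -> is_Cint g a b l ->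
  (Cmod l <= M * (b - a))%R.
Proof.
move=> ab hM /is_Cint_pair h.
have := @norm_RInt_le_const C_R_NormedModule g a b l M ab _ h.
by rewrite -Cmod_norm Rmult_comm; apply=> t /hM; rewrite Cmod_norm.
Qed.

Lemma is_Cint_deriv (g dg : R -> C) a b :
  (forall t, (Rmin a b <= t <= Rmax a b)%R -> rder g t (dg t)) ->
  (forall t, (Rmin a b <= t <= Rmax a b)%R -> rcont dg t) ->
  is_Cint dg a b (g b - g a).
Proof.
move=> h1 h2; split.
  have -> : Re (g b - g a) = minus (Re (g b)) (Re (g a)).
    by rewrite /minus /plus /opp /Re /=.
  apply: (is_RInt_derive (fun t => Re (g t))) => t ht; first by have [] := h1 t ht.
  by have [] := rcont_continuous (h2 t ht).
have -> : Im (g b - g a) = minus (Im (g b)) (Im (g a)).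
  by rewrite /minus /plus /opp /Im /=.
apply: (is_RInt_derive (fun t => Im (g t))) => t ht; first by have [] := h1 t ht.
by have [] := rcont_continuous (h2 t ht).
Qed.

Lemma between_near (a x d t u : R) : (Rabs (u - x) < d)%R ->
  (Rmin a u <= t <= Rmax a u)%R ->
  (Rmin a x <= t <= Rmax a x)%R \/ (Rabs (t - x) < d)%R.
Proof.
rewrite /Rmin /Rmax; case: (Rle_dec a u) => au; case: (Rle_dec a x) => ax hu ht;
  case: (Rle_dec t x) => tx; (try (by left; lra)); right; move: hu;
  rewrite /Rabs; do 2 case: Rcase_abs => ?; lra.
Qed.

Lemma rder_Cint (g : R -> C) a x : (exists d : R, (0 < d)%R /\
    forall t, (Rmin a x <= t <= Rmax a x)%R \/ (Rabs (t - x) < d)%R -> rcont g t) ->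
  rder (fun u => Cint g a u) x (g x).
Proof.
move=> [d [d0 hd]].
have hl : locally x (fun u : R => is_Cint g a u (Cint g a u)).
  exists (mkposreal d d0) => u hu; apply: is_Cint_rcont => t ht; apply: hd.
  exact: (between_near hu ht).
have hx : rcont g x by apply: hd; right; rewrite Rminus_diag Rabs_R0.
have [c1 c2] := rcont_continuous hx.
split.
  apply: (is_derive_RInt (fun t => Re (g t)) (fun u => Re (Cint g a u)) a) => //.
  by move: hl; apply: filter_imp => u [].
apply: (is_derive_RInt (fun t => Im (g t)) (fun u => Im (Cint g a u)) a) => //.
by move: hl; apply: filter_imp => u [].
Qed.

(** The tube lemma: compactness of [[a, b]], applied to a gauge obtained by choice, makes the local
    width independent of the point of the interval. *)
Lemma tube (P : R -> R -> Prop) (a b x : R) :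
  (forall t, (a <= t <= b)%R -> exists d : R, (0 < d)%R /\
     forall u v, (Rabs (u - x) < d)%R -> (Rabs (v - t) < d)%R -> P u v) ->
  exists d : R, (0 < d)%R /\
    forall u v, (Rabs (u - x) < d)%R -> (a <= v <= b)%R -> P u v.
Proof.
move=> h.
have hc t : exists e : posreal, (a <= t <= b)%R ->
    forall u v, (Rabs (u - x) < e)%R -> (Rabs (v - t) < e)%R -> P u v.
  case: (boolp.pselect (a <= t <= b)%R) => ht.
    by have [d [d0 hd]] := h t ht; exists (mkposreal d d0).
  by exists (mkposreal 1 Rlt_0_1) => /ht.
have [delta hdelta] := boolp.choice hc.
have [d hd] := compactness_value_1d a b delta.
exists d; split=> [|u v hu hv]; first exact: cond_pos.
apply: boolp.contrapT => hn; apply: (hd v hv) => -[t [ht [h1 h2]]]; apply: hn.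
by apply: (hdelta t) => //; apply: Rlt_le_trans hu h2.
Qed.

(** Differentiation under the integral sign. The neighbourhoods given around each [(x, t)] are made
    uniform along the segment of integration by [tube]. *)
Lemma rder_Cint_param (K dK : R -> R -> C) a b x :
  (forall t, (Rmin a b <= t <= Rmax a b)%R -> exists d : R, (0 < d)%R /\
     forall u v, (Rabs (u - x) < d)%R -> (Rabs (v - t) < d)%R ->
       rder (fun w => K w v) u (dK u v) /\ rcont (K u) v) ->
  (forall t, (Rmin a b <= t <= Rmax a b)%R -> forall e : R, (0 < e)%R ->
     exists d : R, (0 < d)%R /\
     forall u v, (Rabs (u - x) < d)%R -> (Rabs (v - t) < d)%R ->
       (Cmod (dK u v - dK x t) < e)%R) ->
  rder (fun u => Cint (K u) a b) x (Cint (dK x) a b).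
Proof.
move=> h1 h2.
have [d0 [d00 hd0]] := tube h1.
have xx : (Rabs (x - x) < d0)%R by rewrite Rminus_diag Rabs_R0.
split.
  have e : RInt (fun t => Re (dK x t)) a b = RInt (fun t => Derive (fun u => Re (K u t)) x) a b.
    apply: RInt_ext => t ht; symmetry; apply: is_derive_unique.
    by have [[]] := hd0 x t xx (conj (Rlt_le _ _ (proj1 ht)) (Rlt_le _ _ (proj2 ht))).
  rewrite [Re (Cint _ _ _)]e.
  apply: (@is_derive_RInt_param (fun u t => Re (K u t))).
  - exists (mkposreal d0 d00) => u hu t ht.
    by have [[hK _] _] := hd0 u t hu ht; exists (Re (dK u t)).
  - move=> t ht e2; have [d [d_0 hd]] := h2 t ht e2 (cond_pos e2).
    have [d' [d0' hd']] := h1 t ht.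
    exists (mkposreal _ (Rmin_pos _ _ d_0 d0')) => u v hu hv.
    have [[k1 _] _] := hd' u v (Rlt_minr hu) (Rlt_minr hv).
    have [[k2 _] _] := hd0 x t xx ht.
    rewrite (is_derive_unique _ _ _ k1) (is_derive_unique _ _ _ k2).
    apply: Rle_lt_trans (hd u v (Rlt_minl hu) (Rlt_minl hv)).
    exact: re_le_Cmod (dK u v - dK x t).
  - exists (mkposreal d0 d00) => u hu; apply: ex_RInt_continuous => t ht.
    by have [_ /rcont_continuous []] := hd0 u t hu ht.
have e : RInt (fun t => Im (dK x t)) a b = RInt (fun t => Derive (fun u => Im (K u t)) x) a b.
  apply: RInt_ext => t ht; symmetry; apply: is_derive_unique.
  by have [[]] := hd0 x t xx (conj (Rlt_le _ _ (proj1 ht)) (Rlt_le _ _ (proj2 ht))).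
rewrite [Im (Cint _ _ _)]e.
apply: (@is_derive_RInt_param (fun u t => Im (K u t))).
- exists (mkposreal d0 d00) => u hu t ht.
  by have [[_ hK] _] := hd0 u t hu ht; exists (Im (dK u t)).
- move=> t ht e2; have [d [d_0 hd]] := h2 t ht e2 (cond_pos e2).
  have [d' [d0' hd']] := h1 t ht.
  exists (mkposreal _ (Rmin_pos _ _ d_0 d0')) => u v hu hv.
  have [[_ k1] _] := hd' u v (Rlt_minr hu) (Rlt_minr hv).
  have [[_ k2] _] := hd0 x t xx ht.
  rewrite (is_derive_unique _ _ _ k1) (is_derive_unique _ _ _ k2).
  apply: Rle_lt_trans (hd u v (Rlt_minl hu) (Rlt_minl hv)).
  exact: im_le_Cmod (dK u v - dK x t).
- exists (mkposreal d0 d00) => u hu; apply: ex_RInt_continuous => t ht.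
  by have [_ /rcont_continuous []] := hd0 u t hu ht.
Qed.

Lemma Cmod_pair (x y s t : R) : (Cmod ((x, y) - (s, t) : C) <= Rabs (x - s) + Rabs (y - t))%R.
Proof.
exact: (Cmod_le_abs ((x, y) - (s, t))).
Qed.

(* Primitive along an L-shaped path: horizontal at height [b], then vertical. *)
Lemma antiderivative (D : C -> Prop) (f df : C -> C) (a b : R) : hol D f df ->
  (forall x, D x -> (forall t, (Rmin a (Re x) <= t <= Rmax a (Re x))%R -> D (t, b)) /\
     (forall s, (Rmin b (Im x) <= s <= Rmax b (Im x))%R -> D (Re x, s))) ->
  exists H, forall x, D x -> cder H x (f x).
Proof.
move=> [oD [hf cdf]] hD.
have hline t s : D (t, s) -> rder (fun u => f (u, s)) t (df (t, s)).
  move=> h; have := rder_comp (hf _ h) (rder_hline s t).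
  by rewrite (_ : df (t, s) * 1 = df (t, s)); last ring.
have vline t s : D (t, s) -> rder (fun u => f (t, u)) s (Ci * df (t, s)).
  move=> h; have := rder_comp (hf _ h) (rder_vline t s).
  by rewrite Cmult_comm.
have hnear t s : D (t, s) -> exists d : R, (0 < d)%R /\ forall u v,
    (Rabs (u - t) < d)%R -> (Rabs (v - s) < d)%R -> D (u, v).
  move=> /oD [d [d0 hd]]; exists (d / 2)%R; split; first lra.
  move=> u v hu hv; apply: hd; apply: Rle_lt_trans (Cmod_pair _ _ _ _) _; lra.
have dd (u : R) d : (0 < d)%R -> (Rabs (u - u) < d)%R.
  by rewrite Rminus_diag Rabs_R0.
pose H x := Cint (fun t => f (t, b)) a (Re x) + Ci * Cint (fun s => f (Re x, s)) b (Im x).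
exists H => x Dx; apply: cder_of_partials; last exact: cder_ccont (hf _ Dx).
have [d [d0 hd]] := oD _ Dx; exists d; split=> // -[x1 x2] /hd {d d0 hd} Dy.
have [hD1 hD2] := hD _ Dy; rewrite /= in hD1 hD2.
have Db : D (x1, b) by apply: hD2; split; [exact: Rmin_l | exact: Rmax_l].
split; last first.
  have -> : Ci * f (x1, x2) = 0 + Ci * f (x1, x2) by ring.
  rewrite /H /=; apply: rder_add.
    split; rewrite /Re /Im /=; exact: is_derive_const.
  have [d [d0 hd]] := hnear _ _ Dy.
  apply: (@rder_comp (fun z => Ci * z) (fun s => Cint (fun s => f (x1, s)) b s) x2 Ci).
    by have := cder_scal Ci (@cder_id (Cint (fun s => f (x1, s)) b x2));
       rewrite Cmult_1_r.
  apply: (@rder_Cint (fun s => f (x1, s))); exists d; split=> // t ht.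
  apply: rder_rcont (vline x1 t _); case: ht => ht; first exact: hD2.
  by apply: hd => //; exact: dd.
(* The horizontal derivative of [H] comes out as this right-hand side: the horizontal leg
   contributes the value at the corner, and the vertical leg moves as a whole. Integrating [df] up
   the vertical leg turns the sum back into [f (x1, x2)]. *)
have -> : f (x1, x2) = f (x1, b) + Ci * Cint (fun s => df (x1, s)) b x2.
  have h : is_Cint (fun s => Ci * df (x1, s)) b x2 (f (x1, x2) - f (x1, b)).
    apply: (is_Cint_deriv (g := fun s => f (x1, s))) => t ht.
      by apply: vline; exact: hD2.
    apply: rcont_scal; apply: (@rcont_comp df (fun s => (x1, s))).
      by apply: cdf; exact: hD2.
    exact: rder_rcont (rder_vline x1 t).
  have h' : is_Cint (fun s => df (x1, s)) b x2 (Cint (fun s => df (x1, s)) b x2).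
    apply: is_Cint_rcont => t ht; apply: (@rcont_comp df (fun s => (x1, s))).
      by apply: cdf; exact: hD2.
    exact: rder_rcont (rder_vline x1 t).
  by rewrite -(is_Cint_unique (is_Cint_scal Ci h')) (is_Cint_unique h); ring.
rewrite /H /=; apply: rder_add.
  have [d [d0 hd]] := hnear _ _ Db.
  apply: (@rder_Cint (fun t => f (t, b))); exists d; split=> // t ht.
  apply: rder_rcont (hline t b _); case: ht => ht; first exact: hD1.
  by apply: hd => //; exact: dd.
apply: (@rder_comp (fun z => Ci * z) (fun u => Cint (fun s => f (u, s)) b x2) x1 Ci).
  by have := cder_scal Ci (@cder_id (Cint (fun s => f (x1, s)) b x2));
     rewrite Cmult_1_r.
apply: (@rder_Cint_param (fun u s => f (u, s)) (fun u s => df (u, s))).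
  move=> t /hD2 /hnear [d [d0 hd]]; exists d; split=> // u v hu hv.
  by split; [exact: hline (hd _ _ hu hv) | exact: rder_rcont (vline _ _ (hd _ _ hu hv))].
move=> t /hD2 /cdf hc e /hc [d [d0 hd]]; exists (d / 2)%R; split; first lra.
move=> u v hu hv; apply: hd; apply: Rle_lt_trans (Cmod_pair _ _ _ _) _; lra.
Qed.

End Integrals.

(** * Contour integrals *)

Section Contours.

Local Open Scope R_scope.
Local Open Scope C_scope.

Lemma locally_Cmod (x : C) (P : C -> Prop) :
  locally x P <-> exists d : R, (0 < d)%R /\ forall y, (Cmod (y - x) < d)%R -> P y.
Proof.
split.
  move=> [d hd]; exists d; split=> [|y hy]; first exact: cond_pos.
  apply: hd; split; rewrite /ball /= /AbsRing_ball /abs /minus /plus /opp /=.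
    exact: Rle_lt_trans (re_le_Cmod (y - x)) hy.
  exact: Rle_lt_trans (im_le_Cmod (y - x)) hy.
move=> [d [d0 hd]]; have d2 : (0 < d / 2)%R by lra.
exists (mkposreal _ d2) => y [h1 h2]; apply: hd.
rewrite /ball /= /AbsRing_ball /abs /minus /plus /opp /= in h1 h2.
apply: Rle_lt_trans (Cmod_le_abs _) _; rewrite /Re /Im /=; lra.
Qed.

Lemma continuous_C_rcont (g : R -> C) t :
  continuous (U := C_UniformSpace) g t -> rcont g t.
Proof.
move=> h e e0.
have /h [d hd] : locally (g t) (fun y => (Cmod (y - g t) < e)%R).
  by apply/locally_Cmod; exists e.
by exists d; split; [exact: cond_pos | move=> s hs; exact: hd].
Qed.

Definition left_lim (v : R -> C) (t : R) (l : C) : Prop :=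
  forall e : R, (0 < e)%R -> exists d : R, (0 < d)%R /\
    forall s, (t - d < s < t)%R -> (Cmod (v s - l) < e)%R.

Definition right_lim (v : R -> C) (t : R) (l : C) : Prop :=
  forall e : R, (0 < e)%R -> exists d : R, (0 < d)%R /\
    forall s, (t < s < t + d)%R -> (Cmod (v s - l) < e)%R.

Lemma rcont_left_lim v t : rcont v t -> left_lim v t (v t).
Proof.
move=> h e /h [d [d0 hd]]; exists d; split=> // s hs; apply: hd.
rewrite /Rabs; case: Rcase_abs; lra.
Qed.

Lemma rcont_right_lim v t : rcont v t -> right_lim v t (v t).
Proof.
move=> h e /h [d [d0 hd]]; exists d; split=> // s hs; apply: hd.
rewrite /Rabs; case: Rcase_abs; lra.
Qed.

Lemma mul_near (a b : C) (e : R) : (0 < e)%R -> exists d : R, (0 < d)%R /\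
  forall u v, (Cmod (u - a) < d)%R -> (Cmod (v - b) < d)%R ->
    (Cmod (u * v - a * b) < e)%R.
Proof.
move=> e0; have ha := Cmod_ge_0 a; have hb := Cmod_ge_0 b.
set N := (1 + Cmod a + Cmod b)%R; have hN : (0 < N)%R by rewrite /N; lra.
exists (Rmin 1 (e / 2 / N)); split.
  by apply: Rmin_pos; [lra | apply: Rdiv_lt_0_compat; lra].
move=> u v hu hv.
have u1 := Rlt_minl hu.
have u2 := Rlt_minr hu.
have v2 := Rlt_minr hv.
have -> : u * v - a * b = u * (v - b) + b * (u - a) by ring.
apply: Rle_lt_trans (Cmod_triangle _ _) _; rewrite !Cmod_mult.
have hu' : (Cmod u <= N)%R.
  by have := Cmod_ge_sub u a; rewrite /N; lra.
have k1 : (Cmod u * Cmod (v - b) <= N * Cmod (v - b))%R.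
  by apply: Rmult_le_compat_r => //; exact: Cmod_ge_0.
have k2 : (Cmod b * Cmod (u - a) <= N * Cmod (u - a))%R.
  by apply: Rmult_le_compat_r; [exact: Cmod_ge_0 | rewrite /N; lra].
have k3 : (Cmod (v - b) * N < e / 2)%R by apply/Rlt_div_r.
have k4 : (Cmod (u - a) * N < e / 2)%R by apply/Rlt_div_r.
lra.
Qed.

Lemma left_lim_mul u v t k l : left_lim u t k -> left_lim v t l ->
  left_lim (fun s => u s * v s) t (k * l).
Proof.
move=> hu hv e e0; have [d [d0 hd]] := mul_near k l e0.
have [d1 [d10 h1]] := hu _ d0; have [d2 [d20 h2]] := hv _ d0.
exists (Rmin d1 d2); split; first exact: Rmin_pos.
have := Rmin_l d1 d2; have := Rmin_r d1 d2.
by move=> m1 m2 s hs; apply: hd; [apply: h1 | apply: h2]; lra.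
Qed.

Lemma right_lim_mul u v t k l : right_lim u t k -> right_lim v t l ->
  right_lim (fun s => u s * v s) t (k * l).
Proof.
move=> hu hv e e0; have [d [d0 hd]] := mul_near k l e0.
have [d1 [d10 h1]] := hu _ d0; have [d2 [d20 h2]] := hv _ d0.
exists (Rmin d1 d2); split; first exact: Rmin_pos.
have := Rmin_l d1 d2; have := Rmin_r d1 d2.
by move=> m1 m2 s hs; apply: hd; [apply: h1 | apply: h2]; lra.
Qed.

(* The fundamental theorem of calculus when the derivative is only continuous on
   the open interval, with limits at both ends. *)
Lemma is_Cint_deriv_open (K dK : R -> C) a b la lb : (a < b)%R ->
  (forall t, rcont K t) ->
  (forall t, (a < t < b)%R -> rder K t (dK t) /\ rcont dK t) ->
  right_lim dK a la -> left_lim dK b lb ->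
  is_Cint dK a b (K b - K a).
Proof.
move=> ab cK hK hla hlb.
(* Extended by its one-sided limits, [dK] becomes continuous on the whole line. Its integral [I] is
   then differentiable everywhere, and the parts of [K - I] are constant by the mean value theorem,
   which needs derivatives only inside the interval. *)
pose v t := if Rle_dec t a then la else if Rle_dec b t then lb else dK t.
have vin t : (a < t < b)%R -> v t = dK t.
  by move=> h; rewrite /v; case: Rle_dec => h1 /=; [lra | case: Rle_dec => h2 //=; lra].
have vl t : (t <= a)%R -> v t = la.
  by move=> h; rewrite /v; case: Rle_dec => h1 //=; lra.
have vr t : (b <= t)%R -> v t = lb.
  by move=> h; rewrite /v; case: Rle_dec => h1 /=; [lra | case: Rle_dec => h2 //=; lra].
have cv t : rcont v t.
  move=> e e0.
  have [d1 [d10 h1]] := hla _ e0; have [d2 [d20 h2]] := hlb _ e0.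
  case: (Rlt_le_dec t a) => ta.
    exists (a - t)%R; split; first lra.
    by move=> s /Rabs_def2 hs; rewrite !vl ?Cmod_xx //; lra.
  case: (Rlt_le_dec b t) => tb.
    exists (t - b)%R; split; first lra.
    by move=> s /Rabs_def2 hs; rewrite !vr ?Cmod_xx //; lra.
  case: (Req_dec t a) => [eta|ta'].
    exists (Rmin d1 (b - a)); split; first by apply: Rmin_pos; lra.
    have := Rmin_l d1 (b - a); have := Rmin_r d1 (b - a).
    move=> m1 m2 s /Rabs_def2 hs; rewrite (vl t); last lra.
    case: (Rle_dec s a) => hsa; first by rewrite vl ?Cmod_xx.
    by rewrite vin; [apply: h1; lra | lra].
  case: (Req_dec t b) => [etb|tb'].
    exists (Rmin d2 (b - a)); split; first by apply: Rmin_pos; lra.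
    have := Rmin_l d2 (b - a); have := Rmin_r d2 (b - a).
    move=> m1 m2 s /Rabs_def2 hs; rewrite (vr t); last lra.
    case: (Rle_dec b s) => hsb; first by rewrite vr ?Cmod_xx.
    by rewrite vin; [apply: h2; lra | lra].
  have tin : (a < t < b)%R by lra.
  have [_ ct] := hK _ tin; have [d [d0 hd]] := ct _ e0.
  exists (Rmin d (Rmin (t - a) (b - t))); split.
    by apply: Rmin_pos => //; apply: Rmin_pos; lra.
  move=> s hs; have k1 := Rlt_minl hs.
  have k2 := Rlt_minr hs.
  have /Rabs_def2 k3 := Rlt_minl k2.
  have /Rabs_def2 k4 := Rlt_minr k2.
  by rewrite !vin //; [exact: hd | lra].
pose I t := Cint v a t.
have hI t : rder I t (v t).
  by apply: (@rder_Cint v); exists 1%R; split=> [|s _]; [lra | exact: cv].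
have zero (p : C -> R) : (forall x y : C, p (x - y)%C = p x - p y)%R ->
    (forall t, (a < t < b)%R -> is_derive (fun s => p (K s)) t (p (dK t))) ->
    (forall t, is_derive (fun s => p (I s)) t (p (v t))) ->
    (forall t, continuity_pt (fun s => p (K s)) t) ->
    p (I b) = p (K b - K a)%C.
  move=> plin h1 h2 h3.
  have [t ht|t ht|c [hc e]] := @MVT_gen (fun s => p (K s) - p (I s))%R a b (fun _ => 0%R).
  - rewrite Rmin_left ?Rmax_right in ht; try lra.
    rewrite -(Rminus_diag (p (dK t))) -{2}(vin t ht).
    by apply: is_derive_minus; [exact: h1 | exact: h2].
  - by apply: continuity_pt_minus; [exact: h3 | exact: is_derive_continuity_pt (h2 t)].
  have Ia : I a = 0 by rewrite /I /Cint !RInt_point.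
  have p0 : p 0 = 0%R by have := plin 0 0; rewrite (_ : 0 - 0 = 0); [lra | ring].
  by rewrite plin; move: e; rewrite Ia p0; lra.
have <- : I b = K b - K a.
  apply: C_ext; apply: zero.
  - by move=> x y; rewrite /Re /=; ring.
  - by move=> t /hK [[]].
  - by move=> t; have [] := hI t.
  - by move=> t; apply/continuity_pt_filterlim; have [] := rcont_continuous (cK t).
  - by move=> x y; rewrite /Im /=; ring.
  - by move=> t /hK [[]].
  - by move=> t; have [] := hI t.
  - by move=> t; apply/continuity_pt_filterlim; have [] := rcont_continuous (cK t).
apply: (@is_Cint_ext v) => [t|]; last by apply: is_Cint_rcont => t _; exact: cv.
by rewrite Rmin_left ?Rmax_right; try lra; exact: vin.
Qed.

Lemma is_Cint_Chasles g a b c k l :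
  is_Cint g a b k -> is_Cint g b c l -> is_Cint g a c (k + l).
Proof.
by move=> [h1 h2] [k1 k2]; split;
   [exact: is_RInt_Chasles h1 k1 | exact: is_RInt_Chasles h2 k2].
Qed.

Lemma is_Cint_deriv_piecewise (K dK : R -> C) (s : list R) :
  (forall t, rcont K t) ->
  (forall t, (exists l, left_lim dK t l) /\ (exists l, right_lim dK t l)) ->
  forall a b, (a < b)%R ->
  (forall t, (a < t < b)%R -> ~ List.In t s -> rder K t (dK t) /\ rcont dK t) ->
  is_Cint dK a b (K b - K a).
Proof.
move=> cK hlim; elim: s => [|p s IH] a b ab hs.
  have [_ [la hla]] := hlim a; have [[lb hlb] _] := hlim b.
  by apply: (is_Cint_deriv_open ab cK _ hla hlb) => t /hs; apply.
case: (Rlt_dec a p) => ap; last first.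
  by apply: IH => // t ht n; apply: hs => //= -[e|//]; lra.
case: (Rlt_dec p b) => pb; last first.
  by apply: IH => // t ht n; apply: hs => //= -[e|//]; lra.
have -> : K b - K a = (K p - K a) + (K b - K p) by ring.
apply: (@is_Cint_Chasles dK a p b).
  by apply: IH => // t ht n; apply: hs; [lra | move=> /= -[e|//]; lra].
by apply: IH => // t ht n; apply: hs; [lra | move=> /= -[e|//]; lra].
Qed.

Lemma piecewise_C1_primitive D (f H : C -> C) (g : R -> C) a b :
  (forall x, D x -> cder H x (f x)) -> (forall x, D x -> ccont f x) ->
  contour_in D g ->
  is_Cint (fun t => f (g t) * velocity g t) a b (H (g b) - H (g a)).
Proof.
move=> hH cf [[cg [s [hs1 hs2]]] hD].
have rg t : rcont g t by exact: continuous_C_rcont.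
have cfg t : rcont (fun t => f (g t)) t by apply: rcont_comp => //; exact: cf.
have nice t : ~ List.In t s -> rder g t (velocity g t) /\ rcont (velocity g) t.
  move=> /hs1 [h1 [h2 h3]]; split; last exact: continuous_C_rcont.
  by split; exact: Derive_correct.
have vlim t : (exists l, left_lim (velocity g) t l) /\ (exists l, right_lim (velocity g) t l).
  case: (List.in_dec Req_EM_T t s) => [/hs2 [[l hl] [r hr]]|/nice [_ h]].
    split.
      exists l => e e0; have /hl [d hd] : locally l (fun y => (Cmod (y - l) < e)%R).
        by apply/locally_Cmod; exists e.
      exists d; split=> [|u hu]; first exact: cond_pos.
      apply: hd; last lra; rewrite /ball /= /AbsRing_ball /abs /minus /plus /opp /=.
      by rewrite /Rabs; case: Rcase_abs; lra.
    exists r => e e0; have /hr [d hd] : locally r (fun y => (Cmod (y - r) < e)%R).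
      by apply/locally_Cmod; exists e.
    exists d; split=> [|u hu]; first exact: cond_pos.
    apply: hd; last lra; rewrite /ball /= /AbsRing_ball /abs /minus /plus /opp /=.
    by rewrite /Rabs; case: Rcase_abs; lra.
  by split; exists (velocity g t); [exact: rcont_left_lim | exact: rcont_right_lim].
have main u v : (u < v)%R ->
    is_Cint (fun t => f (g t) * velocity g t) u v (H (g v) - H (g u)).
  move=> uv; apply: (@is_Cint_deriv_piecewise (fun t => H (g t)) _ s) => //.
  - by move=> t; apply: rcont_comp => //; exact: cder_ccont (hH _ (hD t)).
  - move=> t; have [[l hl] [r hr]] := vlim t; split.
      exists (f (g t) * l); apply: left_lim_mul => //.
      by apply: (@rcont_left_lim (fun t => f (g t))).
    exists (f (g t) * r); apply: right_lim_mul => //.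
    by apply: (@rcont_right_lim (fun t => f (g t))).
  - move=> t _ /nice [h1 h2]; split; first exact: rder_comp (hH _ (hD t)) h1.
    move=> e e0; have [d [d0 hd]] := mul_near (f (g t)) (velocity g t) e0.
    have [d1 [d10 hd1]] := cfg t _ d0; have [d2 [d20 hd2]] := h2 _ d0.
    exists (Rmin d1 d2); split; first exact: Rmin_pos.
    move=> w hw; apply: hd.
      exact: hd1 (Rlt_minl hw).
    exact: hd2 (Rlt_minr hw).
case: (Rtotal_order a b) => [ab|[->|ba]]; first exact: main.
  have -> : H (g b) - H (g b) = 0 by ring.
  by split; exact: is_RInt_point.
have [h1 h2] := main _ _ ba; split.
  have -> : Re (H (g b) - H (g a)) = opp (Re (H (g a) - H (g b))).
    by rewrite /opp /Re /=; ring.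
  exact: is_RInt_swap.
have -> : Im (H (g b) - H (g a)) = opp (Im (H (g a) - H (g b))).
  by rewrite /opp /Im /=; ring.
exact: is_RInt_swap.
Qed.

(** The single point where an improper contour integral is evaluated. Both the function and the
    matrix entries of the theorem become differences of limits of a primitive, so independence of
    the path needs no separate argument. *)
Lemma contour_int_primitive D (f H : C -> C) (g : R -> C) (l0 l1 : C) :
  (forall x, D x -> cder H x (f x)) -> (forall x, D x -> ccont f x) ->
  contour_in D g ->
  (forall e : R, (0 < e)%R -> Rbar_locally m_infty (fun t => (Cmod (H (g t) - l0) < e)%R)) ->
  (forall e : R, (0 < e)%R -> Rbar_locally p_infty (fun t => (Cmod (H (g t) - l1) < e)%R)) ->
  contour_int f g = l1 - l0.
Proof.
move=> hH cf hg h0 h1.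
have h : is_RInt_gen (V := C_R_CompleteNormedModule) (fun t => f (g t) * velocity g t)
    (Rbar_locally m_infty) (Rbar_locally p_infty) (l1 - l0).
  move=> P hP; have /locally_Cmod [e [e0 he]] : locally (l1 - l0) P by exact: hP.
  have e2 : (0 < e / 2)%R by lra.
  apply: (Filter_prod _ _ _ _ _ (h0 _ e2) (h1 _ e2)) => a b ha hb.
  exists (H (g b) - H (g a)); split.
    exact: is_Cint_pair (piecewise_C1_primitive a b hH cf hg).
  apply: he.
  have -> : H (g b) - H (g a) - (l1 - l0) = (H (g b) - l1) - (H (g a) - l0) by ring.
  by apply: Rle_lt_trans (Cmod_triangle_sub _ _) _; lra.
exact: (is_RInt_gen_unique (V := C_R_CompleteNormedModule) _ _ h).
Qed.

End Contours.

(** * Cauchy's formula on circles and removable singularities *)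

Section CauchyFormula.

Local Open Scope R_scope.
Local Open Scope C_scope.

Lemma hol_const D a : copen D -> hol D (fun _ => a) (fun _ => 0).
Proof.
by move=> oD; split=> //; split=> x _; [exact: cder_const | exact: ccont_const].
Qed.

Lemma hol_id D : copen D -> hol D (fun x => x) (fun _ => 1).
Proof.
by move=> oD; split=> //; split=> x _; [exact: cder_id | exact: ccont_const].
Qed.

Lemma hol_ccont D f df x : hol D f df -> D x -> ccont f x.
Proof. by move=> [_ [h _]] /h /cder_ccont. Qed.

Lemma hol_add D f df g dg : hol D f df -> hol D g dg ->
  hol D (fun x => f x + g x) (fun x => df x + dg x).
Proof.
move=> [oD [h1 h2]] [_ [k1 k2]]; split=> //; split=> x Dx.
  by apply: cder_add; [exact: h1 | exact: k1].
by apply: ccont_add; [exact: h2 | exact: k2].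
Qed.

Lemma hol_mul D f df g dg : hol D f df -> hol D g dg ->
  hol D (fun x => f x * g x) (fun x => df x * g x + f x * dg x).
Proof.
move=> hf hg; have [oD [h1 h2]] := hf; have [_ [k1 k2]] := hg.
split=> //; split=> x Dx; first by apply: cder_mul; [exact: h1 | exact: k1].
apply: ccont_add; apply: ccont_mul.
- exact: h2.
- exact: hol_ccont hg Dx.
- exact: hol_ccont hf Dx.
- exact: k2.
Qed.

Lemma hol_scal D f df a : hol D f df -> hol D (fun x => a * f x) (fun x => a * df x).
Proof.
move=> [oD [h1 h2]]; split=> //; split=> x Dx; first exact: cder_scal (h1 _ Dx).
by apply: ccont_mul; [exact: ccont_const | exact: h2].
Qed.

Lemma hol_inv D f df : hol D f df -> (forall x, D x -> f x <> 0) ->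
  hol D (fun x => / f x) (fun x => - df x / (f x * f x)).
Proof.
move=> hf n; have [oD [h1 h2]] := hf; split=> //; split=> x Dx.
  by apply: cder_inv; [exact: h1 | exact: n].
have cf := hol_ccont hf Dx.
apply: (@ccont_mul (fun x => - df x) (fun x => / (f x * f x))).
  apply: (@ccont_ext_loc (fun x => - (1) * df x)).
    by exists 1%R; split=> [|y _]; [lra | ring].
  by apply: ccont_mul; [exact: ccont_const | exact: h2].
apply: (@ccont_comp (fun x => f x * f x) Cinv); first exact: ccont_mul.
by apply: ccont_inv; apply: Cmult_neq_0; exact: n.
Qed.

Lemma hol_Cexp D f df : hol D f df -> hol D (fun x => Cexp (f x)) (fun x => Cexp (f x) * df x).
Proof.
move=> hf; have [oD [h1 h2]] := hf; split=> //; split=> x Dx.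
  by apply: (cder_comp (h1 _ Dx)); exact: cder_Cexp.
apply: ccont_mul; last exact: h2.
by apply: (@ccont_comp f Cexp); [exact: hol_ccont hf Dx | exact: ccont_Cexp].
Qed.

Lemma hol_sub (D D' : C -> Prop) f df : copen D' -> (forall x, D' x -> D x) ->
  hol D f df -> hol D' f df.
Proof.
by move=> oD' h [_ [h1 h2]]; split=> //; split=> x /h; [exact: h1 | exact: h2].
Qed.

Lemma hol_ext D f g df : (forall x, D x -> f x = g x) -> hol D f df -> hol D g df.
Proof.
move=> e [oD [h1 h2]]; split=> //; split=> // x Dx.
apply: (@cder_ext_loc f); last exact: h1.
by have [d [d0 hd]] := oD _ Dx; exists d; split=> // y /hd /e.
Qed.

Lemma copen_and (D D' : C -> Prop) : copen D -> copen D' -> copen (fun x => D x /\ D' x).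
Proof.
move=> h h' x [/h [d [d0 hd]] /h' [d' [d0' hd']]].
exists (Rmin d d'); split; first exact: Rmin_pos.
move=> y hy; split; first exact: hd (Rlt_minl hy).
exact: hd' (Rlt_minr hy).
Qed.

Lemma copen_ball (a : C) (r : R) : copen (fun x => (Cmod (x - a) < r)%R).
Proof.
move=> x hx; exists (r - Cmod (x - a))%R; split; first lra.
move=> y hy; have -> : y - a = (y - x) + (x - a) by ring.
by apply: Rle_lt_trans (Cmod_triangle _ _) _; lra.
Qed.

Lemma copen_neq (a : C) : copen (fun x => x <> a).
Proof.
move=> x hx; have h : x - a <> 0 by move=> h; apply: hx; rewrite -(Cplus_0_l a) -h; ring.
exists (Cmod (x - a)); split; first exact/Cmod_gt_0.
by move=> y hy e; move: hy; rewrite e Cmod_sub_sym; lra.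
Qed.

Lemma sub_neq0 (x y : C) : x <> y -> x - y <> 0.
Proof. by move=> n h; apply: n; rewrite -(Cplus_0_l y) -h; ring. Qed.

Definition cis (t : R) : C := Cexp (Ci * t).

Lemma Cmod_cis t : Cmod (cis t) = 1%R.
Proof. by rewrite Cmod_Cexp -exp_0; congr exp; rewrite /Re /=; ring. Qed.

Lemma cis_2PI : cis (2 * PI) = cis 0.
Proof.
have e : cis (2 * PI) = (cos (2 * PI), sin (2 * PI)).
  apply: C_ext; rewrite /cis /Cexp /Re /Im /= ?Rmult_0_l ?Rmult_1_l ?Rminus_diag ?Rplus_0_l ?exp_0;
    ring.
rewrite e cos_2PI sin_2PI; apply: C_ext;
  by rewrite /cis /Cexp /Re /Im /= !Rmult_0_l Rmult_1_l Rminus_diag Rplus_0_l ?exp_0 ?cos_0 ?sin_0; ring.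
Qed.

Lemma rder_RtoC (t : R) : rder RtoC t 1.
Proof. by split; rewrite /Re /Im /=; auto_derive. Qed.

Lemma rder_cis t : rder cis t (Ci * cis t).
Proof.
have h : cder (fun w => Cexp (Ci * w)) t (cis t * (Ci * 1)).
  apply: (@cder_comp (fun w => Ci * w)); last exact: cder_Cexp.
  exact: cder_scal (@cder_id _).
have := rder_comp h (rder_RtoC t).
by rewrite (_ : cis t * (Ci * 1) * 1 = Ci * cis t); last ring.
Qed.

Lemma RtoC_neq0 (r : R) : r <> 0%R -> RtoC r <> 0.
Proof. by move=> h /RtoC_inj. Qed.

(** The integral is taken in the angle, without the factor [dw]: it is [2 PI] times the mean of [q]
    over the circle. *)
Definition circle_int (q : C -> C) (a : C) (r : R) : C :=
  Cint (fun t => q (a + r * cis t)) 0 (2 * PI).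

Lemma circle_mod (a : C) r t : (0 <= r)%R -> Cmod (a + RtoC r * cis t - a) = r.
Proof.
move=> r0; have -> : a + RtoC r * cis t - a = RtoC r * cis t by ring.
by rewrite Cmod_mult Cmod_R Cmod_cis Rabs_pos_eq; lra.
Qed.

Lemma circle_near (a : C) (r t e : R) : (0 < e)%R -> exists d : R, (0 < d)%R /\
  forall u v, (Rabs (u - r) < d)%R -> (Rabs (v - t) < d)%R ->
    (Cmod (a + RtoC u * cis v - (a + RtoC r * cis t)) < e)%R.
Proof.
move=> e0; have [d [d0 hd]] := mul_near (RtoC r) (cis t) e0.
have [d' [d0' hd']] := rder_rcont (rder_cis t) d0.
exists (Rmin d d'); split; first exact: Rmin_pos.
move=> u v hu hv.
have -> : a + RtoC u * cis v - (a + RtoC r * cis t) = RtoC u * cis v - RtoC r * cis t.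
  by ring.
apply: hd; last exact: hd' (Rlt_minr hv).
by rewrite -RtoC_minus Cmod_R; exact: Rlt_minl hu.
Qed.

Lemma circle_near_cont (f : C -> C) (a : C) (r t e : R) :
  ccont f (a + RtoC r * cis t) -> (0 < e)%R -> exists d : R, (0 < d)%R /\
  forall u v, (Rabs (u - r) < d)%R -> (Rabs (v - t) < d)%R ->
    (Cmod (f (a + RtoC u * cis v)%C - f (a + RtoC r * cis t)%C) < e)%R.
Proof.
move=> hf /hf [d [d0 hd]]; have [d' [d0' hd']] := @circle_near a r t _ d0.
by exists d'; split=> // u v hu hv; apply: hd; exact: hd'.
Qed.

Lemma rder_circle_angle (a : C) r t : rder (fun v => a + RtoC r * cis v) t (r * (Ci * cis t)).
Proof.
apply: (@rder_comp (fun w => a + RtoC r * w) cis t (RtoC r)); last exact: rder_cis.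
have := cder_add (cder_const a (cis t)) (cder_scal (RtoC r) (cder_id (cis t))).
by rewrite (_ : 0 + RtoC r * 1 = RtoC r); last ring.
Qed.

Lemma rder_circle_radius (a : C) r t : rder (fun u : R => a + RtoC u * cis t) r (cis t).
Proof.
have h : cder (fun w => a + w * cis t) r (0 + (1 * cis t + r * 0)).
  apply: cder_add; first exact: cder_const.
  by apply: cder_mul; [exact: cder_id | exact: cder_const].
have := rder_comp h (rder_RtoC r).
by rewrite (_ : (0 + (1 * cis t + r * 0)) * 1 = cis t); last ring.
Qed.

Lemma rcont_mul g k t : rcont g t -> rcont k t -> rcont (fun s => g s * k s) t.
Proof.
move=> hg hk e e0; have [d [d0 hd]] := mul_near (g t) (k t) e0.
have [d1 [d10 h1]] := hg _ d0; have [d2 [d20 h2]] := hk _ d0.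
exists (Rmin d1 d2); split; first exact: Rmin_pos.
move=> s hs; apply: hd.
  exact: h1 (Rlt_minl hs).
exact: h2 (Rlt_minr hs).
Qed.

(* The radial derivative of the integrand is, up to a constant factor, its
   angular derivative. *)
Lemma circle_int_der D q dq a r : hol D q dq -> (0 < r)%R ->
  (forall t, D (a + r * cis t)) -> rder (circle_int q a) r 0.
Proof.
move=> [oD [hq cdq]] r0 hD.
have rn0 : RtoC r <> 0 by apply: RtoC_neq0; lra.
have I0 : is_Cint (fun t => dq (a + r * cis t) * cis t) 0 (2 * PI) 0.
  have -> : (0 : C) = / (Ci * r) * (q (a + r * cis (2 * PI)) - q (a + r * cis 0)).
    by rewrite cis_2PI; ring.
  have Cir : Ci * r <> 0 by apply: Cmult_neq_0 => // -[] /R1_neq_R0.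
  have h : is_Cint (fun t => dq (a + r * cis t) * (r * (Ci * cis t))) 0 (2 * PI)
      (q (a + r * cis (2 * PI)) - q (a + r * cis 0)).
    apply: (is_Cint_deriv (g := fun t => q (a + r * cis t))) => t _.
      exact: rder_comp (hq _ (hD t)) (rder_circle_angle a r t).
    apply: rcont_mul.
      apply: (@rcont_comp dq (fun t => a + r * cis t)); first exact: cdq.
      exact: rder_rcont (rder_circle_angle a r t).
    apply: rcont_scal; apply: rcont_scal; exact: rder_rcont (rder_cis t).
  apply: is_Cint_ext (is_Cint_scal (/ (Ci * r)) h) => t _.
  by field; split=> // -[] /R1_neq_R0.
rewrite -(is_Cint_unique I0).
apply: (@rder_Cint_param (fun u t => q (a + RtoC u * cis t))
   (fun u t => dq (a + RtoC u * cis t) * cis t)).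
  move=> t _; have [d [d0 hd]] := oD _ (hD t).
  have [d' [d0' hd']] := @circle_near a r t _ d0; exists d'; split=> // u v hu hv.
  have Duv : D (a + RtoC u * cis v) by apply: hd; exact: hd'.
  split; first exact: rder_comp (hq _ Duv) (rder_circle_radius a u v).
  exact: rder_rcont (rder_comp (hq _ Duv) (rder_circle_angle a u v)).
move=> t _ e e0; have [d [d0 hd]] := mul_near (dq (a + r * cis t)) (cis t) e0.
have [d1 [d10 h1]] := circle_near_cont (cdq _ (hD t)) d0.
have [d2 [d20 h2]] := rder_rcont (rder_cis t) d0.
exists (Rmin d1 d2); split; first exact: Rmin_pos.
have := Rmin_l d1 d2; have := Rmin_r d1 d2 => m1 m2 u v hu hv.
by apply: hd; [apply: h1; lra | apply: h2; lra].
Qed.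

Lemma circle_int_is q a r : (forall t, ccont q (a + RtoC r * cis t)) ->
  is_Cint (fun t => q (a + r * cis t)) 0 (2 * PI) (circle_int q a r).
Proof.
move=> h; apply: is_Cint_rcont => t _.
apply: (@rcont_comp q (fun t => a + r * cis t)); first exact: h.
exact: rder_rcont (rder_circle_angle a r t).
Qed.

Lemma is_Cint_sub (g k : R -> C) a b l m :
  is_Cint g a b l -> is_Cint k a b m -> is_Cint (fun t => g t - k t) a b (l - m).
Proof.
move=> h1 h2; apply: (@is_Cint_ext (fun t => g t + - (1) * k t)).
  by move=> t _; ring.
have -> : l - m = l + - (1) * m by ring.
exact: is_Cint_add h1 (is_Cint_scal _ h2).
Qed.

Lemma circle_int_rcont q a r : (exists d : R, (0 < d)%R /\
    forall u t, (Rabs (u - r) < d)%R -> ccont q (a + RtoC u * cis t)) ->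
  rcont (circle_int q a) r.
Proof.
move=> [d0 [d00 h0]] e e0.
have rr : (Rabs (r - r) < d0)%R by rewrite Rminus_diag Rabs_R0.
have pi0 := PI_RGT_0.
set e' := (e / (4 * PI))%R; have e'0 : (0 < e')%R by apply: Rdiv_lt_0_compat; lra.
have e2 : (0 < e' / 2)%R by lra.
have [|d [d_0 hd]] := @tube (fun u v =>
    (Cmod (q (a + RtoC u * cis v)%C - q (a + RtoC r * cis v)%C) < e')%R) 0 (2 * PI) r.
  move=> t _; have [d [d_0 hd]] := circle_near_cont (h0 r t rr) e2.
  exists d; split=> // u v hu hv.
  have -> : q (a + RtoC u * cis v) - q (a + RtoC r * cis v) =
    (q (a + RtoC u * cis v) - q (a + RtoC r * cis t)) -
    (q (a + RtoC r * cis v) - q (a + RtoC r * cis t)) by ring.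
  apply: Rle_lt_trans (Cmod_triangle_sub _ _) _.
  have := hd u v hu hv; have := hd r v _ hv.
  by rewrite Rminus_diag Rabs_R0 => /(_ d_0); lra.
exists (Rmin d d0); split; first exact: Rmin_pos.
move=> u hu.
have i1 := circle_int_is (fun t => h0 u t (Rlt_minr hu)).
have i2 := circle_int_is (fun t => h0 r t rr).
apply: Rle_lt_trans (Cint_bound (M := e') _ _ (is_Cint_sub i1 i2)) _.
- lra.
- move=> t ht; apply: Rlt_le; apply: hd => //.
  exact: Rlt_minl hu.
- rewrite /e' (_ : e / (4 * PI) * (2 * PI - 0) = e / 2)%R; [lra | field; lra].
Qed.

Lemma rder_zero_const_open (K : R -> C) a b : (a < b)%R ->
  (forall t, (a <= t <= b)%R -> rcont K t) ->
  (forall t, (a < t < b)%R -> rder K t 0) -> K a = K b.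
Proof.
move=> ab cK hK.
have zero (p : R -> R) : (forall t, (a <= t <= b)%R -> continuity_pt p t) ->
    (forall t, (a < t < b)%R -> is_derive p t 0%R) -> p a = p b.
  move=> h1 h2; have [t ht|t ht|c [hc e]] := @MVT_gen p a b (fun _ => 0%R).
  - by apply: h2; rewrite Rmin_left ?Rmax_right in ht; lra.
  - by apply: h1; rewrite Rmin_left ?Rmax_right in ht; lra.
  lra.
apply: C_ext.
  apply: (zero (fun t => Re (K t))) => t ht; last by have [] := hK t ht.
  by apply/continuity_pt_filterlim; have [] := rcont_continuous (cK t ht).
apply: (zero (fun t => Im (K t))) => t ht; last by have [] := hK t ht.
by apply/continuity_pt_filterlim; have [] := rcont_continuous (cK t ht).
Qed.

Lemma is_Cint_const (u : C) a b : is_Cint (fun _ => u) a b (u * (b - a)%R).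
Proof.
split.
  have -> : Re (u * (b - a)%R) = scal (b - a)%R (Re u).
    by rewrite /scal /= /mult /Re /=; ring.
  exact: is_RInt_const.
have -> : Im (u * (b - a)%R) = scal (b - a)%R (Im u).
  by rewrite /scal /= /mult /Im /=; ring.
exact: is_RInt_const.
Qed.

Lemma rcont_bounded (W : R -> C) a b : (a <= b)%R -> (forall t, rcont W t) ->
  exists M : R, (0 < M)%R /\ forall t, (a <= t <= b)%R -> (Cmod (W t) <= M)%R.
Proof.
move=> ab cW.
have [|m [hm _]] := @continuity_ab_maj (fun t => Cmod (W t)) a b ab.
  move=> c _ e e0; have [d [d0 hd]] := cW c e e0; exists d; split=> // x [_ hx].
  apply: Rle_lt_trans (hd x hx); rewrite /= /Rdist.
  apply: Rabs_le; have := Cmod_ge_sub (W x) (W c); have := Cmod_ge_sub (W c) (W x).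
  by rewrite (Cmod_sub_sym (W c)); lra.
exists (1 + Cmod (W m))%R; split; first by have := Cmod_ge_0 (W m); lra.
by move=> t /hm; lra.
Qed.

Lemma rcont_inv g t : rcont g t -> g t <> 0 -> rcont (fun s => / g s) t.
Proof. by move=> hg n; apply: (@rcont_comp Cinv g) => //; exact: ccont_inv. Qed.

Lemma rcont_sub g x t : rcont g t -> rcont (fun s => g s - x) t.
Proof.
move=> hg; apply: (@rcont_comp (fun y => y + - x) g) => //.
by apply: ccont_add; [exact: ccont_id | exact: ccont_const].
Qed.

(** Uniform estimates for the inverse on moduli at least [m]: Lipschitz bound, first-order Taylor
    remainder, and Lipschitz bound for the square of the inverse. The last two give the derivative
    of a Cauchy integral and the continuity of that derivative. *)
Lemma inv_diff_bound (A B : C) (m : R) : (0 < m)%R -> (m <= Cmod A)%R -> (m <= Cmod B)%R ->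
  (Cmod (/ A - / B) <= / m * / m * Cmod (A - B))%R /\
  (Cmod (/ A - / B + (A - B) * (/ B * / B)) <= / m * / m * / m * (Cmod (A - B) * Cmod (A - B)))%R /\
  (Cmod (/ A * / A - / B * / B) <= / m * / m * Cmod (A - B) * (/ m + / m))%R.
Proof.
move=> m0 hA hB.
have A0 : A <> 0 by apply/Cmod_gt_0; lra.
have B0 : B <> 0 by apply/Cmod_gt_0; lra.
have im0 : (0 <= / m)%R by apply/Rlt_le/Rinv_0_lt_compat.
have iA : (Cmod (/ A) <= / m)%R by rewrite Cmod_inv //; apply: Rinv_le_contravar.
have iB : (Cmod (/ B) <= / m)%R by rewrite Cmod_inv //; apply: Rinv_le_contravar.
have pA := Cmod_ge_0 (/ A); have pB := Cmod_ge_0 (/ B); have p := Cmod_ge_0 (A - B).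
have k1 : (Cmod (/ A - / B) <= / m * / m * Cmod (A - B))%R.
  have -> : / A - / B = / A * / B * - (A - B) by field.
  rewrite !Cmod_mult Cmod_opp; apply: Rmult_le_compat_r => //.
  exact: Rmult_le_compat.
split=> //; split.
  have -> : / A - / B + (A - B) * (/ B * / B) = / A * / B * / B * ((A - B) * (A - B)) by field.
  rewrite !Cmod_mult; apply: Rmult_le_compat_r; first exact: Rmult_le_pos.
  by repeat apply: Rmult_le_compat => //; exact: Rmult_le_pos.
have -> : / A * / A - / B * / B = (/ A - / B) * (/ A + / B) by ring.
rewrite Cmod_mult; apply: Rmult_le_compat => //; try exact: Cmod_ge_0.
by apply: Rle_trans (Cmod_triangle _ _) _; lra.
Qed.

(** The kernel is differentiated under the integral by the explicit estimates of [inv_diff_bound],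
    so the density [W] need only be continuous on the circle. *)
Lemma cauchy_kernel_hol (W : R -> C) a r : (0 < r)%R -> (forall t, rcont W t) ->
  hol (fun x => (Cmod (x - a) < r)%R)
    (fun x => Cint (fun t => W t * / (a + r * cis t - x)) 0 (2 * PI))
    (fun x => Cint (fun t => W t * (/ (a + r * cis t - x) * / (a + r * cis t - x))) 0 (2 * PI)).
Proof.
move=> r0 cW; have pi0 := PI_RGT_0; have pi2 : (0 <= 2 * PI)%R by lra.
have [M [M0 hM]] := rcont_bounded pi2 cW.
have low x m t : (Cmod (x - a) <= r - m)%R -> (m <= Cmod (a + RtoC r * cis t - x))%R.
  move=> hx; have := Cmod_ge_sub (a + RtoC r * cis t - a) (x - a).
  rewrite circle_mod; last lra.
  by rewrite (_ : a + r * cis t - a - (x - a) = a + r * cis t - x); [lra | ring].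
have ck x t : (Cmod (x - a) < r)%R -> rcont (fun t => / (a + RtoC r * cis t - x)) t.
  move=> hx; apply: (@rcont_inv (fun t => a + RtoC r * cis t - x)).
    apply: (@rcont_sub (fun t => a + RtoC r * cis t)).
    exact: rder_rcont (rder_circle_angle a r t).
  by apply/Cmod_gt_0; have := @low x (r - Cmod (x - a))%R t; lra.
have i1 x : (Cmod (x - a) < r)%R -> is_Cint (fun t => W t * / (a + RtoC r * cis t - x)) 0 (2 * PI)
    (Cint (fun t => W t * / (a + RtoC r * cis t - x)) 0 (2 * PI)).
  by move=> hx; apply: is_Cint_rcont => t _; apply: rcont_mul => //; exact: ck.
have i2 x : (Cmod (x - a) < r)%R -> is_Cint (fun t => W t * (/ (a + RtoC r * cis t - x) * / (a + RtoC r * cis t - x))) 0 (2 * PI)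
    (Cint (fun t => W t * (/ (a + RtoC r * cis t - x) * / (a + RtoC r * cis t - x))) 0 (2 * PI)).
  by move=> hx; apply: is_Cint_rcont => t _; apply: rcont_mul => //; apply: rcont_mul; exact: ck.
split; first exact: copen_ball.
split=> x hx e e0.
  (* [2 * m] is the distance from [x] to the circle; for [y] within [m] of [x], both denominators
     have modulus at least [m]. *)
  have [m [m0 hm]] : exists m : R, (0 < m)%R /\ (r = Cmod (x - a) + 2 * m)%R.
    by exists ((r - Cmod (x - a)) / 2)%R; split; lra.
  have im0 := Rinv_0_lt_compat _ m0.
  set N := (2 * PI * (M * (/ m * / m * / m)))%R.
  have hN : (0 < N)%R.
    apply: Rmult_lt_0_compat; first lra.
    apply: Rmult_lt_0_compat => //; apply: Rmult_lt_0_compat => //.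
    exact: Rmult_lt_0_compat.
  exists (Rmin m (e / N)); split; first by apply: Rmin_pos => //; exact: Rdiv_lt_0_compat.
  move=> y hy; have h1 := Rlt_minl hy.
  have h2 := Rlt_minr hy.
  have hya : (Cmod (y - a) <= r - m)%R.
    have -> : y - a = (y - x) + (x - a) by ring.
    by apply: Rle_trans (Cmod_triangle _ _) _; lra.
  have hxa : (Cmod (x - a) <= r - m)%R by lra.
  have hyr : (Cmod (y - a) < r)%R by lra.
  have I := is_Cint_sub (is_Cint_sub (i1 y hyr) (i1 x hx)) (is_Cint_scal (y - x) (i2 x hx)).
  rewrite (Cmult_comm (Cint _ _ _)).
  apply: Rle_trans (Cint_bound (M := M * (/ m * / m * / m * (Cmod (y - x) * Cmod (y - x)))) pi2 _ I) _.
    move=> t ht.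
    have [_ [k _]] := inv_diff_bound m0 (low y m t hya) (low x m t hxa).
    set A := a + r * cis t - y in k *; set B := a + r * cis t - x in k *.
    have e1 : y - x = - (A - B) by rewrite /A /B; ring.
    have -> : W t * / A - W t * / B - (y - x) * (W t * (/ B * / B)) =
        W t * (/ A - / B + (A - B) * (/ B * / B)) by rewrite e1; ring.
    rewrite e1 Cmod_opp Cmod_mult; apply: Rmult_le_compat => //; try exact: Cmod_ge_0.
    exact: hM.
  move/(Rlt_div_r _ _ _ hN): h2 => h2.
  have := Rmult_le_compat_r _ _ _ (Cmod_ge_0 (y - x)) (Rlt_le _ _ h2).
  by apply: Rle_trans; apply: Req_le; rewrite /N; ring.
have [m [m0 hm]] : exists m : R, (0 < m)%R /\ (r = Cmod (x - a) + 2 * m)%R.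
    by exists ((r - Cmod (x - a)) / 2)%R; split; lra.
have im0 := Rinv_0_lt_compat _ m0.
set N := (2 * PI * (M * (/ m * / m * (/ m + / m))))%R.
have hN : (0 < N)%R.
  apply: Rmult_lt_0_compat; first lra.
  apply: Rmult_lt_0_compat => //; apply: Rmult_lt_0_compat; last lra.
  exact: Rmult_lt_0_compat.
exists (Rmin m (e / N)); split; first by apply: Rmin_pos => //; exact: Rdiv_lt_0_compat.
move=> y hy; have h1 := Rlt_minl hy.
have h2 := Rlt_minr hy.
have hya : (Cmod (y - a) <= r - m)%R.
  have -> : y - a = (y - x) + (x - a) by ring.
  by apply: Rle_trans (Cmod_triangle _ _) _; lra.
have hxa : (Cmod (x - a) <= r - m)%R by lra.
have hyr : (Cmod (y - a) < r)%R by lra.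
apply: Rle_lt_trans (Cint_bound (M := M * (/ m * / m * Cmod (y - x) * (/ m + / m))) pi2 _
  (is_Cint_sub (i2 y hyr) (i2 x hx))) _.
  move=> t ht.
  have [_ [_ k]] := inv_diff_bound m0 (low y m t hya) (low x m t hxa).
  set A := a + r * cis t - y in k *; set B := a + r * cis t - x in k *.
  have e1 : y - x = - (A - B) by rewrite /A /B; ring.
  have -> : W t * (/ A * / A) - W t * (/ B * / B) = W t * (/ A * / A - / B * / B) by ring.
  rewrite e1 Cmod_opp Cmod_mult; apply: Rmult_le_compat => //; try exact: Cmod_ge_0.
  exact: hM.
move/(Rlt_div_r _ _ _ hN): h2.
by apply: Rle_lt_trans; apply: Req_le; rewrite /N; ring.
Qed.

Lemma is_Cint_circle_angle a r t : rcont (fun t => a + RtoC r * cis t) t.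
Proof. exact: rder_rcont (rder_circle_angle a r t). Qed.

(** The derivative with respect to [x] is the integral over a full turn of an exact angular
    derivative, hence [0]. The value is therefore the one at the centre, where the integrand is
    [1]. *)
Lemma circle_winding a x r : (0 < r)%R -> (Cmod (x - a) < r)%R ->
  Cint (fun t => RtoC r * cis t * / (a + r * cis t - x)) 0 (2 * PI) = (2 * PI)%R.
Proof.
move=> r0 hx.
have cW t : rcont (fun t => RtoC r * cis t) t.
  by apply: rcont_scal; exact: rder_rcont (rder_cis t).
have [_ [hN _]] := cauchy_kernel_hol a r0 cW.
set N := (fun x => Cint _ 0 (2 * PI)) in hN.
have rn0 : RtoC r <> 0 by apply: RtoC_neq0; lra.
have den y t : (Cmod (y - a) < r)%R -> a + RtoC r * cis t - y <> 0.
  move=> hy; apply/Cmod_gt_0; have := Cmod_ge_sub (a + RtoC r * cis t - a) (y - a).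
  rewrite circle_mod; last lra.
  by rewrite (_ : a + r * cis t - a - (y - a) = a + r * cis t - y); [lra | ring].
have N0 y : (Cmod (y - a) < r)%R -> cder N y 0.
  move=> hy; have := hN y hy; set dN := Cint _ _ _.
  suff -> : dN = 0 by [].
  apply: is_Cint_unique.
  have h : is_Cint (fun t => - / ((a + r * cis t - y) * (a + r * cis t - y)) * (r * (Ci * cis t)))
     0 (2 * PI) (/ (a + r * cis (2 * PI) - y) - / (a + r * cis 0 - y)).
    apply: (is_Cint_deriv (g := fun t => / (a + r * cis t - y))) => t _.
      have h : cder (fun w => / (w - y)) (a + r * cis t)
         (- (1 + - 0) / ((a + r * cis t - y) * (a + r * cis t - y))).
        apply: (@cder_inv (fun w => w - y)); last exact: den.
        apply: (@cder_add (fun w => w) (fun _ => - y)); first exact: cder_id.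
        by rewrite (_ : - 0 = 0); [exact: cder_const | ring].
      have := rder_comp h (rder_circle_angle a r t).
      rewrite (_ : - (1 + - 0) / _ = - / ((a + r * cis t - y) * (a + r * cis t - y))) //.
      by rewrite /Cdiv; ring.
    apply: rcont_mul; last by apply: rcont_scal; apply: rcont_scal; exact: rder_rcont (rder_cis t).
    apply: (@rcont_comp (fun w => - w) (fun t => / ((a + r * cis t - y) * (a + r * cis t - y)))).
      apply: (@ccont_ext_loc (fun w => - (1) * w)).
        by exists 1%R; split=> [|w _]; [lra | ring].
      by apply: ccont_mul; [exact: ccont_const | exact: ccont_id].
    apply: (@rcont_inv (fun t => (a + r * cis t - y) * (a + r * cis t - y))).
      by apply: rcont_mul; apply: (@rcont_sub (fun t => a + r * cis t)); exact: is_Cint_circle_angle.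
    by apply: Cmult_neq_0; exact: den.
  have -> : (0 : C) = Ci * (/ (a + r * cis (2 * PI) - y) - / (a + r * cis 0 - y)).
    by rewrite cis_2PI; ring.
  apply: is_Cint_ext (is_Cint_scal Ci h) => t _.
  have hi : Ci * Ci = - (1) by apply: C_ext; rewrite /Re /Im /=; ring.
  have n := den y t hy.
  transitivity (- (Ci * Ci) * (r * cis t * (/ ((a + r * cis t - y) * (a + r * cis t - y))))).
    by ring.
  by rewrite hi; field.
have e : N a = N x.
  rewrite -[x](_ : a + RtoC 1 * (x - a) = x); last ring.
  rewrite -{1}[a](_ : a + RtoC 0 * (x - a) = a); last ring.
  apply: (@rder_zero_const (fun s : R => N (a + RtoC s * (x - a))) 0 1) => s.
  rewrite Rmin_left ?Rmax_right; try lra; move=> hs.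
  have h : cder (fun w : C => a + w * (x - a)) s (0 + (1 * (x - a) + s * 0)).
    apply: cder_add; first exact: cder_const.
    by apply: cder_mul; [exact: cder_id | exact: cder_const].
  have hd := rder_comp h (rder_RtoC s).
  have := rder_comp (N0 (a + s * (x - a)) _) hd; rewrite Cmult_0_l; apply.
  have -> : a + RtoC s * (x - a) - a = RtoC s * (x - a) by ring.
  rewrite Cmod_mult Cmod_R Rabs_pos_eq; last lra.
  by have := Rmult_le_compat_r _ _ _ (Cmod_ge_0 (x - a)) (proj2 hs); lra.
rewrite -[LHS]/(N x) -e; apply: is_Cint_unique.
apply: (@is_Cint_ext (fun _ => 1)).
  move=> t _; have n : RtoC r * cis t <> 0.
    by apply: Cmult_neq_0 => //; exact: Cexp_neq0.
  by rewrite (_ : a + r * cis t - a = r * cis t); [rewrite Cinv_r | ring].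
have := is_Cint_const 1 0 (2 * PI).
by rewrite Rminus_0_r Cmult_1_l.
Qed.

(* Riemann's theorem. The circle average of [(w - a) (P w - P x) / (w - x)] does
   not depend on the radius, and tends to 0 with it. *)
Lemma removable_singularity (P dP : C -> C) (a : C) (rho : R) : (0 < rho)%R ->
  hol (fun x => (0 < Cmod (x - a) < rho)%R) P dP ->
  (forall e : R, (0 < e)%R -> exists d : R, (0 < d)%R /\ forall x,
     (0 < Cmod (x - a) < d)%R -> (Cmod ((x - a) * P x) < e)%R) ->
  exists (Q dQ : C -> C) (r : R), (0 < r)%R /\
    hol (fun x => (Cmod (x - a) < r)%R) Q dQ /\
    (forall x, (0 < Cmod (x - a) < r)%R -> Q x = P x).
Proof.
move=> rho0 hP hlim; have [r [r0 rrho]] : exists r, (0 < r < rho)%R /\ (r < rho)%R.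
  by exists (rho / 2)%R; lra.
have {}r0 : (0 < r)%R by lra.
have onr t : (0 < Cmod (a + RtoC r * cis t - a) < rho)%R.
  by rewrite circle_mod; lra.
pose W t := RtoC r * cis t * P (a + RtoC r * cis t).
have cW t : rcont W t.
  apply: rcont_mul; first by apply: rcont_scal; exact: rder_rcont (rder_cis t).
  apply: (@rcont_comp P (fun t => a + r * cis t)); last exact: is_Cint_circle_angle.
  exact: hol_ccont hP (onr t).
pose T x := Cint (fun t => W t * / (a + r * cis t - x)) 0 (2 * PI).
have pi0 := PI_RGT_0.
have pin0 : RtoC (2 * PI) <> 0 by apply: RtoC_neq0; lra.
have hT := hol_scal (/ RtoC (2 * PI)) (cauchy_kernel_hol a r0 cW).
exists (fun x => / RtoC (2 * PI) * T x); eexists; exists r; split=> //; split; first exact: hT.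
move=> x [x0 xr].
suff e : T x = P x * RtoC (2 * PI) by rewrite e; field.
have xin : (0 < Cmod (x - a) < rho)%R by lra.
have xa : x <> a by move=> e; move: x0; rewrite e Cmod_xx; lra.
(* [S] is the Caratheodory slope of [P] at [x]: it equals [(P w - P x) / (w - x)] off [x] and is
   continuous at [x], which makes [q] continuous there too. *)
have := proj1 (proj2 hP) x xin => /cder_slope [S [hS [_ cSx]]].
pose D w := (0 < Cmod (w - a) < rho)%R /\ w <> x.
have oD : copen D.
  by apply: copen_and; [case: hP | exact: copen_neq].
have Sq w : w <> x -> S w = (P w + - P x) * / (w + - x).
  by move=> n; rewrite (hS w); have := sub_neq0 n; rewrite /Cminus => n'; field.
have DP w : D w -> (0 < Cmod (w - a) < rho)%R by case.
have hq : exists dq, hol D (fun w => (w + - a) * S w) dq.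
  have h1 := hol_add (hol_sub oD DP hP) (hol_const (- P x) oD).
  have h2 := hol_inv (hol_add (hol_id oD) (hol_const (- x) oD)) (fun w h => sub_neq0 (proj2 h)).
  have h3 := hol_mul (hol_add (hol_id oD) (hol_const (- a) oD)) (hol_mul h1 h2).
  eexists; apply: hol_ext h3 => w [_ n]; rewrite (Sq w n); ring.
have [dq {}hq] := hq; set q := (fun w => _) in hq.
have cq w : (Cmod (w - a) < rho)%R -> ccont q w.
  move=> hw; case: (Ceq_dec w x) => [->|wx].
    apply: ccont_mul => //; apply: ccont_add; [exact: ccont_id | exact: ccont_const].
  case: (Ceq_dec w a) => [->|wa]; last first.
    apply: (hol_ccont hq); split=> //; split=> //.
    by apply/Cmod_gt_0; exact: sub_neq0.
  (* Continuity of [q] at [a] is where the growth hypothesis enters: [(w - a) * P w] and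
     [(w - a) * P x] tend to [0], while [w - x] keeps modulus at least [m = |x - a| / 2]. *)
  move=> e e0.
  have qa : q a = 0 by rewrite /q; ring.
  have [m [m0 hm]] : exists m : R, (0 < m)%R /\ (Cmod (x - a) = 2 * m)%R.
    by exists (Cmod (x - a) / 2)%R; split; lra.
  have em0 : (0 < e * m / 2)%R by apply: Rdiv_lt_0_compat; [exact: Rmult_lt_0_compat | lra].
  have [d [d0 hd]] := hlim _ em0.
  have hN : (0 < 1 + Cmod (P x))%R by have := Cmod_ge_0 (P x); lra.
  exists (Rmin m (Rmin d (e * m / 2 / (1 + Cmod (P x))))); split.
    by repeat apply: Rmin_pos => //; apply: Rdiv_lt_0_compat.
  move=> y hy; have h1 := Rlt_minl hy.
  have h2 := Rlt_minr hy.
  have h3 := Rlt_minl h2.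
  have h4 := Rlt_minr h2.
  rewrite qa (_ : q y - 0 = q y); last ring.
  case: (Ceq_dec y a) => [->|ya]; first by rewrite qa Cmod_0.
  have ya0 : (0 < Cmod (y - a))%R by apply/Cmod_gt_0; exact: sub_neq0.
  have yx : (m <= Cmod (y - x))%R.
    have := Cmod_ge_sub (x - a) (y - a).
    rewrite (_ : x - a - (y - a) = x - y); last ring.
    by rewrite (Cmod_sub_sym x y); lra.
  have nyx : y <> x by move=> e1; move: yx; rewrite e1 Cmod_xx; lra.
  rewrite /q (Sq y nyx).
  have -> : (y + - a) * ((P y + - P x) * / (y + - x)) =
     ((y - a) * P y - (y - a) * P x) / (y - x) by rewrite /Cdiv /Cminus; ring.
  rewrite Cmod_div; last exact: sub_neq0.
  apply/Rlt_div_l; first lra.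
  apply: Rle_lt_trans (Cmod_triangle_sub _ _) _.
  have k1 := hd y (conj ya0 h3).
  have k2 : (Cmod ((y - a) * P x) < e * m / 2)%R.
    rewrite Cmod_mult; move/(Rlt_div_r _ _ _ hN): h4.
    by apply: Rle_lt_trans; apply: Rmult_le_compat_l; lra.
  by have := Rmult_le_compat_l _ _ _ (Rlt_le _ _ e0) yx; lra.
have cq' u t : (Rabs u < rho)%R -> ccont q (a + RtoC u * cis t).
  move=> hu; apply: cq; rewrite (_ : a + u * cis t - a = u * cis t); last ring.
  by rewrite Cmod_mult Cmod_R Cmod_cis; lra.
have cJ u : (0 <= u < rho)%R -> rcont (circle_int q a) u.
  move=> hu; apply: circle_int_rcont; exists (rho - u)%R; split; first lra.
  move=> v t /Rabs_def2 hv; apply: cq'; by rewrite /Rabs; case: Rcase_abs => ?; lra.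
have dJ u : (0 < u < rho)%R -> u <> Cmod (x - a) -> rder (circle_int q a) u 0.
  move=> hu hux; apply: (circle_int_der hq); first lra.
  move=> t; split; first by rewrite circle_mod; lra.
  by move=> e; apply: hux; rewrite -e circle_mod; lra.
have J0 : circle_int q a 0 = 0.
  apply: is_Cint_unique; apply: (@is_Cint_ext (fun _ => 0)).
    by move=> t _; rewrite /q; ring.
  by have := is_Cint_const 0 0 (2 * PI); rewrite Cmult_0_l.
(* The circle of radius [|x - a|] passes through [x], where [q] is only known to be continuous. The
   interval of radii is cut at that value, and continuity of the circle integral joins the two
   pieces. *)
have Jr : circle_int q a r = 0.
  rewrite -J0; symmetry; transitivity (circle_int q a (Cmod (x - a))).
    by apply: rder_zero_const_open => // u hu; [apply: cJ | apply: dJ]; lra.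
  by apply: rder_zero_const_open => // u hu; [apply: cJ | apply: dJ]; lra.
have i1 : is_Cint (fun t => W t * / (a + r * cis t - x)) 0 (2 * PI) (T x).
  apply: is_Cint_rcont => t _; apply: rcont_mul => //.
  apply: (@rcont_inv (fun t => a + r * cis t - x)).
    by apply: (@rcont_sub (fun t => a + r * cis t)); exact: is_Cint_circle_angle.
  apply: sub_neq0 => e; move: xr; rewrite -e circle_mod; lra.
have i2 := circle_int_is (fun t => @cq' r t _).
have {}i2 : is_Cint (fun t => q (a + r * cis t)) 0 (2 * PI) 0.
  by rewrite -Jr; apply: i2; rewrite Rabs_pos_eq; lra.
(* On the circle, the integrand of [T x] minus [q] is [P x * (w - a) / (w - x)], whose integral is
   [2 PI * P x] by [circle_winding]. *)
have i3 := is_Cint_sub i1 i2.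
have i4 := is_Cint_ext (k := fun t => P x * (RtoC r * cis t * / (a + r * cis t - x))) _ i3.
have n t : a + RtoC r * cis t <> x by move=> e; move: xr; rewrite -e circle_mod; lra.
have h := is_Cint_unique (i4 _).
have i5 : is_Cint (fun t => RtoC r * cis t * / (a + r * cis t - x)) 0 (2 * PI) (2 * PI)%R.
  rewrite -(circle_winding r0 xr); apply: is_Cint_rcont => t _.
  apply: rcont_mul; first by apply: rcont_scal; exact: rder_rcont (rder_cis t).
  apply: (@rcont_inv (fun t => a + r * cis t - x)); last exact: sub_neq0.
  by apply: (@rcont_sub (fun t => a + r * cis t)); exact: is_Cint_circle_angle.
rewrite -(is_Cint_unique (is_Cint_scal (P x) i5)) h; first by ring.
move=> t _; rewrite /W /q (Sq _ (n t)); have := sub_neq0 (n t).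
rewrite /Cminus => n'; field; exact: n'.
Qed.

End CauchyFormula.

(** * Limits in half-strips; the two branches of the logarithm *)

Section HalfStrip.

Local Open Scope R_scope.
Local Open Scope C_scope.

Lemma Re_sub (x y : C) : Re (x - y) = (Re x - Re y)%R.
Proof. by []. Qed.

Lemma Im_sub (x y : C) : Im (x - y) = (Im x - Im y)%R.
Proof. by []. Qed.

Lemma exp_le_compat (x y : R) : (x <= y)%R -> (exp x <= exp y)%R.
Proof. by case=> [/exp_increasing /Rlt_le|->] //; exact: Rle_refl. Qed.

Lemma exp_decay (k B e : R) : (0 < k)%R -> (0 < e)%R ->
  exists Y : R, forall y, (Y <= y)%R -> (B * exp (- k * y) < e)%R.
Proof.
move=> k0 e0; set A := (1 + Rabs B)%R.
have A0 : (0 < A)%R by rewrite /A; have := Rabs_pos B; lra.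
have AB : (B < A)%R by rewrite /A; have := Rle_abs B; lra.
have eA : (0 < e / A)%R by exact: Rdiv_lt_0_compat.
exists (- ln (e / A) / k)%R => y hy.
have h : (exp (- k * y) <= e / A)%R.
  rewrite -[X in (_ <= X)%R](exp_ln _ eA); apply: exp_le_compat.
  have := Rmult_le_compat_l _ _ _ (Rlt_le _ _ k0) hy.
  by rewrite (_ : k * (- ln (e / A) / k) = - ln (e / A))%R; [lra | field; lra].
have h2 : (A * exp (- k * y) <= e)%R.
  apply: Rle_trans (Rmult_le_compat_l _ _ _ (Rlt_le _ _ A0) h) _.
  by apply: Req_le; field; lra.
by have := Rmult_lt_compat_r _ _ _ (exp_pos (- k * y)) AB; lra.
Qed.

Lemma le_eps (x y : R) : (forall e : R, (0 < e)%R -> (x <= y + e)%R) -> (x <= y)%R.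
Proof.
move=> h; case: (Rle_lt_dec x y) => // xy.
by have := h ((x - y) / 2)%R; lra.
Qed.

Lemma exp_cauchy_limit (K : R -> C) (B k y0 : R) : (0 < k)%R ->
  (forall s t, (y0 < s)%R -> (s <= t)%R -> (Cmod (K t - K s) <= B * exp (- k * s))%R) ->
  exists L, forall s, (y0 < s)%R -> (Cmod (K s - L) <= B * exp (- k * s))%R.
Proof.
move=> k0 hK.
pose u j := K (y0 + 1 + INR j)%R.
have cau e : (0 < e)%R -> exists N : nat, forall i j : nat, (i >= N)%coq_nat -> (j >= N)%coq_nat ->
    (Cmod (u i - u j) < e)%R.
  move=> e0; have [Y hY] := @exp_decay k B e k0 e0.
  have [N hN] := INR_unbounded (Y - y0).
  exists N.
  have main i j : (i >= N)%coq_nat -> (i <= j)%coq_nat -> (Cmod (u j - u i) < e)%R.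
    move=> /le_INR hi /le_INR hj; have := pos_INR i => pi.
    by apply: Rle_lt_trans (hK _ _ _ _) (hY _ _); lra.
  move=> i j hi hj; case: (PeanoNat.Nat.le_ge_cases i j) => hij.
    by rewrite Cmod_sub_sym; exact: main.
  exact: main.
have cauRe : Cauchy_crit (fun j => Re (u j)).
  move=> e /cau [N hN]; exists N => i j hi hj; rewrite /Rdist -Re_sub.
  exact: Rle_lt_trans (re_le_Cmod (u i - u j)) (hN _ _ hi hj).
have [lr hlr] := Rcomplete.R_complete _ cauRe.
have cauIm : Cauchy_crit (fun j => Im (u j)).
  move=> e /cau [N hN]; exists N => i j hi hj; rewrite /Rdist -Im_sub.
  exact: Rle_lt_trans (im_le_Cmod (u i - u j)) (hN _ _ hi hj).
have [li hli] := Rcomplete.R_complete _ cauIm.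
exists (lr, li) => s hs; apply: le_eps => e e0.
have e2 : (0 < e / 2)%R by lra.
have [N1 h1] := hlr _ e2; have [N2 h2] := hli _ e2.
have [N3 h3] := INR_unbounded (s - y0).
set j := addn (addn N1 N2) N3.
have j1 : (j >= N1)%coq_nat by apply/leP; rewrite /j -addnA leq_addr.
have j2 : (j >= N2)%coq_nat by apply/leP; rewrite /j addnAC leq_addl.
have j3 : (N3 <= j)%coq_nat by apply/leP; rewrite /j leq_addl.
have := h1 _ j1; have := h2 _ j2; rewrite /Rdist => d2 d1.
have hj := le_INR _ _ j3.
have -> : K s - (lr, li) = (u j - (lr, li)) - (u j - K s) by ring.
apply: Rle_trans (Cmod_triangle_sub _ _) _.
have b1 : (Cmod (u j - (lr, li)) <= e)%R.
  apply: Rle_trans (Cmod_le_abs _) _.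
  by rewrite Re_sub Im_sub -[Re (lr, li)]/lr -[Im (lr, li)]/li; lra.
have b2 : (Cmod (u j - K s) <= B * exp (- k * s))%R by apply: hK; lra.
lra.
Qed.

(** Going up a vertical line, the increments are exponentially small and a limit exists. Another
    vertical line has the same limit, because a horizontal move at height [y] costs its length times
    [exp (- k * y)]. The two lines are compared at a height tending to infinity, so the width of
    [I], possibly infinite, does not enter the rate. *)
Lemma half_strip_limit (I : R -> Prop) (Y B k : R) (K f : C -> C) : (0 < k)%R ->
  (forall s t u, I s -> I t -> (s <= u <= t)%R -> I u) ->
  (forall x, I (Re x) -> (Y < Im x)%R -> cder K x (f x)) ->
  (forall x, I (Re x) -> (Y < Im x)%R -> (Cmod (f x) <= B * exp (- k * Im x))%R) ->
  exists L, forall x, I (Re x) -> (Y < Im x)%R ->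
    (Cmod (K x - L) <= B / k * exp (- k * Im x))%R.
Proof.
move=> k0 cI hK hf.
case: (boolp.pselect (exists t, I t)) => [[t0 It0]|hn]; last first.
  by exists 0 => x hx; case: hn; exists (Re x).
have B0 : (0 <= B)%R.
  have := hf (t0, Y + 1)%R It0 (_ : (Y < Y + 1)%R); have := Cmod_ge_0 (f (t0, Y + 1)%R).
  move=> h1 h2; have h3 := Rle_trans _ _ _ h1 (h2 (Rlt_plus_1 Y)).
  apply: (Rmult_le_reg_r _ _ _ (exp_pos (- k * (Y + 1)))).
  by rewrite Rmult_0_l; exact: h3.
have vert t : I t -> forall s u, (Y < s)%R -> (s <= u)%R ->
    (Cmod (K (t, u) - K (t, s)) <= B / k * exp (- k * s))%R.
  move=> It s u hs su.
  have := @mean_value_ineq (fun y => K (t, y)) (fun y => Ci * f (t, y))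
    (fun y => - (B / k) * exp (- k * y))%R (fun y => B * exp (- k * y))%R s u su.
  move=> h; apply: Rle_trans (h _ _ _) _.
  - move=> y hy; have := rder_comp (hK (t, y) It _) (rder_vline t y).
    by rewrite Cmult_comm; apply; rewrite /=; lra.
  - by move=> y hy; auto_derive => //; field; lra.
  - move=> y hy; rewrite Cmod_mult Cmod_Ci Rmult_1_l; apply: (hf (t, y)) => //=; lra.
  - have := exp_pos (- k * u); have : (0 <= B / k)%R by apply: Rdiv_le_0_compat.
    by move=> b1 b2; have := Rmult_le_pos _ _ b1 (Rlt_le _ _ b2); lra.
have hor s t y : I s -> I t -> (Y < y)%R ->
    (Cmod (K (t, y) - K (s, y)) <= B * exp (- k * y) * Rabs (t - s))%R.
  move=> Is It hy.
  have Iu u : (Rmin s t <= u <= Rmax s t)%R -> I u.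
    rewrite /Rmin /Rmax; case: Rle_dec => h hu; first exact: cI Is It hu.
    exact: cI It Is hu.
  apply: (@mean_value_bound (fun u => K (u, y)) (fun u => f (u, y))) => u /Iu hu.
    have := rder_comp (hK (u, y) hu hy) (rder_hline y u).
    by rewrite (_ : f (u, y) * 1 = f (u, y)); last ring.
  exact: (hf (u, y)).
have [L hL] := @exp_cauchy_limit (fun y => K (t0, y)) (B / k) k Y k0 (vert t0 It0).
exists L => -[x1 x2] /= Ix hx; apply: le_eps => e e0.
set N := (B * Rabs (x1 - t0) + B / k)%R.
have [Y1 hY1] := @exp_decay k N e k0 e0.
set y := Rmax x2 Y1.
have y1 : (x2 <= y)%R := Rmax_l _ _; have y2 : (Y1 <= y)%R := Rmax_r _ _.
have yY : (Y < y)%R by lra.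
have h1 := vert x1 Ix x2 y hx y1.
have h2 := hor t0 x1 y It0 Ix yY.
have h3 := hL y yY.
have h4 := hY1 y y2.
have -> : K (x1, x2) - L = (K (x1, y) - K (t0, y)) + (K (t0, y) - L) - (K (x1, y) - K (x1, x2)) by ring.
apply: Rle_trans (Cmod_triangle_sub _ _) _.
have := Cmod_triangle (K (x1, y) - K (t0, y)) (K (t0, y) - L).
rewrite /N in h4; lra.
Qed.

(** [log_up] and [log_down] are branches of the logarithm of [a - x], real on the horizontal
    half-line to the left of [a], with their cuts above and below [a]. They agree to the left of [a]
    and differ by [2 pi i] to its right. *)
Definition log_up (a x : C) : C := Log (Ci * (x - a)) + (PI / 2)%R * Ci.
Definition log_down (a x : C) : C := Log (- Ci * (x - a)) - (PI / 2)%R * Ci.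

Definition up_cut (a x : C) : Prop := Re x = Re a /\ (Im a <= Im x)%R.
Definition down_cut (a x : C) : Prop := Re x = Re a /\ (Im x <= Im a)%R.

Lemma up_slit a x : ~ up_cut a x -> slit (Ci * (x - a)).
Proof.
move=> h.
have e1 : Re (Ci * (x - a)) = (Im a - Im x)%R by rewrite /Re /Im /=; ring.
have e2 : Im (Ci * (x - a)) = (Re x - Re a)%R by rewrite /Re /Im /=; ring.
rewrite /slit e1 e2; case: (Req_dec (Re x) (Re a)) => e; last by right; lra.
by left; case: (Rlt_le_dec (Im x) (Im a)) => h'; [lra | case: h].
Qed.

Lemma down_slit a x : ~ down_cut a x -> slit (- Ci * (x - a)).
Proof.
move=> h.
have e1 : Re (- Ci * (x - a)) = (Im x - Im a)%R by rewrite /Re /Im /=; ring.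
have e2 : Im (- Ci * (x - a)) = (Re a - Re x)%R by rewrite /Re /Im /=; ring.
rewrite /slit e1 e2; case: (Req_dec (Re x) (Re a)) => e; last by right; lra.
by left; case: (Rlt_le_dec (Im a) (Im x)) => h'; [lra | case: h].
Qed.

Lemma not_up_cut_neq a x : ~ up_cut a x -> x <> a.
Proof. by move=> h e; apply: h; rewrite e; split; [ | lra]. Qed.

Lemma not_down_cut_neq a x : ~ down_cut a x -> x <> a.
Proof. by move=> h e; apply: h; rewrite e; split; [ | lra]. Qed.

Lemma cder_lin (k a x : C) : cder (fun y => k * (y - a)) x k.
Proof.
have := cder_scal k (cder_add (cder_id x) (cder_const (- a) x)).
by rewrite (_ : k * (1 + 0) = k); last ring.
Qed.

Lemma cder_log_up a x : ~ up_cut a x -> cder (log_up a) x (/ (x - a)).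
Proof.
move=> h; have n := sub_neq0 (not_up_cut_neq h).
have := cder_add (cder_comp (cder_lin Ci a x) (cder_Log (up_slit h)))
  (cder_const ((PI / 2)%R * Ci) x).
have hi : Ci <> 0 by move=> [] /R1_neq_R0.
by rewrite (_ : / (Ci * (x - a)) * Ci + 0 = / (x - a)); last by field.
Qed.

Lemma cder_log_down a x : ~ down_cut a x -> cder (log_down a) x (/ (x - a)).
Proof.
move=> h; have n := sub_neq0 (not_down_cut_neq h).
have := cder_add (cder_comp (cder_lin (- Ci) a x) (cder_Log (down_slit h)))
  (cder_const (- ((PI / 2)%R * Ci)) x).
have hi : Ci <> 0 by move=> [] /R1_neq_R0.
by rewrite (_ : / (- Ci * (x - a)) * - Ci + 0 = / (x - a)); last by field.
Qed.

Lemma Re_log_up a x : Re (log_up a x) = ln (Cmod (x - a)).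
Proof.
by rewrite /log_up /Re /= Cmod_mult Cmod_Ci Rmult_1_l; ring.
Qed.

Lemma Re_log_down a x : Re (log_down a x) = ln (Cmod (x - a)).
Proof.
by rewrite /log_down /Re /= Cmod_mult Cmod_opp Cmod_Ci Rmult_1_l; ring.
Qed.

Lemma Im_log_up a x : (Rabs (Im (log_up a x)) <= 2 * PI)%R.
Proof.
have := Carg_bound (Ci * (x - a)); have := PI_RGT_0 => p0.
rewrite (_ : Im (log_up a x) = Carg (Ci * (x - a)) + PI / 2)%R; last first.
  by rewrite /log_up /Im /=; ring.
by rewrite /Rabs; case: Rcase_abs; lra.
Qed.

Lemma Im_log_down a x : (Rabs (Im (log_down a x)) <= 2 * PI)%R.
Proof.
have := Carg_bound (- Ci * (x - a)); have := PI_RGT_0 => p0.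
rewrite (_ : Im (log_down a x) = Carg (- Ci * (x - a)) - PI / 2)%R; last first.
  by rewrite /log_down /Im /=; ring.
by rewrite /Rabs; case: Rcase_abs; lra.
Qed.

(** With [q = x / (r + y)] and [r] the modulus, the half-angle tangents of the two arguments are
    [/ q] and [- q]; the claim is the identity [atan q + atan (/ q) = PI / 2] for positive [q], and
    its mirror image for negative [q]. *)
Lemma Carg_quarter (x y : R) : x <> 0%R ->
  Carg ((- y)%R, x) = (Carg (y, (- x)%R) + (if Rlt_dec 0 x then PI else - PI))%R.
Proof.
move=> x0.
have s1 : slit ((- y)%R, x) by right.
have s2 : slit (y, (- x)%R) by right; rewrite /Im /=; lra.
have d1 := slit_arg_den s1; have d2 := slit_arg_den s2.
rewrite !Carg_slit // /Re /Im /= in d1 d2 *.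
set r := Cmod ((- y)%R, x) in d1 *.
have e : Cmod (y, (- x)%R) = r.
  by rewrite /r /Cmod /=; congr sqrt; ring.
rewrite e in d2 *.
have hr : (r * r = x * x + y * y)%R.
  have h := Cmod2_alt ((- y)%R, x); rewrite -/r /Re /Im /= in h; lra.
set q := (x / (r + y))%R.
have q0 : q <> 0%R by rewrite /q => h; apply: x0; rewrite -(Rmult_0_l (r + y)) -h; field; lra.
have -> : (x / (r + - y) = / q)%R.
  rewrite /q; field_simplify_eq; last by split=> //; lra.
  by lra.
have -> : (- x / (r + y) = - q)%R by rewrite /q; field; lra.
rewrite atan_opp.
case: Rlt_dec => hx /=.
  have qp : (0 < q)%R by apply: Rdiv_lt_0_compat.
  by rewrite atan_inv //; lra.
have qn : (0 < - q)%R.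
  rewrite /q (_ : - (x / (r + y)) = - x / (r + y))%R; last by field; lra.
  by apply: Rdiv_lt_0_compat; lra.
have := @atan_inv (- q)%R qn; rewrite Rinv_opp !atan_opp; lra.
Qed.

Lemma log_up_left a x : (Re x < Re a)%R -> log_up a x = log_down a x.
Proof.
move=> h; have hx : (Re x - Re a)%R <> 0%R by lra.
have e1 : Ci * (x - a) = ((- (Im x - Im a))%R, (Re x - Re a)%R).
  by apply: C_ext; rewrite /Re /Im /=; ring.
have e2 : - Ci * (x - a) = ((Im x - Im a)%R, (- (Re x - Re a))%R).
  by apply: C_ext; rewrite /Re /Im /=; ring.
apply: C_ext; first by rewrite Re_log_up Re_log_down.
have -> : Im (log_up a x) = (Carg (Ci * (x - a)) + PI / 2)%R by rewrite /log_up /Im /=; ring.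
have -> : Im (log_down a x) = (Carg (- Ci * (x - a)) - PI / 2)%R by rewrite /log_down /Im /=; ring.
by rewrite e1 e2 Carg_quarter //; case: Rlt_dec => ? /=; lra.
Qed.

Lemma log_up_right a x : (Re a < Re x)%R -> log_up a x = log_down a x + (2 * PI)%R * Ci.
Proof.
move=> h; have hx : (Re x - Re a)%R <> 0%R by lra.
have e1 : Ci * (x - a) = ((- (Im x - Im a))%R, (Re x - Re a)%R).
  by apply: C_ext; rewrite /Re /Im /=; ring.
have e2 : - Ci * (x - a) = ((Im x - Im a)%R, (- (Re x - Re a))%R).
  by apply: C_ext; rewrite /Re /Im /=; ring.
apply: C_ext.
  rewrite (_ : Re (log_down a x + _) = Re (log_down a x)); last by rewrite /Re /=; ring.
  by rewrite Re_log_up Re_log_down.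
have -> : Im (log_up a x) = (Carg (Ci * (x - a)) + PI / 2)%R by rewrite /log_up /Im /=; ring.
have -> : Im (log_down a x + (2 * PI)%R * Ci) = (Carg (- Ci * (x - a)) - PI / 2 + 2 * PI)%R.
  by rewrite /log_down /Im /=; ring.
by rewrite e1 e2 Carg_quarter //; case: Rlt_dec => ? /=; lra.
Qed.

End HalfStrip.

(** * Finite families *)

Section FiniteFamilies.

Local Open Scope R_scope.
Local Open Scope C_scope.

Lemma sum_closed (I : Type) (r : seq I) (P : (C -> C) -> Prop) (F : I -> C -> C) :
  P (fun _ => 0) -> (forall f g, P f -> P g -> P (fun x => f x + g x)) ->
  (forall i, P (F i)) -> P (fun x => (\sum_(i <- r) F i x)%R).
Proof.
move=> P0 PD PF; elim: r => [|i r IH].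
  by have -> : (fun x => (\sum_(i <- [::]) F i x)%R) = (fun _ => 0 : C);
     [apply: boolp.funext => x; rewrite big_nil | ].
have -> : (fun x => (\sum_(j <- i :: r) F j x)%R) =
    (fun x => F i x + (\sum_(j <- r) F j x)%R).
  by apply: boolp.funext => x; rewrite big_cons.
exact: PD.
Qed.

Lemma hol_sum (I : Type) (r : seq I) D (F dF : I -> C -> C) : copen D ->
  (forall i, hol D (F i) (dF i)) ->
  hol D (fun x => (\sum_(i <- r) F i x)%R) (fun x => (\sum_(i <- r) dF i x)%R).
Proof.
move=> oD h; elim: r => [|i r IH].
  have -> : (fun x => (\sum_(i <- [::]) F i x)%R) = (fun _ => 0 : C).
    by apply: boolp.funext => x; rewrite big_nil.
  have -> : (fun x => (\sum_(i <- [::]) dF i x)%R) = (fun _ => 0 : C).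
    by apply: boolp.funext => x; rewrite big_nil.
  exact: hol_const.
have e (G : I -> C -> C) : (fun x => (\sum_(j <- i :: r) G j x)%R) =
    (fun x => G i x + (\sum_(j <- r) G j x)%R).
  by apply: boolp.funext => x; rewrite big_cons.
by rewrite !e; exact: hol_add.
Qed.

Lemma cder_sum (I : Type) (r : seq I) (F : I -> C -> C) (dF : I -> C) x :
  (forall i, cder (F i) x (dF i)) ->
  cder (fun y => (\sum_(i <- r) F i y)%R) x (\sum_(i <- r) dF i)%R.
Proof.
move=> h; elim: r => [|i r IH].
  have -> : (fun x => (\sum_(i <- [::]) F i x)%R) = (fun _ => 0 : C).
    by apply: boolp.funext => y; rewrite big_nil.
  by rewrite big_nil; exact: cder_const.
have -> : (fun x => (\sum_(j <- i :: r) F j x)%R) =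
    (fun x => F i x + (\sum_(j <- r) F j x)%R).
  by apply: boolp.funext => y; rewrite big_cons.
by rewrite big_cons; exact: cder_add.
Qed.

Lemma finite_pos_min (T : finType) (Q : T -> R -> Prop) :
  (forall t d d', Q t d -> (d' <= d)%R -> (0 < d')%R -> Q t d') ->
  (forall t, exists d : R, (0 < d)%R /\ Q t d) -> exists d : R, (0 < d)%R /\ forall t, Q t d.
Proof.
move=> mono h.
suff [d [d0 hd]] : exists d : R, (0 < d)%R /\ forall t, t \in enum T -> Q t d.
  by exists d; split=> // t; apply: hd; rewrite mem_enum.
elim: (enum T) => [|t s [d [d0 hd]]]; first by exists 1%R; split; [lra | ].
have [d' [d0' hd']] := h t; exists (Rmin d d'); split; first exact: Rmin_pos.
have dd := Rmin_pos _ _ d0 d0'.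
move=> u; rewrite in_cons => /orP [/eqP ->|/hd hu].
  by apply: mono hd' _ dd; exact: Rmin_r.
by apply: mono hu _ dd; exact: Rmin_l.
Qed.

Lemma finite_max (T : finType) (g : T -> R) : exists M : R, (0 < M)%R /\ forall t, (g t <= M)%R.
Proof.
suff [d [d0 hd]] : exists d : R, (0 < d)%R /\ forall t, t \in enum T -> (g t <= d)%R.
  by exists d; split=> // t; apply: hd; rewrite mem_enum.
elim: (enum T) => [|t s [d [d0 hd]]]; first by exists 1%R; split; [lra | ].
exists (Rmax d (g t)); split; first by have := Rmax_l d (g t); lra.
move=> u; rewrite in_cons => /orP [/eqP ->|/hd hu]; first exact: Rmax_r.
by apply: Rle_trans hu (Rmax_l _ _).
Qed.

Lemma copen_forall (T : finType) (D : T -> C -> Prop) :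
  (forall t, copen (D t)) -> copen (fun x => forall t, D t x).
Proof.
move=> h x hx.
have [|t|d [d0 hd]] := @finite_pos_min T (fun t d => forall y, (Cmod (y - x) < d)%R -> D t y).
- by move=> t d d' hd dd d'0 y hy; apply: hd; lra.
- by have [d [d0 hd]] := h t x (hx t); exists d.
by exists d; split=> // y hy t; exact: hd.
Qed.

Lemma copen_up_cut a : copen (fun x => ~ up_cut a x).
Proof.
move=> x hx; case: (Req_dec (Re x) (Re a)) => e.
  have h : (Im x < Im a)%R.
    by case: (Rlt_le_dec (Im x) (Im a)) => h //; case: hx.
  exists (Im a - Im x)%R; split; first lra.
  move=> y hy [_ h']; have := im_le_Cmod (y - x); rewrite Im_sub.
  by have := Rle_abs (Im y - Im x); lra.
have h : (0 < Rabs (Re x - Re a))%R by apply: Rabs_pos_lt; lra.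
exists (Rabs (Re x - Re a)); split=> // y hy [h' _].
have := re_le_Cmod (y - x); rewrite Re_sub h' (Rabs_minus_sym (Re a)); lra.
Qed.

Lemma copen_down_cut a : copen (fun x => ~ down_cut a x).
Proof.
move=> x hx; case: (Req_dec (Re x) (Re a)) => e.
  have h : (Im a < Im x)%R.
    by case: (Rlt_le_dec (Im a) (Im x)) => h //; case: hx.
  exists (Im x - Im a)%R; split; first lra.
  move=> y hy [_ h']; have := im_le_Cmod (y - x); rewrite Im_sub.
  by have := Rle_abs (- (Im y - Im x)); rewrite Rabs_Ropp; lra.
have h : (0 < Rabs (Re x - Re a))%R by apply: Rabs_pos_lt; lra.
exists (Rabs (Re x - Re a)); split=> // y hy [h' _].
have := re_le_Cmod (y - x); rewrite Re_sub h' (Rabs_minus_sym (Re a)); lra.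
Qed.

End FiniteFamilies.

(** * The summands of the phase, with a cut that can be turned *)

Section Branches.

Local Open Scope R_scope.
Local Open Scope C_scope.

(** For [s = true] this is the summand of [f_pot]. Only the cut from [a] can be turned; the one from
    [Cconj a] always points down. *)
Definition branch_term (s : bool) (k a x : C) : C :=
  k * (if s then log_up a x else log_down a x) + Cconj k * log_down (Cconj a) x.

Definition branch_dom1 (s : bool) (a x : C) : Prop :=
  ~ (if s then up_cut a x else down_cut a x) /\ ~ down_cut (Cconj a) x.

Lemma copen_branch_dom1 s a : copen (branch_dom1 s a).
Proof.
by apply: copen_and; [case: s; [exact: copen_up_cut | exact: copen_down_cut]
  | exact: copen_down_cut].
Qed.

Lemma branch_dom1_neq s a x : branch_dom1 s a x -> x - a <> 0 /\ x - Cconj a <> 0.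
Proof.
move=> [h1 h2]; split; apply: sub_neq0; last exact: not_down_cut_neq h2.
by case: s h1 => h1; [exact: not_up_cut_neq h1 | exact: not_down_cut_neq h1].
Qed.

Lemma hol_rational D (k a : C) : copen D -> (forall x, D x -> x - a <> 0) ->
  exists dq, hol D (fun x => k / (x - a)) dq.
Proof.
move=> oD h; eexists; apply: hol_scal; apply: hol_inv => //.
exact: hol_add (hol_id oD) (hol_const (- a) oD).
Qed.

Lemma hol_branch_term s k a : hol (branch_dom1 s a) (branch_term s k a)
  (fun x => k / (x - a) + Cconj k / (x - Cconj a)).
Proof.
have oD := @copen_branch_dom1 s a.
split=> //; split=> x Dx.
  have [h1 h2] := Dx; apply: cder_add; apply: cder_scal; last exact: cder_log_down.
  by case: s h1 {Dx oD} => h1; [exact: cder_log_up | exact: cder_log_down].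
have [d1 h1] := hol_rational k oD (fun x Dx => proj1 (branch_dom1_neq Dx)).
have [d2 h2] := hol_rational (Cconj k) oD (fun x Dx => proj2 (branch_dom1_neq Dx)).
by apply: ccont_add; [exact: hol_ccont h1 Dx | exact: hol_ccont h2 Dx].
Qed.

(** [ln] is Lipschitz with constant [/ d] above [d]; the estimate comes from [1 + s <= exp s] at
    [s = Cmod (a - b) / d]. *)
Lemma ln_Cmod_diff (d : R) (x a b : C) : (0 < d)%R -> (d <= Cmod (x - a))%R ->
  (d <= Cmod (x - b))%R -> (Rabs (ln (Cmod (x - a)) - ln (Cmod (x - b))) <= Cmod (a - b) / d)%R.
Proof.
move=> d0.
have main u v : (d <= Cmod (x - u))%R -> (d <= Cmod (x - v))%R ->
    (ln (Cmod (x - u)) - ln (Cmod (x - v)) <= Cmod (u - v) / d)%R.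
  move=> hu hv.
  have h1 : (Cmod (x - u) <= Cmod (x - v) * exp (Cmod (u - v) / d))%R.
    have h2 := exp_ineq1_le (Cmod (u - v) / d).
    have h3 : (Cmod (u - v) <= Cmod (x - v) * (Cmod (u - v) / d))%R.
      have h4 := Rdiv_le_0_compat _ _ (Cmod_ge_0 (u - v)) d0.
      apply: Rle_trans (Rmult_le_compat_r _ _ _ h4 hv).
      by apply: Req_le; field; lra.
    have h5 : (Cmod (x - u) <= Cmod (x - v) + Cmod (u - v))%R.
      have -> : x - u = (x - v) - (u - v) by ring.
      exact: Cmod_triangle_sub.
    have := Rmult_le_compat_l _ _ _ (Cmod_ge_0 (x - v)) h2; lra.
  have hv0 : (0 < Cmod (x - v))%R by lra.
  have := ln_le _ _ (Rlt_le_trans _ _ _ d0 hu) h1.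
  rewrite ln_mult //; last exact: exp_pos.
  by rewrite ln_exp; lra.
move=> ha hb; apply: Rabs_le.
by have := main _ _ ha hb; have := main _ _ hb ha; rewrite (Cmod_sub_sym b); lra.
Qed.

Lemma abs_ln_le y : (0 < y)%R -> (Rabs (ln y) <= y + / y)%R.
Proof.
move=> y0; have iy := Rinv_0_lt_compat _ y0.
have main u : (0 < u)%R -> (ln u <= u)%R.
  by move=> u0; have := exp_ineq1_le (ln u); rewrite exp_ln //; lra.
apply: Rabs_le; have := main _ y0; have := main _ iy; rewrite ln_Rinv //; lra.
Qed.

(** Because the two coefficients are conjugate, the logarithms of the distances enter only through
    their difference, while the arguments are bounded. The imaginary part is thus bounded far from
    the two points and behaves like [Im k * ln |x - a|] near [a]. *)
Lemma Im_branch_term s k a x : exists t : R, (Rabs t <= 4 * PI)%R /\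
  Im (branch_term s k a x) =
    (Re k * t + Im k * (ln (Cmod (x - a)) - ln (Cmod (x - Cconj a))))%R.
Proof.
pose l := if s then log_up a x else log_down a x.
have hl : Re l = ln (Cmod (x - a)) /\ (Rabs (Im l) <= 2 * PI)%R.
  by rewrite /l; case: s {l}; [rewrite Re_log_up | rewrite Re_log_down]; split=> //;
     [exact: Im_log_up | exact: Im_log_down].
exists (Im l + Im (log_down (Cconj a) x))%R; split.
  apply: Rle_trans (Rabs_triang _ _) _.
  by have := Im_log_down (Cconj a) x; case: hl; lra.
rewrite -(proj1 hl) -(Re_log_down (Cconj a)) /branch_term -/l.
by rewrite /Re /Im /=; ring.
Qed.

Lemma branch_term_far s k a d x : (0 < d)%R -> (d <= Cmod (x - a))%R ->
  (d <= Cmod (x - Cconj a))%R ->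
  (Rabs (Im (branch_term s k a x)) <= Cmod k * (4 * PI) + Cmod k * (Cmod (a - Cconj a) / d))%R.
Proof.
move=> d0 h1 h2; have [t [ht ->]] := Im_branch_term s k a x.
have h3 := ln_Cmod_diff d0 h1 h2.
apply: Rle_trans (Rabs_triang _ _) _; rewrite !Rabs_mult.
by apply: Rplus_le_compat; apply: Rmult_le_compat => //; try exact: Rabs_pos;
   [exact: re_le_Cmod | exact: im_le_Cmod].
Qed.

(** In the disc of radius [Im a] about [a], the distance to [Cconj a] lies between [Im a] and
    [3 * Im a]; by [abs_ln_le] its logarithm is a bounded error, which accounts for the second
    constant. *)
Lemma branch_term_near s k a x : (0 < Im a)%R -> (Cmod (x - a) <= Im a)%R ->
  (Rabs (Im (branch_term s k a x) - Im k * ln (Cmod (x - a))) <=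
     Cmod k * (4 * PI) + Cmod k * (3 * Im a + / Im a))%R.
Proof.
move=> a0 h; have [t [ht ->]] := Im_branch_term s k a x.
set y := Cmod (x - Cconj a).
have aa : Cmod (a - Cconj a) = (2 * Im a)%R.
  have -> : a - Cconj a = RtoC (2 * Im a) * Ci by apply: C_ext; rewrite /Re /Im /=; ring.
  by rewrite Cmod_mult Cmod_Ci Cmod_R Rabs_pos_eq; lra.
have y1 : (Im a <= y)%R.
  have := Cmod_ge_sub (a - Cconj a) (a - x).
  rewrite (_ : a - Cconj a - (a - x) = x - Cconj a); last ring.
  by rewrite -/y aa (Cmod_sub_sym a x); lra.
have y2 : (y <= 3 * Im a)%R.
  rewrite /y (_ : x - Cconj a = (x - a) + (a - Cconj a)); last ring.
  by apply: Rle_trans (Cmod_triangle _ _) _; rewrite aa; lra.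
have y0 : (0 < y)%R by lra.
have ly := abs_ln_le y0; have iy := Rinv_le_contravar _ _ a0 y1.
have -> : (Re k * t + Im k * (ln (Cmod (x - a)) - ln y) - Im k * ln (Cmod (x - a)) =
   Re k * t + Im k * (- ln y))%R by ring.
apply: Rle_trans (Rabs_triang _ _) _; rewrite !Rabs_mult Rabs_Ropp.
apply: Rplus_le_compat; apply: Rmult_le_compat => //; try exact: Rabs_pos;
  [exact: re_le_Cmod | exact: im_le_Cmod | lra].
Qed.

End Branches.

(** * The rational weight and its bounds *)

Section Weights.

Local Open Scope R_scope.
Local Open Scope C_scope.

Variables (n : nat) (z : 'I_n.+1 -> C).

Definition weight (phi : 'I_n.+1 -> C) (x : C) : C :=
  (\sum_(p < n.+1) (phi p / (x - z p))%C)%R.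

Definition off_poles (x : C) : Prop := forall p, x <> z p.

Lemma copen_off_poles : copen off_poles.
Proof. by apply: copen_forall => p; exact: copen_neq. Qed.

Lemma hol_weight phi : exists dw, hol off_poles (weight phi) dw.
Proof.
have h p : exists dw, hol off_poles (fun x => phi p / (x - z p)) dw.
  by apply: hol_rational copen_off_poles _ => x /(_ p) /sub_neq0.
have [dw hdw] := boolp.choice h.
eexists; apply: (hol_sum _ copen_off_poles (F := fun p x => phi p / (x - z p)) (dF := dw)).
exact: hdw.
Qed.

(** [r] is a scale of comparison. It is taken to be [1] for boundedness, [|x|] for decay at
    infinity, [|x - z m|] at a simple pole, and the distance to the line [Re x = Re (z ord0)] on the
    far left. *)
Lemma weight_bound phi (X : C -> Prop) (r : C -> R) :
  (forall x, X x -> (0 < r x)%R) ->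
  (forall p, exists N : R, forall x, X x -> x <> z p /\ (r x <= N * Cmod (x - z p))%R) ->
  exists N : R, (0 <= N)%R /\ forall x, X x -> (Cmod (weight phi x) * r x <= N)%R.
Proof.
move=> r0 h.
apply: (@sum_closed _ _ (fun f => exists N : R, (0 <= N)%R /\ forall x, X x -> (Cmod (f x) * r x <= N)%R)).
- by exists 0%R; split=> [|x _]; [lra | rewrite Cmod_0; lra].
- move=> f g [N [N0 hN]] [M [M0 hM]]; exists (N + M)%R; split=> [|x Xx]; first lra.
  have := Rmult_le_compat_r _ _ _ (Rlt_le _ _ (r0 _ Xx)) (Cmod_triangle (f x) (g x)).
  by have := hN x Xx; have := hM x Xx; lra.
- move=> p; have [N hN] := h p; exists (Cmod (phi p) * Rabs N)%R; split.
    by apply: Rmult_le_pos; [exact: Cmod_ge_0 | exact: Rabs_pos].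
  move=> x Xx; have [/sub_neq0 nx hx] := hN x Xx; rewrite Cmod_div // /Rdiv Rmult_assoc.
  apply: Rmult_le_compat_l; first exact: Cmod_ge_0.
  have x0 : (0 < Cmod (x - z p))%R by apply/Cmod_gt_0.
  apply: (Rmult_le_reg_l _ _ _ x0); rewrite -Rmult_assoc Rinv_r; last lra.
  rewrite Rmult_1_l Rmult_comm; apply: Rle_trans hx _.
  by apply: Rmult_le_compat_r; [lra | exact: Rle_abs].
Qed.

End Weights.

(** * Abstract limits, approximation from dense sets, and the derivative of the library *)

Section Continuity.

Local Open Scope R_scope.
Local Open Scope C_scope.

Lemma slit_not_up_cut a x : slit (Ci * (x - a)) -> ~ up_cut a x.
Proof.
have e1 : Re (Ci * (x - a)) = (Im a - Im x)%R by rewrite /Re /Im /=; ring.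
have e2 : Im (Ci * (x - a)) = (Re x - Re a)%R by rewrite /Re /Im /=; ring.
by rewrite /slit e1 e2 => h [h1 h2]; case: h; lra.
Qed.

Lemma Ci2 : Ci * Ci = - (1).
Proof. by apply: C_ext; rewrite /Re /Im /=; ring. Qed.

(** The linearity that lets limits pass through linear combinations, abstracted because the limit at
    [i oo] in a strip and the limit at a pole are treated alike. *)
Definition is_lim_rel (T : (C -> C) -> C -> Prop) : Prop :=
  T (fun _ => 0) 0 /\
  (forall f g k l, T f k -> T g l -> T (fun x => f x + g x) (k + l)) /\
  (forall a f l, T f l -> T (fun x => a * f x) (a * l)).

Lemma lim_rel_sum T (I : Type) (r : seq I) (F : I -> C -> C) (l : I -> C) : is_lim_rel T ->
  (forall i, T (F i) (l i)) ->
  T (fun x => (\sum_(i <- r) F i x)%R) (\sum_(i <- r) l i)%R.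
Proof.
move=> [T0 [TD _]] h; elim: r => [|i r IH].
  have -> : (fun x => (\sum_(i <- [::]) F i x)%R) = (fun _ => 0 : C).
    by apply: boolp.funext => y; rewrite big_nil.
  by rewrite big_nil.
have -> : (fun x => (\sum_(j <- i :: r) F j x)%R) =
    (fun x => F i x + (\sum_(j <- r) F j x)%R).
  by apply: boolp.funext => y; rewrite big_cons.
by rewrite big_cons; exact: TD.
Qed.

(* Limits along a filter base of subsets [S t] of [C], [t > 0]. *)
Lemma lim_rel_base (S : R -> C -> Prop) :
  (forall s t x, (0 < s)%R -> (s <= t)%R -> S s x -> S t x) ->
  is_lim_rel (fun H L => forall e : R, (0 < e)%R -> exists t : R, (0 < t)%R /\
    forall x, S t x -> (Cmod (H x - L) < e)%R).
Proof.
move=> mono; split; last split.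
- by move=> e e1; exists 1%R; split=> [|x _]; [lra | rewrite Cmod_xx].
- move=> f g k l hf hg e e1; have e2 : (0 < e / 2)%R by lra.
  have [s [s0 hs]] := hf _ e2; have [t [t0 ht]] := hg _ e2.
  exists (Rmin s t); split; first exact: Rmin_pos.
  move=> x hx; have m0 := Rmin_pos _ _ s0 t0.
  have h1 := hs x (mono _ _ _ m0 (Rmin_l _ _) hx).
  have h2 := ht x (mono _ _ _ m0 (Rmin_r _ _) hx).
  rewrite (_ : f x + g x - (k + l) = (f x - k) + (g x - l)); last ring.
  by apply: Rle_lt_trans (Cmod_triangle _ _) _; lra.
- move=> a f l hf e e1; have N0 : (0 < 1 + Cmod a)%R by have := Cmod_ge_0 a; lra.
  have [t [t0 ht]] := hf _ (Rdiv_lt_0_compat _ _ e1 N0).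
  exists t; split=> // x /ht /(Rlt_div_r _ _ _ N0) h.
  rewrite (_ : a * f x - a * l = a * (f x - l)); last ring.
  by rewrite Cmod_mult; have := Cmod_ge_0 (f x - l); lra.
Qed.

Lemma lim_rel_ext (T T' : (C -> C) -> C -> Prop) :
  (forall H L, T H L <-> T' H L) -> is_lim_rel T -> is_lim_rel T'.
Proof.
move=> e [h1 [h2 h3]]; split; first exact/e.
by split=> [f g k l /e hf /e hg|a f l /e hf]; apply/e; [exact: h2 | exact: h3].
Qed.

Lemma ccont_close (f g : C -> C) x : ccont f x -> ccont g x ->
  (forall d : R, (0 < d)%R -> exists y, (Cmod (y - x) < d)%R /\ f y = g y) -> f x = g x.
Proof.
move=> hf hg h; apply: boolp.contrapT => n0.
have e1 := proj1 (Cmod_gt_0 _) (sub_neq0 n0).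
have e2 : (0 < Cmod (f x - g x) / 2)%R by lra.
have [d [d0 hd]] := hf _ e2; have [d' [d0' hd']] := hg _ e2.
have [y [hy e]] := h _ (Rmin_pos _ _ d0 d0').
have h1 := hd y (Rlt_minl hy).
have h2 := hd' y (Rlt_minr hy).
have := Cmod_triangle_sub (g y - g x) (f y - f x).
rewrite e (_ : g y - g x - (g y - f x) = f x - g x); last ring.
by rewrite e in h1; lra.
Qed.

Lemma ccont_le (f : C -> C) x (B : R) : ccont f x ->
  (forall d : R, (0 < d)%R -> exists y, (Cmod (y - x) < d)%R /\ (Cmod (f y) <= B)%R) ->
  (Cmod (f x) <= B)%R.
Proof.
move=> hf h; apply: le_eps => e e1; have [d [d0 hd]] := hf e e1.
have [y [/hd hy hB]] := h d d0.
by have := Cmod_ge_sub (f x) (f y); rewrite (Cmod_sub_sym (f x)); lra.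
Qed.

Definition shift (x : C) (t : R) : C := (Re x + t, Im x)%R.

Lemma shift_near x t d : (Rabs t < d)%R -> (Cmod (shift x t - x) < d)%R.
Proof.
move=> ht; have -> : shift x t - x = RtoC t by apply: C_ext; rewrite /shift /Re /Im /=; ring.
by rewrite Cmod_R.
Qed.

Lemma left_near D x d : copen D -> D x -> (0 < d)%R ->
  exists y, (Cmod (y - x) < d)%R /\ D y /\ (Re y < Re x)%R /\ Im y = Im x.
Proof.
move=> oD /oD [d' [d0' hd']] d0; have m0 := Rmin_pos _ _ d0 d0'.
set t := (- (Rmin d d' / 2))%R.
have at' : (Rabs t < Rmin d d')%R by rewrite /t Rabs_Ropp Rabs_pos_eq; lra.
exists (shift x t); split.
  by apply: shift_near; exact: Rlt_le_trans at' (Rmin_l _ _).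
split; first by apply: hd'; apply: shift_near; exact: Rlt_le_trans at' (Rmin_r _ _).
by split=> //; rewrite /shift /= /t; lra.
Qed.

Lemma right_near D x d : copen D -> D x -> (0 < d)%R ->
  exists y, (Cmod (y - x) < d)%R /\ D y /\ (Re x < Re y)%R /\ Im y = Im x.
Proof.
move=> oD /oD [d' [d0' hd']] d0; have m0 := Rmin_pos _ _ d0 d0'.
set t := (Rmin d d' / 2)%R.
have at' : (Rabs t < Rmin d d')%R by rewrite /t Rabs_pos_eq; lra.
exists (shift x t); split.
  by apply: shift_near; exact: Rlt_le_trans at' (Rmin_l _ _).
split; first by apply: hd'; apply: shift_near; exact: Rlt_le_trans at' (Rmin_r _ _).
by split=> //; rewrite /shift /= /t; lra.
Qed.

Lemma Cmod_small_eq0 (x : C) (N : R) : (0 < N)%R ->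
  (forall e : R, (0 < e)%R -> (Cmod x <= N * e)%R) -> x = 0.
Proof.
move=> N0 h; apply: Cmod_eq_0; apply: Rle_antisym; last exact: Cmod_ge_0.
apply: le_eps => e e0; have := h _ (Rdiv_lt_0_compat _ _ e0 N0).
by rewrite (_ : N * (e / N) = e)%R; [lra | field; lra].
Qed.

Lemma cder_unique f x l k : cder f x l -> cder f x k -> l = k.
Proof.
case: x => a b hl hk.
have := rder_unique (rder_comp hl (rder_hline b a)) (rder_comp hk (rder_hline b a)).
by rewrite !Cmult_1_r.
Qed.

Lemma Cconj_sum (I : Type) (r : seq I) (F : I -> C) :
  Cconj (\sum_(i <- r) F i)%R = (\sum_(i <- r) Cconj (F i))%R.
Proof.
elim: r => [|i r IH]; first by rewrite !big_nil; apply: C_ext; rewrite /Re /Im /=; ring.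
by rewrite !big_cons -IH; exact: Cplus_conj.
Qed.

Lemma Cmod_vertical x t : (0 <= Im x)%R -> (Im x <= t)%R -> (Cmod x <= Cmod (Re x, t))%R.
Proof.
move=> h1 h2; rewrite /Cmod; apply: sqrt_le_1_alt; apply: Rplus_le_compat; first exact: Rle_refl.
by apply: pow_incr.
Qed.

Lemma is_derive_increasing (S dS : R -> R) a b : (a <= b)%R ->
  (forall t, is_derive S t (dS t)) -> (forall t, (0 <= dS t)%R) -> (S a <= S b)%R.
Proof.
move=> ab h h0; have [t ht|t ht|u [hu e]] := @MVT_gen S a b dS.
- exact: h.
- exact: is_derive_continuity_pt (h t).
by have := Rmult_le_pos _ _ (h0 u) (_ : (0 <= b - a)%R); lra.
Qed.

Lemma copen_open (D : C -> Prop) : copen D -> open D.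
Proof. by move=> h x /h hx; apply/locally_Cmod. Qed.

(** Here neighbourhoods are those of the absolute value of [C_AbsRing], not of the product structure
    on pairs treated by [locally_Cmod]; [cder], written with the modulus, serves as the common
    form. *)
Lemma cder_is_derive f x l :
  is_derive (K := C_AbsRing) (V := C_NormedModule) f x l <-> cder f x l.
Proof.
have lC (P : C -> Prop) : locally (T := AbsRing_UniformSpace C_AbsRing) x P <->
    exists d : R, (0 < d)%R /\ forall y, (Cmod (y - x) < d)%R -> P y.
  split=> [[d hd]|[d [d0 hd]]]; first by exists d; split; [exact: cond_pos | move=> y hy; exact: hd].
  by exists (mkposreal d d0) => y hy; apply: hd.
split.
  move=> [_ h] e e0.
  have /lC [d [d0 hd]] := h x (fun P hP => hP) (mkposreal e e0).
  exists d; split=> // y /hd.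
  rewrite /= /norm /= /minus /plus /opp /scal /= /mult /= /abs /=.
  by rewrite (_ : f y + - f x + - ((y + - x) * l) = f y - f x - l * (y - x)); last ring.
move=> h; split; first exact: is_linear_scal_l.
move=> w hw; have <- : x = w.
  exact: (@is_filter_lim_locally_unique C_AbsRing (AbsRing_NormedModule C_AbsRing)).
move=> e; apply/lC; have [d [d0 hd]] := h e (cond_pos e).
exists d; split=> // y /hd.
rewrite /= /norm /= /minus /plus /opp /scal /= /mult /= /abs /=.
by rewrite (_ : f y + - f x + - ((y + - x) * l) = f y - f x - l * (y - x)); last ring.
Qed.

End Continuity.

(** * The primitive of the integrand and its continuation *)

Section Resolvent.

Local Open Scope R_scope.
Local Open Scope C_scope.

Variables (n : nat) (eps lam : R) (c z : 'I_n.+1 -> C).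
Hypotheses (eps0 : (0 < eps)%R) (zpos : forall p, (0 < Im (z p))%R).
Hypothesis zinc : forall p q : 'I_n.+1, (p < q)%nat -> (Re (z p) < Re (z q))%R.
Hypothesis lam0 : (lam < 0)%R.

(* [s p] tells whether the logarithmic cut from [z p] goes up or down. *)
Definition branch_f (s : 'I_n.+1 -> bool) (x : C) : C :=
  (\sum_(p < n.+1) branch_term (s p) (c p) (z p) x)%R.

Definition branch_dom (s : 'I_n.+1 -> bool) (x : C) : Prop :=
  forall p, branch_dom1 (s p) (z p) x.

Definition branch_e (s : 'I_n.+1 -> bool) (x : C) : C :=
  Cexp (- Ci * (lam * x + branch_f s x) / eps).

Definition u0 (x : C) : C :=
  (\sum_(p < n.+1) (c p / (x - z p) + Cconj (c p) / (x - Cconj (z p)))%C)%R.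

Definition up_cuts (_ : 'I_n.+1) : bool := true.

Let up := up_cuts.
Let G := branch_dom up.
Let kap : R := (- lam / eps)%R.

Lemma h_phaseE x : h_phase c z lam x = lam * x + branch_f up x.
Proof. by []. Qed.

Lemma dom_GE x : dom_G z x <-> branch_dom up x.
Proof.
split=> h p; have [h1 h2] := h p; split.
- move=> [e1 e2]; apply: h1; exists (Im x - Im (z p))%R; split; first lra.
  by apply: C_ext; rewrite /Re /Im /= in e1 e2 *; lra.
- move=> [e1 e2]; apply: h2; exists (Im (Cconj (z p)) - Im x)%R; split; first lra.
  by apply: C_ext; rewrite /Re /Im /= in e1 e2 *; lra.
- by move=> [t [t0 e]]; apply: h1; rewrite e; split; rewrite /Re /Im /=; lra.
- by move=> [t [t0 e]]; apply: h2; rewrite e; split; rewrite /Re /Im /=; lra.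
Qed.

Lemma copen_branch_dom s : copen (branch_dom s).
Proof. by apply: copen_forall => p; exact: copen_branch_dom1. Qed.

Lemma hol_branch_f s : hol (branch_dom s) (branch_f s) u0.
Proof.
apply: hol_sum => [|p]; first exact: copen_branch_dom.
apply: hol_sub (hol_branch_term _ _ _); first exact: copen_branch_dom.
by move=> x; apply.
Qed.

Lemma hol_branch_e s : hol (branch_dom s) (branch_e s)
  (fun x => branch_e s x * ((- Ci / eps) * (lam + u0 x))).
Proof.
have oD := @copen_branch_dom s.
have h := hol_Cexp (hol_scal (- Ci / eps) (hol_add (hol_scal lam (hol_id oD)) (hol_branch_f s))).
have e : (fun x => branch_e s x * (- Ci / eps * (lam + u0 x))) =
  (fun x => Cexp (- Ci / eps * (lam * x + branch_f s x)) * (- Ci / eps * (lam * 1 + u0 x))).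
  apply: boolp.funext => x; rewrite /branch_e Cmult_1_r; congr (Cexp _ * _).
  by rewrite /Cdiv; ring.
rewrite e; apply: hol_ext h => x _; rewrite /branch_e; congr Cexp.
by rewrite /Cdiv; ring.
Qed.

Lemma Cmod_branch_e s x :
  Cmod (branch_e s x) = exp ((lam * Im x + Im (branch_f s x)) / eps).
Proof.
rewrite Cmod_Cexp; congr exp.
have -> : - Ci * (lam * x + branch_f s x) / eps =
    RtoC (/ eps) * (- Ci * (lam * x + branch_f s x)).
  by rewrite RtoC_inv; [rewrite /Cdiv; ring | lra].
by rewrite /Re /Im /=; field; lra.
Qed.

Lemma branch_e_neq0 s x : branch_e s x <> 0.
Proof. exact: Cexp_neq0. Qed.

Definition far (x : C) : Prop := forall p, (1 <= Cmod (x - z p))%R /\ (1 <= Cmod (x - Cconj (z p)))%R.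

(** The modulus of the exponential depends only on [lam * Im x] and the imaginary part of the phase,
    so a bounded error on the latter costs the same constant factor for the exponential and for its
    inverse. *)
Lemma branch_e_of_bound s (X : C -> Prop) (g : C -> R) :
  (exists M : R, forall x, X x -> (Rabs (Im (branch_f s x) - g x) <= M)%R) ->
  exists M : R, (0 < M)%R /\ forall x, X x ->
    (Cmod (branch_e s x) <= M * exp ((lam * Im x + g x) / eps))%R /\
    (Cmod (/ branch_e s x) <= M * exp (- ((lam * Im x + g x) / eps)))%R.
Proof.
move=> [M hM]; exists (exp (M / eps)); split; first exact: exp_pos.
move=> x /hM h; have h1 := Rle_trans _ _ _ (Rle_abs _) h.
have h2 := Rle_trans _ _ _ (Rle_abs (- (Im (branch_f s x) - g x))) _.
rewrite Rabs_Ropp in h2; have {}h2 := h2 _ h.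
have ie := Rinv_0_lt_compat _ eps0.
split.
  rewrite Cmod_branch_e -exp_plus; apply: exp_le_compat.
  by rewrite /Rdiv -Rmult_plus_distr_r; apply: Rmult_le_compat_r; lra.
rewrite Cmod_inv; last exact: branch_e_neq0.
rewrite Cmod_branch_e -exp_Ropp -exp_plus; apply: exp_le_compat.
rewrite /Rdiv !Ropp_mult_distr_l -Rmult_plus_distr_r; apply: Rmult_le_compat_r; lra.
Qed.

Lemma Im_sum_bound (X : C -> Prop) (F : 'I_n.+1 -> C -> C) :
  (forall p, exists M : R, forall x, X x -> (Rabs (Im (F p x)) <= M)%R) ->
  exists M : R, forall x, X x -> (Rabs (Im (\sum_(p < n.+1) F p x)%R) <= M)%R.
Proof.
apply: (@sum_closed _ _ (fun f => exists M : R, forall x, X x -> (Rabs (Im (f x)) <= M)%R)).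
  by exists 0%R => x _; rewrite Rabs_R0; lra.
move=> f g [M hM] [N hN]; exists (M + N)%R => x Xx.
have -> : Im (f x + g x) = (Im (f x) + Im (g x))%R by [].
apply: Rle_trans (Rabs_triang _ _) _.
by have := hM x Xx; have := hN x Xx; lra.
Qed.

Lemma branch_e_far s : exists M : R, (0 < M)%R /\ forall x, far x ->
  (Cmod (branch_e s x) <= M * exp (lam / eps * Im x))%R /\
  (Cmod (/ branch_e s x) <= M * exp (- (lam / eps * Im x)))%R.
Proof.
have [|M [M0 hM]] := @branch_e_of_bound s far (fun _ => 0%R).
  have [|M hM] := @Im_sum_bound far (fun p => branch_term (s p) (c p) (z p)).
    move=> p; eexists => x /(_ p) [h1 h2].
    exact: branch_term_far Rlt_0_1 h1 h2.
  by exists M => x hx; rewrite Rminus_0_r; exact: hM.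
exists M; split=> // x /hM.
by rewrite (_ : (lam * Im x + 0) / eps = lam / eps * Im x)%R; last by field; lra.
Qed.

(** * Separation of the poles and size of the exponential near them *)

Lemma z_Re_inj p q : Re (z p) = Re (z q) -> p = q.
Proof.
move=> e; apply: val_inj => /=; apply/eqP; case: ltngtP => // /zinc; rewrite e; lra.
Qed.

(** The factor [2] leaves a margin: the disc of radius [d] about [z m] keeps horizontal distance at
    least [d] from every other cut, and [d <= Im (z m)] keeps it in the upper half-plane. *)
Lemma z_separated m : exists d : R, (0 < d)%R /\ (d <= Im (z m))%R /\
  forall p, p != m -> (2 * d <= Rabs (Re (z p) - Re (z m)))%R.
Proof.
have [|p|d [d0 hd]] := @finite_pos_min _ (fun p d => p != m -> (2 * d <= Rabs (Re (z p) - Re (z m)))%R).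
- by move=> p d d' h1 h2 _ /h1; lra.
- case: (eqVneq p m) => [->|pm]; first by exists 1%R; split; [lra | ].
  have h : (0 < Rabs (Re (z p) - Re (z m)))%R.
    apply: Rabs_pos_lt => h; have e : Re (z p) = Re (z m) by lra.
    by move: pm; rewrite (z_Re_inj e) eqxx.
  by exists (Rabs (Re (z p) - Re (z m)) / 2)%R; split; [lra | move=> _; lra].
exists (Rmin d (Im (z m))); split; first exact: Rmin_pos.
split; first exact: Rmin_r.
by move=> p /hd; have := Rmin_l d (Im (z m)); lra.
Qed.

(* With [Cmod (branch_e s x)] of the order of [r ^ b], [r = Cmod (x - z m)]. *)
Lemma branch_e_near s m : exists d M : R, (0 < d)%R /\ (d <= Im (z m))%R /\
  (forall p, p != m -> (2 * d <= Rabs (Re (z p) - Re (z m)))%R) /\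
  (0 < M)%R /\ forall x, (0 < Cmod (x - z m) < d)%R ->
  (Cmod (branch_e s x) <= M * exp (Im (c m) / eps * ln (Cmod (x - z m))))%R /\
  (Cmod (/ branch_e s x) <= M * exp (- (Im (c m) / eps * ln (Cmod (x - z m)))))%R.
Proof.
have [d [d0 [dm hd]]] := z_separated m; exists d.
pose X x := (0 < Cmod (x - z m) < d)%R.
(* Only the [m]-th term is unbounded near [z m]. Its logarithm is removed from that term alone, as a
   purely imaginary number, so that one bound on imaginary parts covers every term. *)
pose lg x : C := RtoC (Im (c m) * ln (Cmod (x - z m))) * Ci.
pose F p x := branch_term (s p) (c p) (z p) x - (if p == m then lg x else 0).
have Imlg x : Im (lg x) = (Im (c m) * ln (Cmod (x - z m)))%R by rewrite /lg /Im /=; ring.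
have [|N hN] := @Im_sum_bound X F.
  move=> p; rewrite /F; case: (eqVneq p m) => [->|pm].
    eexists => x [x0 xd]; rewrite Im_sub Imlg; apply: branch_term_near => //; lra.
  eexists => x [x0 xd]; rewrite (_ : forall y : C, y - 0 = y); last by move=> y; ring.
  have h : (d <= Rabs (Re (x - z p)))%R.
    have := hd _ pm; have := re_le_Cmod (x - z m).
    rewrite !Re_sub => h1 h2.
    have := Rabs_triang (Re (z p) - Re x) (Re x - Re (z m)).
    rewrite (_ : Re (z p) - Re x + (Re x - Re (z m)) = Re (z p) - Re (z m))%R; last ring.
    by rewrite (Rabs_minus_sym (Re x) (Re (z p))); lra.
  apply: (branch_term_far (s p) (c p) d0).
    exact: Rle_trans h (re_le_Cmod _).
  apply: Rle_trans (re_le_Cmod _); move: h; by rewrite !Re_sub.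
have [|M [M0 hM]] := @branch_e_of_bound s X (fun x => Im (c m) * ln (Cmod (x - z m)))%R.
  exists N => x /hN; rewrite -Imlg -Im_sub.
  suff -> : (\sum_(p < n.+1) F p x)%R = branch_f s x - lg x by [].
  have := GRing.sumrB (index_enum 'I_n.+1) xpredT (fun p => branch_term (s p) (c p) (z p) x)
     (fun p => if p == m then lg x else 0).
  have -> : (\sum_(p < n.+1) (if p == m then lg x else 0))%R = lg x.
    by rewrite -(@big_mkcond _ _ _ _ _ (fun p => p == m)) big_pred1_eq.
  by [].
(* The factor [exp (lam * Im x / eps)] is bounded above and below in the disc, where
   [|Im x| <= 2 * Im (z m)]. *)
have [N' [N0' hN']] : exists N' : R, (0 < N')%R /\ forall x, X x -> (exp (Rabs (lam * Im x / eps)) <= N')%R.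
  exists (exp (Rabs lam * (2 * Im (z m)) / eps)); split; first exact: exp_pos.
  move=> x [x0 xd]; apply: exp_le_compat.
  have h := im_le_Cmod (x - z m); rewrite Im_sub in h.
  have h2 : (Rabs (Im x) <= 2 * Im (z m))%R.
    rewrite (_ : Im x = (Im x - Im (z m)) + Im (z m))%R; last ring.
    apply: Rle_trans (Rabs_triang _ _) _; rewrite (Rabs_pos_eq (Im (z m))).
      lra.
    by have := zpos m; lra.
  rewrite /Rdiv !Rabs_mult (Rabs_pos_eq (/ eps)); last by apply/Rlt_le/Rinv_0_lt_compat.
  apply: Rmult_le_compat_r; first by apply/Rlt_le/Rinv_0_lt_compat.
  by apply: Rmult_le_compat_l => //; exact: Rabs_pos.
exists (M * N')%R; do 3 split=> //; split; first exact: Rmult_lt_0_compat.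
move=> x Xx; have [h1 h2] := hM x Xx; have h3 := hN' x Xx.
have h4 : (exp (lam * Im x / eps) <= N')%R.
  by apply: Rle_trans h3; apply: exp_le_compat; exact: Rle_abs.
have h5 : (exp (- (lam * Im x / eps)) <= N')%R.
  by apply: Rle_trans h3; apply: exp_le_compat; rewrite -Rabs_Ropp; exact: Rle_abs.
split.
  apply: Rle_trans h1 _.
  rewrite (_ : (lam * Im x + _) / eps = lam * Im x / eps + Im (c m) / eps * ln (Cmod (x - z m)))%R.
    rewrite exp_plus -Rmult_assoc; apply: Rmult_le_compat_r; first exact/Rlt_le/exp_pos.
    by apply: Rmult_le_compat_l => //; lra.
  by field; lra.
apply: Rle_trans h2 _.
rewrite (_ : - ((lam * Im x + _) / eps) =
    - (lam * Im x / eps) + - (Im (c m) / eps * ln (Cmod (x - z m))))%R.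
  rewrite exp_plus -Rmult_assoc; apply: Rmult_le_compat_r; first exact/Rlt_le/exp_pos.
  by apply: Rmult_le_compat_l => //; lra.
by field; lra.
Qed.

Lemma kap_pos : (0 < kap)%R.
Proof. by apply: Rdiv_lt_0_compat; lra. Qed.

Lemma zle (p q : 'I_n.+1) : (p <= q)%nat -> (Re (z p) <= Re (z q))%R.
Proof.
rewrite leq_eqVlt => /orP [/eqP /val_inj ->|/zinc]; first exact: Rle_refl.
exact: Rlt_le.
Qed.

Lemma branch_dom_off_poles s x : branch_dom s x -> off_poles z x.
Proof. by move=> h p e; have [] := branch_dom1_neq (h p); rewrite e; case; ring. Qed.

Lemma weight_far phi : exists N : R, (0 <= N)%R /\ forall x, far x -> (Cmod (weight z phi x) <= N)%R.
Proof.
have [||N [N0 hN]] := @weight_bound n z phi (far) (fun _ => 1%R).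
- by move=> *; lra.
- move=> p; exists 1%R => x /(_ p) [h1 _]; split; last lra.
  by move=> e; rewrite e Cmod_xx in h1; lra.
by exists N; split=> // x /hN; rewrite Rmult_1_r.
Qed.

(** * The integrand, its strips of decay, and its primitive *)

Definition integrand s phi (x : C) : C := branch_e s x * weight z phi x.

Lemma hol_integrand s phi : exists df, hol (branch_dom s) (integrand s phi) df.
Proof.
have [dw hw] := hol_weight z phi; eexists; apply: hol_mul; first exact: hol_branch_e.
apply: hol_sub hw; first exact: copen_branch_dom.
exact: branch_dom_off_poles.
Qed.

Lemma integrand_far s phi : exists B : R, (0 <= B)%R /\ forall x, far x ->
  (Cmod (integrand s phi x) <= B * exp (- kap * Im x))%R.
Proof.
have [M [M0 hM]] := branch_e_far s.
have [N [N0 hN]] := weight_far phi.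
exists (M * N)%R; split=> [|x hx]; first by apply: Rmult_le_pos; lra.
have [h1 _] := hM x hx; have h2 := hN x hx; rewrite Cmod_mult.
rewrite (_ : - kap * Im x = lam / eps * Im x)%R; last by rewrite /kap; field; lra.
rewrite (_ : M * N * _ = M * exp (lam / eps * Im x) * N)%R; last ring.
by apply: Rmult_le_compat => //; exact: Cmod_ge_0.
Qed.

(* The [k]-th strip lies between the cuts from [z (k - 1)] and [z k]; strips
   [0] and [n + 1] are half-planes. *)
Definition strip (k : nat) (t : R) : Prop := forall p : 'I_n.+1,
  ((p < k)%nat -> (Re (z p) < t)%R) /\ ((k <= p)%nat -> (t < Re (z p))%R).

Lemma strip_convex k s t u : strip k s -> strip k t -> (s <= u <= t)%R -> strip k u.
Proof.
move=> hs ht hu p; have [h1 h2] := hs p; have [h3 h4] := ht p.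
by split; [move=> /h1; lra | move=> /h4; lra].
Qed.

Lemma strip_off k t p : strip k t -> t <> Re (z p).
Proof.
move=> /(_ p) [h1 h2]; case: (ltnP p k) => hp; [have := h1 hp | have := h2 hp]; lra.
Qed.

Lemma off_cuts_dom x : (forall p, Re x <> Re (z p)) -> G x.
Proof. by move=> h p; split=> -[e _]; apply: (h p). Qed.

Lemma strip_dom k x : strip k (Re x) -> G x.
Proof. by move=> h; apply: off_cuts_dom => p; exact: strip_off h. Qed.

(** The strip is indexed by the least [k] such that all poles from the [k]-th on lie to the right of
    [t]. *)
Lemma strip_exists t : (forall p, t <> Re (z p)) ->
  exists k, (k <= n.+1)%nat /\ strip k t.
Proof.
move=> h.
pose P k := boolp.asbool (forall p : 'I_n.+1, (k <= p)%nat -> (t < Re (z p))%R).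
have Pn : P n.+1 by apply/boolp.asboolP => p; rewrite leqNgt ltn_ord.
have exP : exists k, P k by exists n.+1.
exists (ex_minn exP); case: ex_minnP => k /boolp.asboolP hk kmin; split; first exact: kmin.
move=> p; split; last exact: hk.
move=> pk; case: (Rtotal_order (Re (z p)) t) => [//|[e|tp]]; first by case: (h p).
have : P p.
  by apply/boolp.asboolP => q pq; apply: Rlt_le_trans tp (zle pq).
by move=> /kmin; rewrite leqNgt pk.
Qed.

Lemma high_far : exists Y : R, (0 < Y)%R /\ forall x, (Y <= Im x)%R -> far x.
Proof.
have [Y [Y0 hY]] := finite_max (fun p => Im (z p) + 1)%R.
exists Y; split=> // x hx p; have := hY p; have := zpos p => p0 hp.
split; apply: Rle_trans (im_le_Cmod _); rewrite Im_sub.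
  by apply: Rle_trans (Rle_abs _); lra.
apply: Rle_trans (Rle_abs _); rewrite (_ : Im (Cconj (z p)) = - Im (z p))%R //; lra.
Qed.

Definition tends_top (H : C -> C) (k : nat) (L : C) : Prop :=
  forall e : R, (0 < e)%R -> exists Y : R, forall x, strip k (Re x) -> (Y < Im x)%R ->
    (Cmod (H x - L) < e)%R.

Definition tends_pole (H : C -> C) (m : 'I_n.+1) (L : C) : Prop :=
  forall e : R, (0 < e)%R -> exists d : R, (0 < d)%R /\
    forall x, G x -> (Cmod (x - z m) < d)%R -> (Cmod (H x - L) < e)%R.

Lemma tends_top_exists phi H k :
  (forall x, G x -> cder H x (integrand up phi x)) -> exists L, tends_top H k L.
Proof.
move=> hH; have [Y [Y0 hY]] := high_far; have [B [B0 hB]] := integrand_far up phi.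
have [||L hL] := @half_strip_limit (strip k) Y B kap H (integrand up phi) kap_pos (@strip_convex k).
- by move=> x hx _; apply: hH; exact: strip_dom hx.
- by move=> x _ hx; apply: hB; apply: hY; lra.
exists L => e e1; have [Y1 hY1] := @exp_decay kap (B / kap) e kap_pos e1.
exists (Rmax Y Y1) => x hx hi; have := Rmax_l Y Y1; have := Rmax_r Y Y1 => m1 m2.
by apply: Rle_lt_trans (hL x hx _) (hY1 _ _); lra.
Qed.

(* The primitive of the integrand that vanishes at [i oo] in [G_0]. *)
Definition is_primitive phi (H : C -> C) : Prop :=
  (forall x, G x -> cder H x (integrand up phi x)) /\ tends_top H 0 0.

Lemma cder_sub_const H x l L : cder H x l -> cder (fun y => H y - L) x l.
Proof.
move=> h; have := cder_add h (cder_const (- L) x).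
by rewrite (_ : l + 0 = l); last ring.
Qed.

(** All cuts point away from the real axis, so the vertical segment from the axis to a point of [G]
    stays in [G]. The L-shaped paths can therefore follow the real axis first, and the limit in the
    leftmost strip is subtracted afterwards. *)
Lemma primitive_exists phi : exists H, is_primitive phi H.
Proof.
have [df hf] := hol_integrand up phi.
have [x|H hH] := @antiderivative G _ _ 0 0 hf.
  move=> Gx; split=> [t _ p|s hs p]; split=> -[]; rewrite /Re /Im /= => h1 h2.
  - by have := zpos p; rewrite /Im; lra.
  - by have := zpos p; rewrite /Im; lra.
  - have [h _] := Gx p; apply: h; split=> //; move: (zpos p) hs h2.
    by rewrite /Rmin /Rmax /Im; case: Rle_dec => ? /=; lra.
  - have [_ h] := Gx p; apply: h; split=> //; move: (zpos p) hs h2.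
    by rewrite /Rmin /Rmax /Im /=; case: Rle_dec => ? /=; lra.
have [L hL] := tends_top_exists 0 hH.
exists (fun x => H x - L); split=> [x Gx|e e1]; first exact: cder_sub_const (hH _ Gx).
have [Y hY] := hL e e1; exists Y => x hx hi.
by rewrite (_ : H x - L - 0 = H x - L); [exact: hY | ring].
Qed.

(* Integration along the vertical half-line above [x]. *)
Lemma vertical_bound s phi H : exists B : R, (0 < B)%R /\ forall (x : C) (W : R), (0 <= W)%R ->
  (forall t, (Im x <= t)%R -> cder H (Re x, t) (integrand s phi (Re x, t)) /\
     far (Re x, t) /\ (Cmod (weight z phi (Re x, t)) <= W)%R) ->
  (forall e : R, (0 < e)%R -> exists Y : R, forall t, (Y < t)%R -> (Cmod (H (Re x, t)) < e)%R) ->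
  (Cmod (H x) <= B * W * exp (- kap * Im x))%R.
Proof.
have [M [M0 hM]] := branch_e_far s; have k0 := kap_pos.
exists (M / kap)%R; split=> [|x W W0 hx h0]; first exact: Rdiv_lt_0_compat.
apply: le_eps => e e1; have [Y hY] := h0 e e1.
set T := (Rmax (Im x) (Y + 1))%R; have T1 : (Im x <= T)%R := Rmax_l _ _.
have T2 : (Y + 1 <= T)%R := Rmax_r _ _.
have h := @mean_value_ineq (fun t => H (Re x, t)) (fun t => Ci * integrand s phi (Re x, t))
  (fun t => - (M * W / kap) * exp (- kap * t))%R (fun t => M * W * exp (- kap * t))%R (Im x) T T1.
have {}h : (Cmod (H (Re x, T) - H (Re x, Im x)) <= - (M * W / kap) * exp (- kap * T) -
    - (M * W / kap) * exp (- kap * Im x))%R.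
  apply: h => t ht.
  - have [h _] := hx t (proj1 ht); have := rder_comp h (rder_vline (Re x) t).
    by rewrite Cmult_comm.
  - by auto_derive => //; field; lra.
  - have [_ [h1 h2]] := hx t (proj1 ht); have [h3 _] := hM _ h1.
    rewrite !Cmod_mult Cmod_Ci Rmult_1_l.
    rewrite (_ : - kap * t = lam / eps * Im (Re x, t))%R; last by rewrite /kap /Im /=; field; lra.
    rewrite (_ : M * W * _ = M * exp (lam / eps * Im (Re x, t)) * W)%R; last ring.
    by apply: Rmult_le_compat => //; exact: Cmod_ge_0.
have h1 := hY T (_ : (Y < T)%R).
have {}h1 : (Cmod (H (Re x, T)) < e)%R by apply: h1; lra.
have xe : x = (Re x, Im x) := surjective_pairing x.
have h2 : (0 <= M * W / kap * exp (- kap * T))%R.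
  apply: Rmult_le_pos; last exact/Rlt_le/exp_pos.
  by apply: Rdiv_le_0_compat => //; apply: Rmult_le_pos; lra.
have := Cmod_triangle_sub (H (Re x, T)) (H (Re x, T) - H (Re x, Im x)).
rewrite (_ : H (Re x, T) - (H (Re x, T) - H (Re x, Im x)) = H (Re x, Im x)); last ring.
rewrite -xe; move=> h3; rewrite -xe in h.
by rewrite (_ : M / kap * W = M * W / kap)%R; [lra | field; lra].
Qed.

Lemma far_left phi (e : R) : (0 < e)%R -> exists X : R, forall x, (Re x < X)%R ->
  strip 0 (Re x) /\ far x /\ (Cmod (weight z phi x) <= e)%R.
Proof.
move=> e1.
pose Z x := (Re x < Re (z ord0) - 1)%R.
have hZ x p : Z x -> (Re (z ord0) - Re x <= Re (z p) - Re x)%R.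
  by move=> _; have := zle (leq0n p : (ord0 <= p)%nat); lra.
have hC x p : Z x -> (Re (z ord0) - Re x <= Cmod (x - z p))%R.
  move=> Zx; apply: Rle_trans (re_le_Cmod _); rewrite Re_sub Rabs_minus_sym.
  by apply: Rle_trans (Rle_abs _); exact: hZ.
have [||N [N0 hN]] := @weight_bound n z phi Z (fun x => Re (z ord0) - Re x)%R.
- by move=> x; rewrite /Z; lra.
- move=> p; exists 1%R => x Zx; rewrite Rmult_1_l; split; last exact: hC.
  by move=> h; have := hC x p Zx; rewrite h Cmod_xx; move: Zx; rewrite h /Z; lra.
exists (Re (z ord0) - 1 - N / e)%R => x hx.
have Ne : (0 <= N / e)%R by exact: Rdiv_le_0_compat.
have Zx : Z x by rewrite /Z; lra.
split; last split.
- by move=> p; split=> // _; have := hZ x p Zx; move: Zx; rewrite /Z; lra.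
- move=> p; split; first by have := hC x p Zx; move: Zx; rewrite /Z; lra.
  apply: Rle_trans (re_le_Cmod _); rewrite Re_sub Rabs_minus_sym.
  apply: Rle_trans (Rle_abs _); rewrite (_ : Re (Cconj (z p)) = Re (z p)) //.
  by have := hZ x p Zx; move: Zx; rewrite /Z; lra.
- have h1 := hN x Zx; have h2 : (N <= e * (Re (z ord0) - Re x))%R.
    have h3 : (N / e <= Re (z ord0) - Re x)%R by lra.
    by move/Rle_div_l: h3 => /(_ e1); rewrite Rmult_comm.
  apply: (Rmult_le_reg_r (Re (z ord0) - Re x)); last lra.
  by move: Zx; rewrite /Z; lra.
Qed.

(** * Contour integrals as limits of the primitive *)

(** Towards [-oo] the integrand has no exponential decay, so the primitive is estimated from above
    instead: on the vertical half-line over [g t] it comes down from [i oo] against a weight of size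
    [W], which is small on the far left. The factor [exp (kap * M)] in [W] allows for the imaginary
    part of the path, at most [M] in absolute value. *)
Lemma primitive_at_minus_infty phi H g : is_primitive phi H -> starts_at_minus_infty g ->
  forall e : R, (0 < e)%R -> Rbar_locally m_infty (fun t => (Cmod (H (g t) - 0) < e)%R).
Proof.
move=> [hH h0] [g1 [M gM]] e e1.
have [B [B0 hB]] := vertical_bound up phi H.
have E0 := exp_pos (kap * M); have k0 := kap_pos.
set W := (e / 2 / (B * exp (kap * M)))%R.
have BE : (0 < B * exp (kap * M))%R by exact: Rmult_lt_0_compat.
have W0 : (0 < W)%R by apply: Rdiv_lt_0_compat => //; lra.
have [X hX] := far_left phi W0.
have gX : Rbar_locally m_infty (fun t => (Re (g t) < X)%R).
  by apply: (g1 (fun y => (y < X)%R)); exists X.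
apply: filter_imp (filter_and _ _ gX gM) => t [hx hM].
rewrite (_ : H (g t) - 0 = H (g t)); last ring.
apply: Rle_lt_trans (hB (g t) W (Rlt_le _ _ W0) _ _) _.
- move=> u _; have [h1 [h2 h3]] := hX (Re (g t), u) hx.
  by split=> //; apply: hH; exact: strip_dom h1.
- move=> e' e1'; have [Y hY] := h0 e' e1'; exists Y => u hu.
  have [h1 _] := hX (Re (g t), u) hx.
  by have := hY (Re (g t), u) h1 hu; rewrite (_ : forall y : C, y - 0 = y); last by move=> y; ring.
- have h : (exp (- kap * Im (g t)) <= exp (kap * M))%R.
    apply: exp_le_compat; have := Rle_abs (- Im (g t)); rewrite Rabs_Ropp => h.
    have := Rmult_le_compat_l _ _ _ (Rlt_le _ _ k0) (Rle_trans _ _ _ h hM); lra.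
  have BW : (0 <= B * W)%R by apply: Rmult_le_pos; lra.
  apply: Rle_lt_trans (Rmult_le_compat_l _ _ _ BW h) _.
  rewrite /W (_ : B * (e / 2 / (B * exp (kap * M))) * exp (kap * M) = e / 2)%R; first lra.
  by field; split; lra.
Qed.

Lemma tends_top_start H L g : tends_top H 0 L -> starts_at_i_infty_in (dom_G0 z) g ->
  forall e : R, (0 < e)%R -> Rbar_locally m_infty (fun t => (Cmod (H (g t) - L) < e)%R).
Proof.
move=> hL [g1 g2] e e1; have [Y hY] := hL e e1.
have gY : Rbar_locally m_infty (fun t => (Y < Im (g t))%R).
  by apply: (g1 (fun y => (Y < y)%R)); exists Y.
apply: filter_imp (filter_and _ _ gY g2) => t [hy hd]; apply: hY => // p; split=> // _.
by move: hd; rewrite /dom_G0; have := zle (leq0n p : (ord0 <= p)%nat); lra.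
Qed.

(** [insub] fails exactly at the last pole, where the strip numbered [m + 1] is the half-plane to
    the right of all cuts. *)
Lemma dom_G_right_strip Rad (m : 'I_n.+1) x : dom_G_right z Rad m x -> strip m.+1 (Re x).
Proof.
rewrite /dom_G_right; case: insubP => [q _ qm|] /=.
  move=> [_ [_ [h1 h2]]] p; split=> hp.
    by have := zle (hp : (p <= m)%nat); lra.
  by have := @zle q p; rewrite qm => /(_ hp); lra.
rewrite -leqNgt => hm hx p; split=> hp.
  by have := zle (hp : (p <= m)%nat); lra.
by have := leq_ltn_trans hp (ltn_ord p); rewrite ltnNge hm.
Qed.

Lemma tends_top_end H L Rad (m : 'I_n.+1) g : tends_top H m.+1 L -> ends_at_i_infty_in (dom_G_right z Rad m) g ->
  forall e : R, (0 < e)%R -> Rbar_locally p_infty (fun t => (Cmod (H (g t) - L) < e)%R).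
Proof.
move=> hL [g1 g2] e e1; have [Y hY] := hL e e1.
have gY : Rbar_locally p_infty (fun t => (Y < Im (g t))%R).
  by apply: (g1 (fun y => (Y < y)%R)); exists Y.
apply: filter_imp (filter_and _ _ gY g2) => t [hy /dom_G_right_strip hd]; exact: hY.
Qed.

Lemma ends_at_near x g d : ends_at x g -> (0 < d)%R ->
  Rbar_locally p_infty (fun t => (Cmod (g t - x) < d)%R).
Proof.
by move=> h d0; apply: (h (fun y => (Cmod (y - x) < d)%R)); apply/locally_Cmod; exists d.
Qed.

Lemma tends_pole_end H L m g : tends_pole H m L -> (forall t, G (g t)) -> ends_at (z m) g ->
  forall e : R, (0 < e)%R -> Rbar_locally p_infty (fun t => (Cmod (H (g t) - L) < e)%R).
Proof.
move=> hL gG hg e e1; have [d [d0 hd]] := hL e e1.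
by apply: filter_imp (ends_at_near hg d0) => t ht; exact: hd.
Qed.

Lemma contour_in_dom g : contour_in (dom_G z) g -> contour_in G g.
Proof. by move=> [h1 h2]; split=> // t; apply/dom_GE. Qed.

Lemma primitive_ccont phi x : G x -> ccont (integrand up phi) x.
Proof. by move=> Gx; have [df hf] := hol_integrand up phi; exact: hol_ccont hf Gx. Qed.

Lemma contour_int_path phi H x g : is_primitive phi H -> G x -> is_path_to z x g ->
  contour_int (integrand up phi) g = H x.
Proof.
move=> hp Gx [g1 [g2 g3]]; have [hH _] := hp.
rewrite (contour_int_primitive hH (@primitive_ccont phi) (contour_in_dom g1) (l0 := 0) (l1 := H x)).
- by ring.
- exact: primitive_at_minus_infty hp g2.
- move=> e e1; have [d [d0 hd]] := cder_ccont (hH x Gx) e1.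
  by apply: filter_imp (ends_at_near g3 d0) => t; exact: hd.
Qed.

(** The limit of a primitive at the far end of the contour attached to [m], in both cases of
    [is_C_contour]. For the primitive belonging to [unit_weight p] it is the matrix entry in row [m]
    and column [p]. *)
Definition tends_end (H : C -> C) (m : 'I_n.+1) (L : C) : Prop :=
  (~ strictly_negative_integer (Ci * c m / eps) -> tends_top H m.+1 L) /\
  (strictly_negative_integer (Ci * c m / eps) -> tends_pole H m L).

Lemma contour_int_end phi H L Rad m g : is_primitive phi H -> tends_end H m L ->
  is_C_contour eps c z Rad m g -> contour_int (integrand up phi) g = L.
Proof.
move=> [hH h0] [hL1 hL2] [hg1 hg2].
case: (boolp.pselect (strictly_negative_integer (Ci * c m / eps))) => hc.
  have [g1 [g2 g3]] := hg2 hc; have gG := contour_in_dom g1.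
  rewrite (contour_int_primitive hH (@primitive_ccont phi) gG (l0 := 0) (l1 := L)).
  - by ring.
  - exact: tends_top_start h0 g2.
  - by apply: tends_pole_end g3; [exact: hL2 | case: gG].
have [g1 [g2 g3]] := hg1 hc; have gG := contour_in_dom g1.
rewrite (contour_int_primitive hH (@primitive_ccont phi) gG (l0 := 0) (l1 := L)).
- by ring.
- exact: tends_top_start h0 g2.
- by apply: tends_top_end g3; exact: hL1.
Qed.

(** * Behaviour of the primitive at a pole *)

Definition pole_exponent (m : 'I_n.+1) : R := (Im (c m) / eps)%R.

Lemma near_pole_dom m d x : (d <= Im (z m))%R ->
  (forall p, p != m -> (2 * d <= Rabs (Re (z p) - Re (z m)))%R) ->
  (Cmod (x - z m) < d)%R -> ~ up_cut (z m) x -> G x.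
Proof.
move=> dm hd xd hx p.
have h1 := re_le_Cmod (x - z m); have h2 := im_le_Cmod (x - z m).
rewrite Re_sub in h1; rewrite Im_sub in h2.
case: (eqVneq p m) => [->|/hd hp].
  split=> // -[_]; rewrite (_ : Im (Cconj (z m)) = - Im (z m))%R // => h3.
  have := Rle_abs (- (Im x - Im (z m))); rewrite Rabs_Ropp; have := zpos m; lra.
have hne : Re x <> Re (z p).
  by move=> e; rewrite e in h1; have := Cmod_ge_0 (x - z m); lra.
by split=> -[e _]; apply: hne.
Qed.

(** Inverse of [- i Log (i (x - z m))]. The rotation by [- Ci] sends the upward slit to the lines
    [Re s = PI] and [Re s = - PI]. *)
Definition pole_coord (m : 'I_n.+1) (s : C) : C := z m - Ci * Cexp (Ci * s).

Lemma pole_coord_rot m s : Ci * (pole_coord m s - z m) = Cexp (Ci * s).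
Proof.
rewrite /pole_coord; transitivity (- (Ci * Ci) * Cexp (Ci * s)); first by ring.
by rewrite Ci2; ring.
Qed.

Lemma Cmod_pole_coord m s : Cmod (pole_coord m s - z m) = exp (- Im s).
Proof.
rewrite -[LHS]Rmult_1_l -Cmod_Ci -Cmod_mult pole_coord_rot Cmod_Cexp.
by congr exp; rewrite /Re /Im /=; ring.
Qed.

Lemma pole_coord_slit m s : (- PI < Re s < PI)%R -> slit (Ci * (pole_coord m s - z m)).
Proof.
move=> hs; rewrite pole_coord_rot /slit.
have -> : Re (Cexp (Ci * s)) = (exp (- Im s) * cos (Re s))%R.
  by rewrite /Cexp /Re /Im /=; congr (exp _ * cos _)%R; ring.
have -> : Im (Cexp (Ci * s)) = (exp (- Im s) * sin (Re s))%R.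
  by rewrite /Cexp /Re /Im /=; congr (exp _ * sin _)%R; ring.
have E := exp_pos (- Im s).
case: (Rtotal_order (Re s) 0) => [h|[->|h]].
- right; have := sin_gt_0 (- Re s); rewrite sin_neg => h'.
  have {}h' : (0 < - sin (Re s))%R by apply: h'; lra.
  by have := Rmult_lt_0_compat _ _ E h'; lra.
- by left; rewrite cos_0; lra.
- by right; have := Rmult_lt_0_compat _ _ E (sin_gt_0 _ h (proj2 hs)); lra.
Qed.

Lemma pole_coord_surj m x : ~ up_cut (z m) x -> exists s,
  pole_coord m s = x /\ (- PI < Re s < PI)%R /\ Im s = (- ln (Cmod (x - z m)))%R.
Proof.
move=> h; have hs := up_slit h; exists (- Ci * Log (Ci * (x - z m))).
have n0 := slit_neq0 hs.
split; last split.
- rewrite /pole_coord (_ : Ci * (- Ci * _) = - (Ci * Ci) * Log (Ci * (x - z m))); last ring.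
  rewrite Ci2 (_ : - - (1) * Log (Ci * (x - z m)) = Log (Ci * (x - z m))); last ring.
  rewrite Cexp_Log //; transitivity (z m - Ci * Ci * (x - z m)); first by ring.
  by rewrite Ci2; ring.
- have -> : Re (- Ci * Log (Ci * (x - z m))) = Carg (Ci * (x - z m)).
    by rewrite /Log /Re /=; ring.
  rewrite Carg_slit //.
  by have := atan_bound (Im (Ci * (x - z m)) / (Cmod (Ci * (x - z m)) + Re (Ci * (x - z m)))); lra.
- have -> : Im (- Ci * Log (Ci * (x - z m))) = (- ln (Cmod (Ci * (x - z m))))%R.
    by rewrite /Log /Im /=; ring.
  by rewrite Cmod_mult Cmod_Ci Rmult_1_l.
Qed.

Lemma cder_pole_coord m s : cder (pole_coord m) s (Cexp (Ci * s)).
Proof.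
have h : cder (fun s => Cexp (Ci * s)) s (Cexp (Ci * s) * (Ci * 1)).
  by apply: (@cder_comp (fun w => Ci * w)); [exact: cder_scal (cder_id s) | exact: cder_Cexp].
have := cder_add (cder_const (z m) s) (cder_scal (- Ci) h).
rewrite (_ : 0 + - Ci * (Cexp (Ci * s) * (Ci * 1)) = - (Ci * Ci) * Cexp (Ci * s)); last ring.
rewrite Ci2 (_ : - - (1) * Cexp (Ci * s) = Cexp (Ci * s)); last ring.
by apply: cder_ext_loc; exists 1%R; split=> [|y _]; [lra | rewrite /pole_coord; ring].
Qed.

(* The primitive in the coordinate [s], [x = z m - i exp (i s)]: [Im s] is
   [- ln |x - z m|], and the slit disc becomes a half-strip. *)
Lemma pole_coord_bound phi H m : (forall x, G x -> cder H x (integrand up phi x)) ->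
  exists Y B : R, (0 <= Y)%R /\ (0 <= B)%R /\ forall s, (- PI < Re s < PI)%R -> (Y < Im s)%R ->
  cder (fun s => H (pole_coord m s)) s
    (integrand up phi (pole_coord m s) * Cexp (Ci * s)) /\
  (Cmod (integrand up phi (pole_coord m s) * Cexp (Ci * s)) <=
     B * exp (- pole_exponent m * Im s))%R.
Proof.
move=> hH.
have [d [M [d0 [dm [hd [M0 hM]]]]]] := branch_e_near up m.
pose X x := (0 < Cmod (x - z m) < d)%R.
have [||N [N0 hN]] := @weight_bound n z phi X (fun x => Cmod (x - z m)).
- by move=> x [].
- move=> p; exists 1%R => x [x0 xd]; rewrite Rmult_1_l.
  case: (eqVneq p m) => [->|/hd hp].
    by split; [move=> e; rewrite e Cmod_xx in x0; lra | lra].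
  have h : (d <= Cmod (x - z p))%R.
    apply: Rle_trans (re_le_Cmod _); have := re_le_Cmod (x - z m); rewrite !Re_sub => h1.
    have := Rabs_triang (Re (z p) - Re x) (Re x - Re (z m)).
    rewrite (_ : Re (z p) - Re x + (Re x - Re (z m)) = Re (z p) - Re (z m))%R; last ring.
    by rewrite (Rabs_minus_sym (Re x) (Re (z p))); lra.
  by split; [move=> e; rewrite e Cmod_xx in h; lra | lra].
exists (Rmax 0 (- ln d)), (M * N)%R; split; first exact: Rmax_l.
split; first by apply: Rmult_le_pos; lra.
move=> s hs hY; have hY' := Rle_lt_trans _ _ _ (Rmax_r _ _) hY.
set x := pole_coord m s; have hr : Cmod (x - z m) = exp (- Im s) := Cmod_pole_coord m s.
have Xx : X x.
  rewrite /X hr; split; first exact: exp_pos.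
  by rewrite -[X in (_ < X)%R](exp_ln _ d0); apply: exp_increasing; lra.
have Gx : G x.
  apply: (near_pole_dom dm hd (proj2 Xx)).
  by apply: slit_not_up_cut; exact: pole_coord_slit.
split; first exact: cder_comp (cder_pole_coord m s) (hH _ Gx).
(* [dx / ds] has modulus [|x - z m|], which cancels the simple pole that the weight may have at
   [z m]. What remains is the exponential, of order [|x - z m| ^ b = exp (- b * Im s)]. *)
have [h1 _] := hM x Xx; have h2 := hN x Xx.
rewrite /integrand !Cmod_mult -(pole_coord_rot m s) Cmod_mult Cmod_Ci Rmult_1_l -/x Rmult_assoc.
have -> : (- pole_exponent m * Im s = Im (c m) / eps * ln (Cmod (x - z m)))%R.
  by rewrite hr ln_exp /pole_exponent; field; lra.
rewrite (_ : M * N * _ = M * exp (Im (c m) / eps * ln (Cmod (x - z m))) * N)%R; last ring.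
apply: Rmult_le_compat => //; first exact: Cmod_ge_0.
by apply: Rmult_le_pos; exact: Cmod_ge_0.
Qed.

(** In the coordinate of [pole_coord] the derivative decays with rate [b > 0] in a half-strip, so
    [half_strip_limit] applies. The rate is recorded besides the limit, since it is what the removal
    of the singularity uses. *)
Lemma primitive_pole_pos phi H m : (forall x, G x -> cder H x (integrand up phi x)) ->
  (0 < pole_exponent m)%R -> exists (L : C) (B d : R), (0 < d)%R /\ (0 <= B)%R /\
  forall x, G x -> (0 < Cmod (x - z m) < d)%R ->
    (Cmod (H x - L) <= B * exp (pole_exponent m * ln (Cmod (x - z m))))%R.
Proof.
move=> hH b0; have [Y [B [Y0 [B0 hB]]]] := pole_coord_bound m hH.
have [s t u|s h1 h2|s h1 h2|L hL] := @half_strip_limit (fun t => - PI < t < PI)%R Y B (pole_exponent m)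
  (fun s => H (pole_coord m s)) (fun s => integrand up phi (pole_coord m s) * Cexp (Ci * s)) b0.
- by move=> *; lra.
- by have [] := hB s h1 h2.
- by have [] := hB s h1 h2.
exists L, (B / pole_exponent m)%R, (exp (- Y)); split; first exact: exp_pos.
split; first by apply: Rdiv_le_0_compat.
move=> x Gx [x0 xd]; have [s [e [hs sIm]]] := pole_coord_surj (proj1 (Gx m)).
rewrite -e in x0 xd sIm *; rewrite Cmod_pole_coord ln_exp (_ : pole_exponent m * - Im s = - pole_exponent m * Im s)%R; last ring.
apply: hL => //; rewrite sIm.
by have := ln_increasing _ _ x0 xd; rewrite ln_exp; lra.
Qed.

(** Integrating [exp (- b * u)] gives a power of [r = |x - z m|] for [b < 0] but a logarithm for
    [b = 0]. Replacing the rate [- b] by [g = 1 / 2 - b > 0] treats both at once, at the price of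
    the factor [r ^ (- 1 / 2)]. *)
Lemma primitive_pole_nonpos phi H m : (forall x, G x -> cder H x (integrand up phi x)) ->
  (pole_exponent m <= 0)%R -> exists (B d : R), (0 < d)%R /\ (0 <= B)%R /\
  forall x, G x -> (0 < Cmod (x - z m) < d)%R ->
    (Cmod (H x) <= B * exp ((pole_exponent m - / 2) * ln (Cmod (x - z m))))%R.
Proof.
move=> hH b0; have [Y [B [Y0 [B0 hB]]]] := pole_coord_bound m hH.
set b := pole_exponent m in b0 hB *; set y1 := (Y + 1)%R.
pose K s := H (pole_coord m s).
pose dK s := integrand up phi (pole_coord m s) * Cexp (Ci * s).
have p0 := PI_RGT_0.
set g := (/ 2 - b)%R; have g0 : (0 < g)%R by rewrite /g; lra.
(* Points are reached from [(0, y1)] by a horizontal step of length at most [PI], whose result [B1]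
   bounds, and then a vertical step. *)
set B1 := (Cmod (K (0, y1)%R) + B * exp (- b * y1) * PI)%R.
have B10 : (0 <= B1)%R.
  apply: Rplus_le_le_0_compat; first exact: Cmod_ge_0.
  by apply: Rmult_le_pos; [apply: Rmult_le_pos => //; exact/Rlt_le/exp_pos | lra].
have Bg : (0 <= B / g)%R by apply: Rdiv_le_0_compat.
exists (B1 + B / g)%R, (exp (- y1)); split; first exact: exp_pos.
split; first lra.
move=> x Gx [x0 xd]; have [s [e [hs sIm]]] := pole_coord_surj (proj1 (Gx m)).
have hy : (y1 < Im s)%R by have := ln_increasing _ _ x0 xd; rewrite ln_exp sIm; lra.
have -> : ((b - / 2) * ln (Cmod (x - z m)) = g * Im s)%R by rewrite sIm /g; ring.
rewrite -e -[H _]/(K s) {x0 xd Gx e sIm x}; case: s hs hy => t y; rewrite /Re /Im /= => ht hy.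
have h1 : (Cmod (K (t, y1) - K (0%R, y1)) <= B * exp (- b * y1) * Rabs (t - 0))%R.
  apply: (@mean_value_bound (fun u => K (u, y1)) (fun u => dK (u, y1))) => u hu.
    have hu' : (- PI < u < PI)%R by move: hu; rewrite /Rmin /Rmax; case: Rle_dec => ? /=; lra.
    have [h _] := hB (u, y1) hu' (Rlt_plus_1 Y).
    have := rder_comp h (rder_hline y1 u).
    by rewrite -/(dK _) (_ : dK (u, y1) * 1 = dK (u, y1)); last ring.
  have hu' : (- PI < u < PI)%R by move: hu; rewrite /Rmin /Rmax; case: Rle_dec => ? /=; lra.
  by have [_] := hB (u, y1) hu' (Rlt_plus_1 Y).
have h2 : (Cmod (K (t, y) - K (t, y1)) <= B / g * exp (g * y) - B / g * exp (g * y1))%R.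
  apply: (@mean_value_ineq (fun u => K (t, u)) (fun u => Ci * dK (t, u))
    (fun u => B / g * exp (g * u))%R (fun u => B * exp (g * u))%R y1 y) => [|u hu|u hu|u hu].
  - lra.
  - have hYu : (Y < u)%R by rewrite /y1 in hu; lra.
    have [h _] := hB (t, u) ht hYu; have := rder_comp h (rder_vline t u).
    by rewrite Cmult_comm.
  - by auto_derive => //; field; lra.
  - have hYu : (Y < u)%R by rewrite /y1 in hu; lra.
    have [_ h] := hB (t, u) ht hYu; rewrite Cmod_mult Cmod_Ci Rmult_1_l.
    apply: Rle_trans h _.
    apply: Rmult_le_compat_l => //; apply: exp_le_compat; rewrite /g /Im /=.
    by rewrite /y1 in hu; lra.
have E1 : (1 <= exp (g * y))%R.
  rewrite -exp_0; apply: exp_le_compat; apply: Rmult_le_pos; rewrite /y1 in hy; lra.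
have h3 : (Cmod (K (t, y1)) <= B1)%R.
  have := Cmod_triangle (K (t, y1) - K (0%R, y1)) (K (0%R, y1)).
  rewrite (_ : K (t, y1) - K (0%R, y1) + K (0%R, y1) = K (t, y1)); last ring.
  have h4 : (Rabs (t - 0) <= PI)%R by rewrite /Rabs; case: Rcase_abs; lra.
  have h5 : (0 <= B * exp (- b * y1))%R by apply: Rmult_le_pos => //; exact/Rlt_le/exp_pos.
  have := Rmult_le_compat_l _ _ _ h5 h4; rewrite /B1; lra.
have := Cmod_triangle (K (t, y) - K (t, y1)) (K (t, y1)).
rewrite (_ : K (t, y) - K (t, y1) + K (t, y1) = K (t, y)); last ring.
have := Rmult_le_compat_l _ _ _ B10 E1.
have : (0 <= B / g * exp (g * y1))%R by apply: Rmult_le_pos => //; exact/Rlt_le/exp_pos.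
lra.
Qed.

Lemma primitive_pole_lim H m L B d : (0 < pole_exponent m)%R -> (0 < d)%R -> (0 <= B)%R ->
  (forall x, G x -> (0 < Cmod (x - z m) < d)%R ->
    (Cmod (H x - L) <= B * exp (pole_exponent m * ln (Cmod (x - z m))))%R) ->
  tends_pole H m L.
Proof.
move=> b0 d0 B0 h e e1.
have [Y hY] := @exp_decay (pole_exponent m) B e b0 e1.
exists (Rmin d (exp (- Y))); split; first by apply: Rmin_pos => //; exact: exp_pos.
move=> x Gx hx; have h1 := Rlt_minl hx.
have h2 := Rlt_minr hx.
have x0 : (0 < Cmod (x - z m))%R.
  by apply/Cmod_gt_0; have [] := branch_dom1_neq (Gx m).
apply: Rle_lt_trans (h x Gx (conj x0 h1)) _.
have := ln_increasing _ _ x0 h2; rewrite ln_exp => h3.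
have := hY (- ln (Cmod (x - z m)))%R _; rewrite Rmult_opp_opp; apply; lra.
Qed.

(** If [i c / eps = - k] then [c = i k eps], so the exponent is [k] itself. *)
Lemma negative_integer_exponent m : strictly_negative_integer (Ci * c m / eps) ->
  (0 < pole_exponent m)%R.
Proof.
move=> [k hk].
have en : RtoC eps <> 0 by apply: RtoC_neq0; lra.
have e : c m = RtoC (eps * INR k.+1) * Ci.
  transitivity (- (Ci * Ci) * c m); first by rewrite Ci2; ring.
  transitivity (- Ci * eps * (Ci * c m / eps)); first by field.
  by rewrite hk RtoC_mult; ring.
rewrite /pole_exponent e (_ : Im _ = eps * INR k.+1)%R; last by rewrite /Im /=; ring.
have := lt_0_INR k.+1 (PeanoNat.Nat.lt_0_succ k).
by rewrite (_ : eps * INR k.+1 / eps = INR k.+1)%R; last by field; lra.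
Qed.

Lemma tends_end_exists phi H m : is_primitive phi H -> exists L, tends_end H m L.
Proof.
move=> hp; have [hH h0] := hp.
case: (boolp.pselect (strictly_negative_integer (Ci * c m / eps))) => hc.
  have [L [B [d [d0 [B0 h]]]]] := primitive_pole_pos hH (negative_integer_exponent hc).
  exists L; split=> // _.
  exact: primitive_pole_lim (negative_integer_exponent hc) d0 B0 h.
have [L hL] := tends_top_exists m.+1 hH.
by exists L; split.
Qed.

(** * Linear dependence of the limits on the weight *)

Lemma tends_top_base H k L : tends_top H k L <->
  forall e : R, (0 < e)%R -> exists t : R, (0 < t)%R /\
    forall x, (strip k (Re x) /\ (/ t < Im x)%R) -> (Cmod (H x - L) < e)%R.
Proof.
split=> h e /h.
  move=> [Y hY]; exists (/ (1 + Rabs Y))%R.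
  have Y0 : (0 < 1 + Rabs Y)%R by have := Rabs_pos Y; lra.
  split; first exact: Rinv_0_lt_compat.
  move=> x [sx]; rewrite Rinv_inv => hx; apply: hY => //.
  by have := Rle_abs Y; lra.
by move=> [t [t0 ht]]; exists (/ t)%R => x sx hx; apply: ht.
Qed.

Lemma tends_top_lim_rel k : is_lim_rel (fun H L => tends_top H k L).
Proof.
apply: lim_rel_ext (@lim_rel_base (fun t x => strip k (Re x) /\ (/ t < Im x)%R) _).
  by move=> H L; split=> /tends_top_base.
move=> s t x s0 st [sx hx]; split=> //; apply: Rle_lt_trans hx.
exact: Rinv_le_contravar.
Qed.

Lemma tends_pole_lim_rel m : is_lim_rel (fun H L => tends_pole H m L).
Proof.
apply: lim_rel_ext (@lim_rel_base (fun t x => G x /\ (Cmod (x - z m) < t)%R) _).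
  move=> H L; split=> h e /h [t [t0 ht]]; exists t; split=> //.
    by move=> x Gx hx; apply: ht.
  by move=> x [Gx hx]; apply: ht.
by move=> s t x s0 st [Gx hx]; split=> //; lra.
Qed.

Lemma tends_end_lim_rel m : is_lim_rel (fun H L => tends_end H m L).
Proof.
case: (boolp.pselect (strictly_negative_integer (Ci * c m / eps))) => hc.
  apply: lim_rel_ext (tends_pole_lim_rel m) => H L.
  by split=> [h|[_ h]]; [split | exact: h].
apply: lim_rel_ext (tends_top_lim_rel m.+1) => H L.
by split=> [h|[h _]]; [split | exact: h].
Qed.

(** The coordinate vectors; their primitives produce the columns of the matrix. *)
Definition unit_weight (p q : 'I_n.+1) : C := if q == p then RtoC 1 else RtoC 0.

Lemma weight_unit p x : weight z (unit_weight p) x = / (x - z p).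
Proof.
rewrite /weight (bigD1 p) //= big1.
  by rewrite /unit_weight eqxx; rewrite -[LHS]/(1 / (x - z p) + 0) /Cdiv; ring.
move=> q /negPf qp; rewrite /unit_weight qp.
by rewrite -[RHS]/(RtoC 0) /Cdiv; ring.
Qed.

Lemma primitive_sum (H : 'I_n.+1 -> C -> C) (phi : 'I_n.+1 -> C) :
  (forall p, is_primitive (unit_weight p) (H p)) ->
  is_primitive phi (fun x => (\sum_(p < n.+1) (phi p * H p x)%C)%R).
Proof.
move=> hH; split=> [x Gx|].
  have e : integrand up phi x =
      (\sum_(p < n.+1) (phi p * integrand up (unit_weight p) x)%C)%R.
    rewrite /integrand {1}/weight.
    rewrite -[LHS]/(GRing.mul (branch_e up x) (\sum_(p < n.+1) (phi p / (x - z p))%C)%R).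
    rewrite GRing.mulr_sumr.
    apply: eq_bigr => p _; rewrite weight_unit.
    by rewrite -[LHS]/(branch_e up x * (phi p / (x - z p)))%C /Cdiv; ring.
  rewrite e; apply: (@cder_sum _ _ (fun p x => phi p * H p x)) => p.
  by apply: cder_scal; have [h _] := hH p; exact: h.
have T := tends_top_lim_rel 0.
have := @lim_rel_sum _ _ (index_enum 'I_n.+1) (fun p x => phi p * H p x) (fun p => phi p * 0) T.
rewrite big1; first by apply=> p; case: T => _ [_]; apply; case: (hH p).
by move=> p _; exact: Cmult_0_r.
Qed.

Lemma tends_end_sum (H : 'I_n.+1 -> C -> C) (phi l : 'I_n.+1 -> C) m :
  (forall p, tends_end (H p) m (l p)) ->
  tends_end (fun x => (\sum_(p < n.+1) (phi p * H p x)%C)%R) m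
    (\sum_(p < n.+1) (phi p * l p)%C)%R.
Proof.
move=> h; have T := tends_end_lim_rel m.
apply: (@lim_rel_sum _ _ (index_enum 'I_n.+1) (fun p x => phi p * H p x) (fun p => phi p * l p) T).
by move=> p; case: T => _ [_]; apply.
Qed.

(** * Turning a cut: the two sides compared *)

(** [true] still means up: the cut from [z m] is the only one turned. *)
Definition turn_down (m p : 'I_n.+1) : bool := p != m.

(** The half-strip above [z m] bounded by the neighbouring upward cuts, with the open cut from [z m]
    inside. For the first and the last pole it is unbounded on the free side. *)
Definition over_cut (m : 'I_n.+1) (x : C) : Prop := (Im (z m) < Im x)%R /\
  forall p : 'I_n.+1, ((p < m)%nat -> (Re (z p) < Re x)%R) /\ ((m < p)%nat -> (Re x < Re (z p))%R).

(** The factor [q]. It arises because [log_up] exceeds [log_down] by [2 pi i] to the right of the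
    pole. *)
Definition monodromy (m : 'I_n.+1) : C := Cexp (- Ci * (c m * ((2 * PI)%R * Ci)) / eps).

Lemma branch_e_left m x : (Re x < Re (z m))%R ->
  branch_e up x = branch_e (turn_down m) x.
Proof.
move=> h; rewrite /branch_e /branch_f; congr (Cexp (- Ci * (lam * x + _) / eps)).
apply: eq_bigr => p _; rewrite /turn_down; case: eqVneq => [->|//].
by rewrite /branch_term /= log_up_left.
Qed.

Lemma branch_e_right m x : (Re (z m) < Re x)%R ->
  branch_e up x = monodromy m * branch_e (turn_down m) x.
Proof.
move=> h; rewrite /branch_e /branch_f /monodromy -Cexp_add; congr Cexp.
have -> : (\sum_(p < n.+1) branch_term (up p) (c p) (z p) x)%R =
    (\sum_(p < n.+1) branch_term (turn_down m p) (c p) (z p) x)%R + c m * ((2 * PI)%R * Ci).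
  have tm : turn_down m m = false by rewrite /turn_down eqxx.
  rewrite (bigD1 m) //= [in RHS](bigD1 m) //= tm.
  rewrite (eq_bigr (fun p => branch_term (turn_down m p) (c p) (z p) x)); last first.
    by move=> p pm; rewrite /turn_down pm.
  set S := (\sum_(p < n.+1 | _) _)%R.
  rewrite -[LHS]/(branch_term true (c m) (z m) x + S)%C.
  rewrite -[RHS]/(branch_term false (c m) (z m) x + S + c m * ((2 * PI)%R * Ci))%C.
  by rewrite /branch_term log_up_right //; ring.
by rewrite /Cdiv; ring.
Qed.

Lemma over_cut_dom m x : over_cut m x -> branch_dom (turn_down m) x.
Proof.
move=> [h1 h2] p; have p0 := zpos m; rewrite /branch_dom1 /turn_down; case: eqVneq => [->|pm] /=.
  split=> -[_]; first lra.
  by rewrite (_ : Im (Cconj (z m)) = - Im (z m))%R //; lra.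
have hne : Re x <> Re (z p).
  have [h3 h4] := h2 p; case: (ltngtP p m) => hp; [have := h3 hp; lra | have := h4 hp; lra | ].
  by move: pm; rewrite (val_inj hp) eqxx.
by split=> -[e _]; apply: hne.
Qed.

Lemma copen_over_cut m : copen (over_cut m).
Proof.
have op (P : Prop) a : copen (fun x => P -> (a < Re x)%R).
  move=> x hx; case: (boolp.pselect P) => [p|np]; last by exists 1%R; split; [lra | ].
  have h := hx p; exists (Re x - a)%R; split; first lra.
  move=> y hy _; have := re_le_Cmod (y - x); rewrite Re_sub.
  by have := Rle_abs (- (Re y - Re x)); rewrite Rabs_Ropp; lra.
have op' (P : Prop) a : copen (fun x => P -> (Re x < a)%R).
  move=> x hx; case: (boolp.pselect P) => [p|np]; last by exists 1%R; split; [lra | ].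
  have h := hx p; exists (a - Re x)%R; split; first lra.
  move=> y hy _; have := re_le_Cmod (y - x); rewrite Re_sub.
  by have := Rle_abs (Re y - Re x); lra.
apply: copen_and.
  move=> x hx; exists (Im x - Im (z m))%R; split; first lra.
  move=> y hy; have := im_le_Cmod (y - x); rewrite Im_sub.
  by have := Rle_abs (- (Im y - Im x)); rewrite Rabs_Ropp; lra.
apply: copen_forall => p; apply: copen_and; [exact: op | exact: op'].
Qed.

Lemma over_cut_left (m : 'I_n.+1) x : over_cut m x -> (Re x < Re (z m))%R -> strip m (Re x).
Proof.
move=> [_ h] hx p; have [h1 h2] := h p; split=> //.
by rewrite leq_eqVlt => /orP [/eqP /val_inj <-|/h2].
Qed.

Lemma over_cut_right m x : over_cut m x -> (Re (z m) < Re x)%R -> strip m.+1 (Re x).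
Proof.
move=> [_ h] hx p; have [h1 h2] := h p; split=> //.
by rewrite ltnS leq_eqVlt => /orP [/eqP /val_inj ->|/h1].
Qed.

Lemma over_cut_up m x t : over_cut m x -> (Im x <= t)%R -> over_cut m (Re x, t).
Proof. by move=> [h1 h2] ht; split=> //; rewrite /Im /=; rewrite /Im in h1 ht; lra. Qed.

Lemma jump phi H (m : 'I_n.+1) L L' : (forall x, G x -> cder H x (integrand up phi x)) ->
  tends_top H m L -> tends_top H m.+1 L' ->
  exists K, (forall x, over_cut m x -> cder K x (integrand (turn_down m) phi x)) /\
    (forall x, over_cut m x -> (Re x < Re (z m))%R -> H x = K x + L) /\
    (forall x, over_cut m x -> (Re (z m) < Re x)%R -> H x = monodromy m * K x + L').
Proof.
move=> hH hL hL'.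
have [df hf] := hol_integrand (turn_down m) phi.
have {}hf := hol_sub (@copen_over_cut m) (@over_cut_dom m) hf.
have [x Sx|K0 hK0] := @antiderivative (over_cut m) _ _ (Re (z m)) (Im (z m) + 1) hf.
  have [h1 h2] := Sx.
  split=> [t ht|t ht]; split; rewrite /Re /Im /=.
  - by rewrite /Im; lra.
  - move=> p; have [h3 h4] := h2 p; split=> hp; move: (zinc hp) ht;
      [have := h3 hp | have := h4 hp]; rewrite /Rmin /Rmax /Re; case: Rle_dec => ? /=; lra.
  - by move: ht h1; rewrite /Rmin /Rmax /Im; case: Rle_dec => ? /=; lra.
  - exact: h2.
have [Y [Y0 hY]] := high_far; have [B [B0 hB]] := integrand_far (turn_down m) phi.
pose I t := forall p : 'I_n.+1, ((p < m)%nat -> (Re (z p) < t)%R) /\ ((m < p)%nat -> (t < Re (z p))%R).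
have Yx x : I (Re x) -> (Rmax Y (Im (z m)) < Im x)%R -> over_cut m x.
  by move=> Ix hx; split=> //; have := Rmax_r Y (Im (z m)); lra.
have [s t u|x Ix hx|x Ix hx|L0 hL0] := @half_strip_limit I (Rmax Y (Im (z m))) B kap K0
    (integrand (turn_down m) phi) (kap_pos).
- move=> hs ht hu p; have [h1 h2] := hs p; have [h3 h4] := ht p.
  by split; [move=> /h1; lra | move=> /h4; lra].
- exact: hK0 (Yx x Ix hx).
- by apply: hB; apply: hY; have := Rmax_l Y (Im (z m)); lra.
(* The integrand with the turned cut is holomorphic on the whole half-strip, so one constant [L0]
   normalises [K] at [i oo] on both sides of the original cut. *)
pose K x := K0 x - L0.
have hK x : over_cut m x -> cder K x (integrand (turn_down m) phi x).
  by move=> Sx; exact: cder_sub_const (hK0 x Sx).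
have Klim e x : (0 < e)%R -> over_cut m x -> exists Y' : R, forall t, (Y' < t)%R -> (Cmod (K (Re x, t)) < e)%R.
  move=> e1 [_ Ix]; have [Y1 hY1] := @exp_decay kap (B / kap) e (kap_pos) e1.
  exists (Rmax (Rmax Y (Im (z m))) Y1) => t ht.
  have h1 := Rle_lt_trans _ _ _ (Rmax_l _ _) ht; have h2 := Rle_lt_trans _ _ _ (Rmax_r _ _) ht.
  exact: Rle_lt_trans (hL0 (Re x, t) Ix h1) (hY1 _ (Rlt_le _ _ h2)).
(* [H - a K] is constant on the vertical half-line above [x]. *)
have main a k M x : over_cut m x -> strip k (Re x) ->
    (forall t, (Im x <= t)%R -> branch_e up (Re x, t) = a * branch_e (turn_down m) (Re x, t)) ->
    tends_top H k M -> H x = a * K x + M.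
  move=> Sx sx he hM.
  suff h : Cmod (H x - a * K x - M) = 0%R.
    by move/Cmod_eq_0: h => h; rewrite -(Cplus_0_r (a * K x + M)) -h; ring.
  apply: Rle_antisym; last exact: Cmod_ge_0.
  apply: le_eps => e e1; rewrite Rplus_0_l.
  have e2 : (0 < e / 2)%R by lra.
  have N0 : (0 < 1 + Cmod a)%R by have := Cmod_ge_0 a; lra.
  have e3 : (0 < e / 2 / (1 + Cmod a))%R by exact: Rdiv_lt_0_compat.
  have [Y1 hY1] := hM _ e2; have [Y2 hY2] := Klim _ x e3 Sx.
  set t := (Rmax (Im x) (Rmax Y1 Y2 + 1))%R.
  have t1 : (Im x <= t)%R := Rmax_l _ _; have t2 : (Rmax Y1 Y2 + 1 <= t)%R := Rmax_r _ _.
  have m1 := Rmax_l Y1 Y2; have m2 := Rmax_r Y1 Y2.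
  have xe : x = (Re x, Im x) := surjective_pairing x.
  have -> : H x - a * K x - M = H (Re x, t) - a * K (Re x, t) - M.
    have := @rder_zero_const (fun u => H (Re x, u) - a * K (Re x, u)) (Im x) t _.
    rewrite -xe => -> // u; rewrite Rmin_left ?Rmax_right // => hu.
    have Gu : G (Re x, u) := @strip_dom k (Re x, u) sx.
    have := rder_add (rder_comp (hH _ Gu) (rder_vline (Re x) u))
      (rder_comp (cder_scal (- a) (hK (Re x, u) (over_cut_up Sx (proj1 hu)))) (rder_vline (Re x) u)).
    rewrite /integrand (he u (proj1 hu)).
    rewrite (_ : _ + _ = 0); last by ring.
    by apply: rder_ext => v; ring.
  have k1 := hY1 (Re x, t) sx (_ : (Y1 < t)%R).
  have {}k1 : (Cmod (H (Re x, t) - M) < e / 2)%R by apply: k1; lra.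
  have k2 := hY2 t (_ : (Y2 < t)%R).
  have {}k2 : (Cmod (K (Re x, t)) < e / 2 / (1 + Cmod a))%R by apply: k2; lra.
  rewrite (_ : _ - _ - M = (H (Re x, t) - M) - a * K (Re x, t)); last ring.
  apply: Rle_trans (Cmod_triangle_sub _ _) _; rewrite Cmod_mult.
  move/(Rlt_div_r _ _ _ N0): k2; have := Cmod_ge_0 (K (Re x, t)); lra.
exists K; split=> //; split=> x Sx hx.
  have -> : H x = 1 * K x + L; last by ring.
  apply: (main 1 m L x Sx (over_cut_left Sx hx)) => // t _.
  by rewrite (branch_e_left (m := m)) //; ring.
apply: (main (monodromy m) m.+1 L' x Sx (over_cut_right Sx hx)) => // t _.
exact: branch_e_right.
Qed.

Definition resolvent s (K : C -> C) (x : C) : C :=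
  - (Ci / eps) * (K x / branch_e s x).

Definition ode_rhs phi (x y : C) : C :=
  (Ci / eps) * ((lam + u0 x) * y - weight z phi x).

Lemma cder_resolvent s K phi x : branch_dom s x ->
  cder K x (integrand s phi x) ->
  cder (resolvent s K) x (ode_rhs phi x (resolvent s K x)).
Proof.
move=> Gx hK; have [_ [he _]] := hol_branch_e s.
have n0 := branch_e_neq0 (s := s) (x := x).
have en : RtoC eps <> 0 by apply: RtoC_neq0; lra.
have := cder_scal (- (Ci / eps)) (cder_mul hK (cder_inv (he x Gx) n0)).
set l := (X in cder _ x X); suff -> : l = ode_rhs phi x (resolvent s K x) by [].
rewrite /l /ode_rhs /resolvent /integrand; field; split=> //.
Qed.

Lemma ccont_resolvent s K x a : branch_dom s x -> ccont K x ->
  ccont (fun y => resolvent s (fun w => K w + a) y) x.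
Proof.
move=> Gx hK.
apply: ccont_mul; first exact: ccont_const.
apply: ccont_mul; first by apply: ccont_add => //; exact: ccont_const.
apply: (@ccont_comp (branch_e s) Cinv).
  exact: hol_ccont (hol_branch_e s) Gx.
by apply: ccont_inv; exact: branch_e_neq0.
Qed.

Lemma monodromy_neq0 m : monodromy m <> 0.
Proof. exact: Cexp_neq0. Qed.

Lemma over_cut_point m (d : R) : (0 < d)%R -> over_cut m (Re (z m), Im (z m) + d)%R.
Proof. by move=> d0; split=> [|p]; [rewrite /Im /=; lra | split; exact: zinc]. Qed.

Lemma jump_resolvent H m L L' K :
  (forall x, over_cut m x -> (Re x < Re (z m))%R -> H x = K x + L) ->
  (forall x, over_cut m x -> (Re (z m) < Re x)%R -> H x = monodromy m * K x + L') ->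
  (forall x, over_cut m x -> (Re x < Re (z m))%R ->
     resolvent up H x = resolvent (turn_down m) (fun w => K w + L) x) /\
  (forall x, over_cut m x -> (Re (z m) < Re x)%R ->
     resolvent up H x = resolvent (turn_down m) (fun w => K w + L' / monodromy m) x).
Proof.
move=> hl hr.
have n0 x := branch_e_neq0 (s := turn_down m) (x := x).
have m0 := @monodromy_neq0 m.
have en : RtoC eps <> 0 by apply: RtoC_neq0; lra.
split=> x Sx hx; rewrite /resolvent.
  by rewrite (hl x Sx hx) (branch_e_left hx).
rewrite (hr x Sx hx) (branch_e_right hx); have := n0 x => nx.
by field; split=> //; split.
Qed.

(** * Limits forced by an analytic extension *)

(** Induction over the cuts from left to right, using only the continuity of [Psi]. At a point of
    the cut from [z m], the expressions of [Psi] from the left and from the right have the same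
    value; as the left constant is [0], so is the right one. *)
Lemma extension_tends_top phi H Psi : is_primitive phi H ->
  (forall x, (0 <= Im x)%R -> ccont Psi x) ->
  (forall x, (0 <= Im x)%R -> G x -> Psi x = resolvent up H x) ->
  forall k, (k <= n.+1)%nat -> tends_top H k 0.
Proof.
move=> [hH h0] cPsi hPsi; elim=> [|k IH] kn //.
pose m : 'I_n.+1 := Ordinal kn.
have hm : tends_top H m 0 by apply: IH; exact: ltnW.
have [L' hL'] := tends_top_exists k.+1 hH.
suff L0 : L' = 0 by rewrite -L0.
have [K [hK [hl hr]]] := jump hH hm (hL' : tends_top H m.+1 L').
have [el er] := jump_resolvent hl hr.
pose x0 : C := (Re (z m), Im (z m) + 1)%R.
have Sx0 : over_cut m x0 := over_cut_point m Rlt_0_1.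
have Dx0 := over_cut_dom Sx0.
have x0i : (0 <= Im x0)%R by rewrite /x0 /=; have := zpos m; rewrite /Im; lra.
have cK := cder_ccont (hK _ Sx0).
have oS := @copen_over_cut m.
have e1 : Psi x0 = resolvent (turn_down m) (fun w => K w + 0) x0.
  apply: ccont_close; [exact: cPsi | exact: ccont_resolvent | move=> d d0].
  have [y [yd [Sy [yl yi]]]] := left_near oS Sx0 d0.
  have Gy : G y := strip_dom (over_cut_left Sy yl).
  have y0 : (0 <= Im y)%R by rewrite yi.
  by exists y; split=> //; rewrite (hPsi y y0 Gy); exact: el.
have e2 : Psi x0 = resolvent (turn_down m) (fun w => K w + L' / monodromy m) x0.
  apply: ccont_close; [exact: cPsi | exact: ccont_resolvent | move=> d d0].
  have [y [yd [Sy [yl yi]]]] := right_near oS Sx0 d0.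
  have Gy : G y := strip_dom (over_cut_right Sy yl).
  have y0 : (0 <= Im y)%R by rewrite yi.
  by exists y; split=> //; rewrite (hPsi y y0 Gy); exact: er.
have n0 := branch_e_neq0 (s := turn_down m) (x := x0).
have m0 := @monodromy_neq0 m.
have en : RtoC eps <> 0 by apply: RtoC_neq0; lra.
move: e2; rewrite e1 /resolvent; set e := branch_e _ _ in n0 *.
set w := monodromy _ in m0 *; move=> e2.
have -> : L' = Ci * eps * e * w * (- (Ci / eps) * ((K x0 + L' / w) / e) - - (Ci / eps) * ((K x0 + 0) / e)).
  transitivity (- (Ci * Ci) * L'); first by rewrite Ci2; ring.
  by field; split=> //; split.
by rewrite -e2; ring.
Qed.

(** Up to a constant factor [H] is [Psi] times the exponential; near [z m] the former is bounded and
    the latter is of order [|x - z m| ^ b] with [b > 0]. *)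
Lemma extension_tends_pole phi H Psi m : is_primitive phi H ->
  (forall x, (0 <= Im x)%R -> ccont Psi x) ->
  (forall x, (0 <= Im x)%R -> G x -> Psi x = resolvent up H x) ->
  (0 < pole_exponent m)%R -> tends_pole H m 0.
Proof.
move=> [hH h0] cPsi hPsi b0 e e1.
have zi : (0 <= Im (z m))%R by apply: Rlt_le.
have [d1 [d10 hd1]] := ccont_bounded (cPsi _ zi); set N := (1 + _)%R in hd1.
have N0 : (0 < N)%R by rewrite /N; have := Cmod_ge_0 (Psi (z m)); lra.
have [d [M [d0 [dm [_ [M0 hM]]]]]] := branch_e_near up m.
have [Y hY] := @exp_decay _ (eps * N * M) e b0 e1.
exists (Rmin (Rmin d1 d) (exp (- Y))); split.
  by repeat apply: Rmin_pos => //; exact: exp_pos.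
move=> x Gx hx; have h12 := Rlt_minl hx.
have h3 := Rlt_minr hx.
have h1 := Rlt_minl h12; have h2 := Rlt_minr h12.
have x0 : (0 < Cmod (x - z m))%R by apply/Cmod_gt_0; have [] := branch_dom1_neq (Gx m).
have xi : (0 <= Im x)%R.
  have := im_le_Cmod (x - z m); rewrite Im_sub; have := Rle_abs (- (Im x - Im (z m))).
  by rewrite Rabs_Ropp; lra.
have n0 := branch_e_neq0 (s := up) (x := x).
have en : RtoC eps <> 0 by apply: RtoC_neq0; lra.
have -> : H x - 0 = Ci * eps * (Psi x * branch_e up x).
  rewrite (hPsi x xi Gx) /resolvent; transitivity (- (Ci * Ci) * H x); first by rewrite Ci2; ring.
  by field; split.
rewrite !Cmod_mult Cmod_Ci Cmod_R Rabs_pos_eq; last lra.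
have [k1 _] := hM x (conj x0 h2); have k2 := hd1 x h1.
have := ln_increasing _ _ x0 h3; rewrite ln_exp => h4.
have hYx := hY (- ln (Cmod (x - z m)))%R (_ : (Y <= _)%R).
have {}hYx : (eps * N * M * exp (pole_exponent m * ln (Cmod (x - z m))) < e)%R.
  by rewrite -[(pole_exponent _ * _)%R]Rmult_opp_opp; apply: hYx; lra.
rewrite /pole_exponent in hYx; set E := exp _ in k1 hYx.
apply: Rle_lt_trans hYx; rewrite Rmult_1_l (_ : eps * N * M * E = eps * (N * (M * E)))%R; last ring.
apply: Rmult_le_compat_l; first lra.
apply: Rmult_le_compat; try exact: Cmod_ge_0; first lra.
exact: k1.
Qed.

(** * Limits forced by the linear equations *)

Lemma monodromy_negative_integer m : strictly_negative_integer (Ci * c m / eps) ->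
  monodromy m = 1.
Proof.
move=> [k hk].
have -> : monodromy m = Cexp (- (2 * PI)%R * Ci * (Ci * c m / eps)).
  by rewrite /monodromy; congr Cexp; rewrite /Cdiv; ring.
rewrite hk.
have -> : - (2 * PI)%R * Ci * - RtoC (INR k.+1) = (0, (0 + 2 * INR k.+1 * PI))%R.
  by apply: C_ext; rewrite /Re /Im /=; ring.
set t := (0 + _)%R.
have ct : cos t = 1%R by rewrite /t cos_period cos_0.
have st : sin t = 0%R by rewrite /t sin_period sin_0.
rewrite /Cexp -[Re (0%R, t)]/0%R -[Im (0%R, t)]/t exp_0 ct st.
by apply: C_ext; rewrite /Re /Im /=; ring.
Qed.

(** The modulus of [q] gives [Re (c m) = 0]. Then [cos (2 * PI * b) = 1] forces [sin (PI * b) = 0],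
    so [b] is an integer, positive by hypothesis. *)
Lemma monodromy_1 m : monodromy m = 1 -> (0 < pole_exponent m)%R ->
  strictly_negative_integer (Ci * c m / eps).
Proof.
move=> h b0; set b := pole_exponent m in b0.
have en : RtoC eps <> 0 by apply: RtoC_neq0; lra.
have pi0 := PI_RGT_0.
have he : - Ci * (c m * ((2 * PI)%R * Ci)) / eps = (2 * PI * (Re (c m) / eps), 2 * PI * b)%R.
  transitivity (- (Ci * Ci) * (2 * PI)%R * (c m / eps)); first by rewrite /Cdiv; ring.
  rewrite Ci2; have -> : c m / eps = (Re (c m) / eps, b)%R.
    rewrite /Cdiv -RtoC_inv; last lra.
    by apply: C_ext; rewrite /b /pole_exponent /Re /Im /=; rewrite /Rdiv; ring.
  by apply: C_ext; rewrite /Re /Im /=; ring.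
have hre : Re (c m) = 0%R.
  have := f_equal Cmod h; rewrite /monodromy Cmod_Cexp Cmod_1 he /Re /= -exp_0 => /exp_inv e.
  have : (2 * PI * ((c m).1 / eps) / (2 * PI) * eps = 0)%R by rewrite e; field; lra.
  by move=> <-; field; lra.
have hcos : cos (2 * PI * b) = 1%R.
  have := f_equal Re h; rewrite /monodromy he /Cexp /Re /=.
  have -> : (c m).1 = 0%R := hre.
  by rewrite (_ : 2 * PI * (0 / eps) = 0)%R; [rewrite exp_0; lra | field; lra].
have hsin : sin (PI * b) = 0%R.
  move: hcos; rewrite (_ : 2 * PI * b = 2 * (PI * b))%R; last ring.
  rewrite cos_2a_sin => hs; have h2 : (sin (PI * b) * sin (PI * b) = 0)%R by lra.
  by case: (Rmult_integral _ _ h2).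
have [k hk] := sin_eq_0_0 _ hsin.
have hbk : b = IZR k by apply: (Rmult_eq_reg_l PI); lra.
have k0 : (0 < k)%Z by apply: lt_IZR; rewrite -hbk.
have [j hj] : exists j : nat, IZR k = INR j.+1.
  have [[|j] hj] := IZN k (Z.lt_le_incl _ _ k0); first by rewrite hj in k0.
  by exists j; rewrite hj -INR_IZR_INZ.
exists j; rewrite -hj -hbk.
transitivity (Ci * (c m / eps)); first by rewrite /Cdiv; ring.
rewrite /Cdiv -RtoC_inv; last lra.
by apply: C_ext; rewrite /b /pole_exponent /Re /Im /=; have := hre; rewrite /Re => ->; rewrite /Rdiv; ring.
Qed.

(** [u] is the value of [K] at a point of the cut close to [z m]. Approached from the two sides, [H]
    tends there to [u + L] and to [q * u + L'], and both limits inherit the closeness of [H] to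
    [M]. *)
Lemma jump_near_pole phi H (m : 'I_n.+1) L L' M K (e : R) :
  (forall x, over_cut m x -> cder K x (integrand (turn_down m) phi x)) ->
  (forall x, over_cut m x -> (Re x < Re (z m))%R -> H x = K x + L) ->
  (forall x, over_cut m x -> (Re (z m) < Re x)%R -> H x = monodromy m * K x + L') ->
  tends_pole H m M -> (0 < e)%R -> exists u : C,
    (Cmod (u + L - M) <= e)%R /\ (Cmod (monodromy m * u + L' - M) <= e)%R.
Proof.
move=> hK hl hr hM e0; have [d [d0 hd]] := hM e e0.
have d2 : (0 < d / 2)%R by lra.
set x0 : C := (Re (z m), Im (z m) + d / 2)%R.
have Sx0 : over_cut m x0 := over_cut_point m d2.
have oS := @copen_over_cut m.
have cK := cder_ccont (hK _ Sx0).
have near y : (Cmod (y - x0) < d / 2)%R -> (Cmod (y - z m) < d)%R.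
  move=> hy; rewrite (_ : y - z m = (y - x0) + (x0 - z m)); last ring.
  apply: Rle_lt_trans (Cmod_triangle _ _) _.
  have -> : x0 - z m = RtoC (d / 2) * Ci by apply: C_ext; rewrite /x0 /Re /Im /=; ring.
  by rewrite Cmod_mult Cmod_Ci Cmod_R Rabs_pos_eq; lra.
exists (K x0); split.
  apply: (@ccont_le (fun y => K y + L - M)) => [|r r0].
    by apply: ccont_add; [apply: ccont_add => //; exact: ccont_const | exact: ccont_const].
  have [y [yd [Sy [yl _]]]] := left_near oS Sx0 (Rmin_pos _ _ r0 d2).
  exists y; split; first exact: Rlt_minl yd.
  rewrite -(hl y Sy yl); apply/Rlt_le/hd; first exact: strip_dom (over_cut_left Sy yl).
  by apply: near; exact: Rlt_minr yd.
apply: (@ccont_le (fun y => monodromy m * K y + L' - M)) => [|r r0].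
  apply: ccont_add; last exact: ccont_const.
  by apply: ccont_add; [apply: ccont_mul => //; exact: ccont_const | exact: ccont_const].
have [y [yd [Sy [yl _]]]] := right_near oS Sx0 (Rmin_pos _ _ r0 d2).
exists y; split; first exact: Rlt_minl yd.
rewrite -(hr y Sy yl); apply/Rlt_le/hd; first exact: strip_dom (over_cut_right Sy yl).
by apply: near; exact: Rlt_minr yd.
Qed.

(** At an exceptional pole the equation speaks of [z m] and not of [i oo], but there [q = 1]: by
    [jump_near_pole] with [L = M = 0], both [u] and [u + L'] are arbitrarily small, so [L' = 0]. *)
Lemma tends_end_tends_top phi H : is_primitive phi H ->
  (forall m, tends_end H m 0) -> forall k, (k <= n.+1)%nat -> tends_top H k 0.
Proof.
move=> [hH h0] hend; elim=> [|k IH] kn //.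
pose m : 'I_n.+1 := Ordinal kn; have [h1 h2] := hend m.
case: (boolp.pselect (strictly_negative_integer (Ci * c m / eps))) => hc; last exact: (h1 hc).
have hm : tends_top H m 0 by apply: IH; exact: ltnW.
have [L' hL'] := tends_top_exists k.+1 hH.
suff L0 : L' = 0 by rewrite -L0.
have [K [hK [hl hr]]] := jump hH hm (hL' : tends_top H m.+1 L').
apply: (@Cmod_small_eq0 _ 2) => [|e e0]; first lra.
have [u []] := jump_near_pole hK hl hr (h2 hc) e0.
rewrite (monodromy_negative_integer hc) => k1 k2.
have -> : L' = (1 * u + L' - 0) - (u + 0 - 0) by ring.
by apply: Rle_trans (Cmod_triangle_sub _ _) _; lra.
Qed.

(** At an exceptional pole this is the equation itself. Otherwise [q <> 1] by [monodromy_1]; the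
    constants on both sides are [0], so [u] and [q * u] approach the same limit [L] and
    [(q - 1) * L = 0]. *)
Lemma tends_end_tends_pole phi H m : is_primitive phi H ->
  (forall m, tends_end H m 0) -> (0 < pole_exponent m)%R -> tends_pole H m 0.
Proof.
move=> hp hend b0; have [hH h0] := hp.
case: (boolp.pselect (strictly_negative_integer (Ci * c m / eps))) => hc.
  by have [_] := hend m; exact.
have htop := tends_end_tends_top hp hend.
have [L [B [d [d0 [B0 hL]]]]] := primitive_pole_pos hH b0.
have hpole := primitive_pole_lim b0 d0 B0 hL.
suff L0 : L = 0 by rewrite -L0.
have hm : tends_top H m 0 by apply: htop; exact: ltnW.
have [K [hK [hl hr]]] := jump hH hm (htop m.+1 (ltn_ord m)).
set w := monodromy m in hr.
have w1 : w - 1 <> 0.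
  by apply: sub_neq0 => h; apply: hc; apply: monodromy_1 => //; exact: zpos.
have wn : (0 < 1 + Cmod w)%R by have := Cmod_ge_0 w; lra.
suff h : (w - 1) * L = 0.
  by rewrite -[L]Cmult_1_l -(Cinv_l _ w1) -Cmult_assoc h; ring.
apply: (@Cmod_small_eq0 _ (1 + Cmod w)) => // e e0.
have [u [k1 k2]] := jump_near_pole hK hl hr hpole e0.
have -> : (w - 1) * L = (w * u + 0 - L) - w * (u + 0 - L) by ring.
apply: Rle_trans (Cmod_triangle_sub _ _) _; rewrite Cmod_mult.
have := Rmult_le_compat_l _ _ _ (Cmod_ge_0 w) k1; rewrite -/w in k2; lra.
Qed.

Lemma branch_dom_dense x d : (0 < d)%R -> exists y, (Cmod (y - x) < d)%R /\ G y /\ Im y = Im x /\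
  forall p, Re y <> Re (z p).
Proof.
move=> d0.
have [|p|r [r0 hr]] := @finite_pos_min _ (fun p r => forall t : R, (0 < t)%R -> (t < r)%R -> (Re x + t <> Re (z p))%R).
- by move=> p r r' h1 h2 _ t t0 tr; apply: h1; lra.
- case: (Rtotal_order (Re x) (Re (z p))) => h.
    by exists (Re (z p) - Re x)%R; split; [lra | move=> t t0 tr; lra].
  by exists 1%R; split; [lra | move=> t t0 tr; lra].
have m0 := Rmin_pos _ _ d0 r0; have m1 := Rmin_l d r; have m2 := Rmin_r d r.
have hne p : Re (shift x (Rmin d r / 2)) <> Re (z p) by apply: (hr p); lra.
exists (shift x (Rmin d r / 2)); split.
  by apply: shift_near; rewrite Rabs_pos_eq; lra.
by split; [exact: off_cuts_dom | ].
Qed.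

(** [primitive_pole_pos] provides the rate with some limit [L]; comparing it with the known limit
    [0] at points of [G] near [z m] identifies [L]. *)
Lemma primitive_pole_vanish phi H m : is_primitive phi H ->
  (forall m, tends_end H m 0) -> (0 < pole_exponent m)%R ->
  exists (B d : R), (0 < d)%R /\ (0 <= B)%R /\ forall x, G x -> (0 < Cmod (x - z m) < d)%R ->
    (Cmod (H x) <= B * exp (pole_exponent m * ln (Cmod (x - z m))))%R.
Proof.
move=> hp hend b0; have [hH h0] := hp.
have [L [B [d [d0 [B0 hL]]]]] := primitive_pole_pos hH b0.
have h1 := primitive_pole_lim b0 d0 B0 hL.
have h2 := tends_end_tends_pole hp hend b0.
suff L0 : L = 0.
  exists B, d; split=> //; split=> // x Gx hx.
  by have := hL x Gx hx; rewrite L0 (_ : H x - 0 = H x); last ring.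
apply: (@Cmod_small_eq0 _ 2) => [|e e0]; first lra.
have [d1 [d10 hd1]] := h1 e e0; have [d2 [d20 hd2]] := h2 e e0.
have [y [hy [Gy _]]] := branch_dom_dense (z m) (Rmin_pos _ _ d10 d20).
have k1 := hd1 y Gy (Rlt_minl hy).
have k2 := hd2 y Gy (Rlt_minr hy).
have -> : L = (H y - 0) - (H y - L) by ring.
by apply: Rle_trans (Cmod_triangle_sub _ _) _; lra.
Qed.

(** With [r = |x - z m|], the primitive is [O(r ^ (b - 1 / 2))] for either sign of [b], since
    [r ^ b <= r ^ (b - 1 / 2)] when [r <= 1]. The inverse of the exponential is [O(r ^ (- b))], and
    the factor [x - z m] leaves half a power. *)
Lemma resolvent_pole_small phi H m : is_primitive phi H ->
  (forall m, tends_end H m 0) ->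
  exists (B d : R), (0 < d)%R /\ forall x, G x -> (0 < Cmod (x - z m) < d)%R ->
    (Cmod ((x - z m) * resolvent up H x) <= B * exp (/ 2 * ln (Cmod (x - z m))))%R.
Proof.
move=> hp hend; have [hH h0] := hp.
have [d [M [d0 [_ [_ [M0 hM]]]]]] := branch_e_near up m.
set b := pole_exponent m.
have [B [d' [d0' [B0 hB]]]] : exists (B d : R), (0 < d)%R /\ (0 <= B)%R /\ forall x, G x ->
    (0 < Cmod (x - z m) < d)%R -> (Cmod (H x) <= B * exp ((b - / 2) * ln (Cmod (x - z m))))%R.
  case: (Rle_lt_dec b 0) => hb; first exact: primitive_pole_nonpos hH hb.
  have [B [d' [d0' [B0 hB]]]] := primitive_pole_vanish hp hend hb.
  exists B, (Rmin d' 1); split; first by apply: Rmin_pos => //; lra.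
  split=> // x Gx [x0 xd].
  apply: Rle_trans (hB x Gx (conj x0 (Rlt_minl xd))) _.
  apply: Rmult_le_compat_l => //; apply: exp_le_compat.
  by have := ln_increasing _ _ x0 (Rlt_minr xd); rewrite ln_1 -/b; lra.
exists (/ eps * (B * M))%R, (Rmin d d'); split; first exact: Rmin_pos.
move=> x Gx [x0 xd].
have h1 := hB x Gx (conj x0 (Rlt_minr xd)).
have [_ h2] := hM x (conj x0 (Rlt_minl xd)).
have ie := Rinv_0_lt_compat _ eps0.
rewrite /resolvent !Cmod_mult Cmod_opp Cmod_div; last by apply: RtoC_neq0; lra.
rewrite Cmod_Ci Cmod_R Rabs_pos_eq; last lra.
set r := Cmod (x - z m) in x0 h1 h2 *.
have hr : r = exp (ln r) by rewrite exp_ln.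
have E1 := exp_pos ((b - / 2) * ln r); have E2 := exp_pos (- (b * ln r)).
have h3 : (Cmod (H x) * Cmod (/ branch_e up x) <=
   B * exp ((b - / 2) * ln r) * (M * exp (- (b * ln r))))%R.
  by apply: Rmult_le_compat => //; exact: Cmod_ge_0.
have h4 : (r * (1 / eps * (B * exp ((b - / 2) * ln r) * (M * exp (- (b * ln r))))) =
   / eps * (B * M) * exp (/ 2 * ln r))%R.
  transitivity (/ eps * (B * M) * (exp (ln r) * exp ((b - / 2) * ln r) * exp (- (b * ln r))))%R.
    by rewrite -hr; field; lra.
  by rewrite -!exp_plus; congr (_ * exp _)%R; field.
rewrite -h4; apply: Rmult_le_compat_l; first lra.
by apply: Rmult_le_compat_l => //; rewrite /Rdiv; lra.
Qed.

(** * Construction of the extension *)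

(** The domain of the extension: only the cuts in the lower half-plane are removed, so it contains
    the upward cuts and the poles [z p]. *)
Definition below_free (x : C) : Prop := forall p, ~ down_cut (Cconj (z p)) x.

Lemma copen_below_free : copen below_free.
Proof. by apply: copen_forall => p; exact: copen_down_cut. Qed.

Lemma upper_below_free x : (0 <= Im x)%R -> below_free x.
Proof.
move=> hx p [_]; rewrite (_ : Im (Cconj (z p)) = - Im (z p))%R //; have := zpos p; lra.
Qed.

Lemma branch_dom_below_free s x : branch_dom s x -> below_free x.
Proof. by move=> h p; have [] := h p. Qed.

Lemma local_extension phi H x : is_primitive phi H ->
  (forall k, (k <= n.+1)%nat -> tends_top H k 0) -> below_free x -> off_poles z x ->
  exists (P : C -> C) (d : R), (0 < d)%R /\ forall y, (Cmod (y - x) < d)%R ->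
    cder P y (ode_rhs phi y (P y)) /\
    (G y -> P y = resolvent up H y).
Proof.
move=> [hH h0] htop Ux ox.
case: (boolp.pselect (G x)) => Gx.
  have [d [d0 hd]] := copen_branch_dom Gx.
  exists (resolvent up H), d; split=> // y /hd Gy; split=> //.
  by apply: cder_resolvent => //; exact: hH.
have [m hm] : exists m, up_cut (z m) x.
  apply: boolp.contrapT => hn; apply: Gx => p; split; last exact: Ux.
  by move=> hp; apply: hn; exists p.
have Sx : over_cut m x.
  have [e hi] := hm; split.
    case: (Rtotal_order (Im (z m)) (Im x)) => [//|[e'|]]; last lra.
    by case: (ox m); apply: C_ext.
  by move=> p; rewrite e; split; exact: zinc.
have hm0 : tends_top H m 0 by apply: htop; exact: ltnW.
have [K [hK [hl hr]]] := jump hH hm0 (htop m.+1 (ltn_ord m)).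
have [el er] := jump_resolvent hl hr.
have [d [d0 hd]] := copen_over_cut Sx.
exists (resolvent (turn_down m) K), d; split=> // y /hd Sy; split.
  by apply: cder_resolvent => //; [exact: over_cut_dom | exact: hK].
move=> Gy; have e0 : forall a : C, a = 0 -> resolvent (turn_down m) (fun w => K w + a) y =
    resolvent (turn_down m) K y.
  by move=> a ->; rewrite /resolvent Cplus_0_r.
case: (Rtotal_order (Re y) (Re (z m))) => [hy|[hy|hy]].
- by rewrite el // e0.
- by have [h _] := Gy m; case: h; split=> //; case: Sy; lra.
- by rewrite er // e0 // /Cdiv Cmult_0_l.
Qed.

(** Provides the continuous derivative required by [hol]: off the poles, the derivative of the
    extension is read off from the differential equation. *)
Lemma ode_rhs_ccont phi P x : below_free x -> off_poles z x -> ccont P x ->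
  ccont (fun y => ode_rhs phi y (P y)) x.
Proof.
move=> Ux ox cP.
have cw : ccont (weight z phi) x.
  by have [dw hw] := hol_weight z phi; exact: hol_ccont hw ox.
have oD := copen_and copen_below_free (@copen_off_poles n z).
have cu : ccont (u0) x.
  have h p : exists dq, hol (fun x => below_free x /\ off_poles z x)
      (fun x => c p / (x - z p) + Cconj (c p) / (x - Cconj (z p))) dq.
    have [d1 h1] := hol_rational (c p) oD (fun x (Dx : below_free x /\ off_poles z x) => sub_neq0 (proj2 Dx p)).
    have [d2 h2] := hol_rational (Cconj (c p)) oD (fun x (Dx : below_free x /\ off_poles z x) =>
      sub_neq0 (not_down_cut_neq (proj1 Dx p))).
    by eexists; exact: hol_add h1 h2.
  have [du hdu] := boolp.choice h.
  have hs := hol_sum (index_enum 'I_n.+1) oD hdu.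
  exact: (hol_ccont hs (conj Ux ox)).
apply: ccont_mul; first exact: ccont_const.
apply: ccont_add.
  by apply: ccont_mul => //; apply: ccont_add => //; exact: ccont_const.
apply: (@ccont_ext_loc (fun y => - (1) * weight z phi y)).
  by exists 1%R; split=> [|y _]; [lra | ring].
by apply: ccont_mul => //; exact: ccont_const.
Qed.

(** The value at [x] is taken from the local extension centred at [x]. Two local extensions agree
    where both live, being continuous and equal on the dense set [G]. *)
Lemma extension_off_poles phi H : is_primitive phi H ->
  (forall k, (k <= n.+1)%nat -> tends_top H k 0) ->
  exists P : C -> C, forall x, below_free x -> off_poles z x ->
    cder P x (ode_rhs phi x (P x)) /\
    (G x -> P x = resolvent up H x).
Proof.
move=> hp htop.
have loc x : exists Pd : (C -> C) * R, below_free x -> off_poles z x ->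
    (0 < Pd.2)%R /\ forall y, (Cmod (y - x) < Pd.2)%R ->
    cder Pd.1 y (ode_rhs phi y (Pd.1 y)) /\
    (G y -> Pd.1 y = resolvent up H y).
  case: (boolp.pselect (below_free x /\ off_poles z x)) => [[Ux ox]|hn].
    by have [P [d hd]] := local_extension hp htop Ux ox; exists (P, d).
  by exists ((fun y => y), 0%R) => Ux ox; case: hn.
have [f hf] := boolp.choice loc.
exists (fun x => (f x).1 x) => x Ux ox.
have [d0 hd] := hf x Ux ox.
have agree y : (Cmod (y - x) < (f x).2)%R -> below_free y -> off_poles z y ->
    (f x).1 y = (f y).1 y.
  move=> hy Uy oy; have [d0' hd'] := hf y Uy oy.
  have [h1 _] := hd y hy; have h2 : cder (f y).1 y (ode_rhs phi y ((f y).1 y)).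
    by apply: (hd' y _).1; rewrite Cmod_xx.
  apply: ccont_close (cder_ccont h1) (cder_ccont h2) _ => r r0.
  have ry : (0 < (f x).2 - Cmod (y - x))%R by lra.
  have [w [hw [Gw _]]] := branch_dom_dense y (Rmin_pos _ _ r0 (Rmin_pos _ _ d0' ry)).
  have w1 := Rlt_minl hw; have w' := Rlt_minr hw.
  have w2 := Rlt_le_trans _ _ _ w' (Rmin_l _ _); have w3 := Rlt_le_trans _ _ _ w' (Rmin_r _ _).
  exists w; split=> //.
  have -> : (f x).1 w = resolvent up H w.
    apply: (hd w _).2 => //; rewrite (_ : w - x = (w - y) + (y - x)); last ring.
    by apply: Rle_lt_trans (Cmod_triangle _ _) _; lra.
  by symmetry; apply: (hd' w w2).2.
have xx : (Cmod (x - x) < (f x).2)%R by rewrite Cmod_xx.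
have [hx hx'] := hd x xx; split=> //.
have [d1 [d10 hd1]] := copen_and copen_below_free (@copen_off_poles n z) (conj Ux ox).
apply: cder_ext_loc hx; exists (Rmin (f x).2 d1); split; first exact: Rmin_pos.
move=> y hy; have [Uy oy] := hd1 y (Rlt_minr hy).
by apply: agree => //; exact: Rlt_minl hy.
Qed.

(** Off the poles this is the glued extension; at each [z m] the singularity is now isolated and of
    a single-valued function, and Riemann's theorem fills it in. *)
Theorem resolvent_extension phi H : is_primitive phi H ->
  (forall m, tends_end H m 0) ->
  exists (Psi dPsi : C -> C), hol below_free Psi dPsi /\
    forall x, G x -> Psi x = resolvent up H x.
Proof.
move=> hp hend; have htop := tends_end_tends_top hp hend.
have [P hP] := extension_off_poles hp htop.
have loc m : exists Qdr : (C -> C) * (C -> C) * R, (0 < Qdr.2)%R /\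
    hol (fun x => (Cmod (x - z m) < Qdr.2)%R) Qdr.1.1 Qdr.1.2 /\
    (forall x, (0 < Cmod (x - z m) < Qdr.2)%R -> Qdr.1.1 x = P x) /\
    (forall q, (Cmod (z q - z m) < Qdr.2)%R -> q = m) /\
    (forall x, (Cmod (x - z m) < Qdr.2)%R -> below_free x).
  have [d [d0 [dm hd]]] := z_separated m.
  have inU x : (0 < Cmod (x - z m) < d)%R -> below_free x /\ off_poles z x.
    move=> [x0 xd]; split.
      apply: upper_below_free; have := im_le_Cmod (x - z m); rewrite Im_sub.
      by have := Rle_abs (- (Im x - Im (z m))); rewrite Rabs_Ropp; lra.
    move=> p e; case: (eqVneq p m) => [pm|/hd hpm].
      by rewrite e pm Cmod_xx in x0; lra.
    by rewrite e in xd; have := re_le_Cmod (z p - z m); rewrite Re_sub; lra.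
  have oB : copen (fun x => (0 < Cmod (x - z m) < d)%R).
    have o := copen_and (@copen_neq (z m)) (@copen_ball (z m) d).
    move=> x [x0 xd]; have xz : x <> z m by move=> e; rewrite e Cmod_xx in x0; lra.
    have [r [r0 hr]] := o x (conj xz xd); exists r; split=> // y /hr [yz yd].
    by split=> //; apply/Cmod_gt_0; exact: sub_neq0.
  have hPb : hol (fun x => (0 < Cmod (x - z m) < d)%R) P (fun x => ode_rhs phi x (P x)).
    split=> //; split=> x /inU [Ux ox]; have [h1 _] := hP x Ux ox => //.
    by apply: ode_rhs_ccont => //; exact: cder_ccont h1.
  have [B [r [r0 hB]]] := resolvent_pole_small m hp hend.
  have sep q : (Cmod (z q - z m) < d)%R -> q = m.
    move=> hq; case: (eqVneq q m) => // /hd; have := re_le_Cmod (z q - z m); rewrite Re_sub; lra.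
  have [|Q [dQ [r' [r0' [hQ eQ]]]]] := removable_singularity d0 hPb; last first.
    exists (Q, dQ, Rmin r' d); split; first exact: Rmin_pos.
    split; last split; last split=> [q hq|x hx].
    - apply: hol_sub hQ; first exact: copen_ball.
      by move=> x hx; exact: Rlt_minl hx.
    - by move=> x [x0 xr]; apply: eQ; split=> //; exact: Rlt_minl xr.
    - by apply: sep; exact: Rlt_minr hq.
    - apply: upper_below_free; have := Rlt_minr hx.
      have := im_le_Cmod (x - z m); rewrite Im_sub.
      by have := Rle_abs (- (Im x - Im (z m))); rewrite Rabs_Ropp; lra.
  move=> e e0.
  have half : (0 < / 2)%R by lra.
  have e2 : (0 < e / 2)%R by lra.
  have [Y hY] := @exp_decay (/ 2) B (e / 2) half e2.
  exists (Rmin (Rmin r d) (exp (- Y))); split.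
    by repeat apply: Rmin_pos => //; exact: exp_pos.
  move=> x [x0 xd]; have h12 := Rlt_minl xd.
  have x3 := Rlt_minr xd.
  have x1 := Rlt_minl h12; have x2 := Rlt_minr h12.
  have [Ux ox] := inU x (conj x0 x2); have [hx _] := hP x Ux ox.
  apply: Rle_lt_trans (_ : e / 2 < e)%R; last lra.
  (* The estimate of [resolvent_pole_small] is known on [G] only; it passes to points of the cuts by
     continuity and density, with [g] keeping the approximating point inside the punctured disc. *)
  apply: (@ccont_le (fun y => (y - z m) * P y)).
    apply: ccont_mul; last exact: cder_ccont hx.
    by apply: ccont_add; [exact: ccont_id | exact: ccont_const].
  move=> t t0; set g := Rmin (Cmod (x - z m)) (Rmin (r - Cmod (x - z m)) (exp (- Y) - Cmod (x - z m))).
  have g0 : (0 < g)%R by repeat apply: Rmin_pos; lra.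
  have [y [hy [Gy _]]] := branch_dom_dense x (Rmin_pos _ _ t0 g0).
  exists y; split; first exact: Rlt_minl hy.
  have hyg := Rlt_minr hy.
  have g1 := Rmin_l (Cmod (x - z m)) (Rmin (r - Cmod (x - z m)) (exp (- Y) - Cmod (x - z m))).
  have g2 := Rmin_r (Cmod (x - z m)) (Rmin (r - Cmod (x - z m)) (exp (- Y) - Cmod (x - z m))).
  have g3 := Rmin_l (r - Cmod (x - z m)) (exp (- Y) - Cmod (x - z m)).
  have g4 := Rmin_r (r - Cmod (x - z m)) (exp (- Y) - Cmod (x - z m)).
  have y0 : (0 < Cmod (y - z m))%R.
    have := Cmod_ge_sub (x - z m) (x - y); rewrite (Cmod_sub_sym x y).
    by rewrite (_ : x - z m - (x - y) = y - z m); [rewrite -/g in g1; lra | ring].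
  have yr : (Cmod (y - z m) < Rmin r (exp (- Y)))%R.
    rewrite (_ : y - z m = (y - x) + (x - z m)); last ring.
    apply: Rle_lt_trans (Cmod_triangle _ _) _; rewrite -/g in g2.
    by apply: Rmin_glb_lt; lra.
  have [_ hPy] := hP y (branch_dom_below_free Gy) (branch_dom_off_poles Gy).
  rewrite (hPy Gy).
  apply: Rle_trans (hB y Gy (conj y0 (Rlt_minl yr))) _.
  have := ln_increasing _ _ y0 (Rlt_minr yr); rewrite ln_exp => hl.
  have := hY (- ln (Cmod (y - z m)))%R (_ : (Y <= _)%R).
  by rewrite Rmult_opp_opp => h; apply/Rlt_le/h; lra.
have [f hf] := boolp.choice loc.
(* The filled-in functions are used at the poles themselves only; [nearQ] shows that they agree with
   [Psi] on a whole disc. *)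
pose Psi x := if [pick m | x == z m] is Some m then (f m).1.1 x else P x.
pose dPsi x := if [pick m | x == z m] is Some m then (f m).1.2 x else ode_rhs phi x (P x).
have nopick x (T : Type) (g : 'I_n.+1 -> T) u : off_poles z x ->
    (if [pick m | x == z m] is Some m then g m else u) = u.
  by move=> ox; case: pickP => [m /eqP /ox|].
have nearPsi x : off_poles z x -> exists d : R, (0 < d)%R /\ forall y, (Cmod (y - x) < d)%R ->
    P y = Psi y /\ ode_rhs phi y (P y) = dPsi y.
  move=> /(@copen_off_poles n z) [d [d0 hd]]; exists d; split=> // y /hd oy.
  by rewrite /Psi /dPsi !nopick.
have nearQ m y : (Cmod (y - z m) < (f m).2)%R -> (f m).1.1 y = Psi y.
  have [_ [_ [hQ [sep _]]]] := hf m; move=> hy; rewrite /Psi.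
  case: pickP => [q /eqP yq|no]; first by rewrite yq in hy; rewrite (sep q hy).
  apply: hQ; split=> //; apply/Cmod_gt_0; apply: sub_neq0 => e.
  by have := no m; rewrite e eqxx.
have nearDQ m y : (Cmod (y - z m) < (f m).2)%R -> (f m).1.2 y = dPsi y.
  have [_ [[oQ [dQ _]] [hQ [sep inU]]]] := hf m; move=> hy; rewrite /dPsi.
  case: pickP => [q /eqP yq|no]; first by rewrite yq in hy; rewrite (sep q hy).
  have oy : off_poles z y by move=> q e; have := no q; rewrite e eqxx.
  have [hy1 _] := hP y (inU y hy) oy.
  (* Off the pole, the derivative of the filled-in function and the right-hand side of the equation
     differentiate the same function, so [dPsi] is continuous at the pole as well. *)
  apply: (cder_unique (dQ y hy)).
  have [d [d0 hd]] := copen_and oQ (@copen_off_poles n z) (conj hy oy).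
  apply: cder_ext_loc hy1; exists d; split=> // w /hd [w1 w2]; symmetry; apply: hQ.
  by split=> //; apply/Cmod_gt_0; apply: sub_neq0; exact: w2.
exists Psi, dPsi; split; last first.
  move=> x Gx; have ox := branch_dom_off_poles Gx.
  have [_ hx] := hP x (branch_dom_below_free Gx) ox.
  by rewrite /Psi nopick //; exact: hx.
split; first exact: copen_below_free.
split=> x Ux; (case: (boolp.pselect (off_poles z x)) => [ox|nox]; last first).
- have [m xm] : exists m, x = z m.
    by apply: boolp.contrapT => hn; apply: nox => p e; apply: hn; exists p.
  have [r0 [[oQ [dQ cQ]] _]] := hf m; rewrite xm.
  have zz : (Cmod (z m - z m) < (f m).2)%R by rewrite Cmod_xx.
  rewrite -(nearDQ m _ zz); apply: cder_ext_loc (dQ _ zz).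
  by exists (f m).2; split=> // y; exact: nearQ.
- have [hx _] := hP x Ux ox; have [d [d0 hd]] := nearPsi x ox.
  have xx : (Cmod (x - x) < d)%R by rewrite Cmod_xx.
  have [_ <-] := hd x xx.
  by apply: cder_ext_loc hx; exists d; split=> // y /hd [].
- have [m xm] : exists m, x = z m.
    by apply: boolp.contrapT => hn; apply: nox => p e; apply: hn; exists p.
  have [r0 [[oQ [dQ cQ]] _]] := hf m; rewrite xm.
  have zz : (Cmod (z m - z m) < (f m).2)%R by rewrite Cmod_xx.
  apply: ccont_ext_loc (cQ _ zz).
  by exists (f m).2; split=> // y; exact: nearDQ.
- have [hx _] := hP x Ux ox; have [d [d0 hd]] := nearPsi x ox.
  apply: (@ccont_ext_loc (fun y => ode_rhs phi y (P y))).
    by exists d; split=> // y /hd [].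
  by apply: ode_rhs_ccont => //; exact: cder_ccont hx.
Qed.

(** * Simplicity of the kernel *)

Lemma real_off_poles (t : R) : off_poles z t.
Proof. by move=> p e; have := zpos p; rewrite -e /Im /=; lra. Qed.

Lemma real_dom (t : R) : G t.
Proof.
move=> p; have p0 := zpos p; split=> -[_].
  by rewrite (_ : Im (RtoC t) = 0%R) //; lra.
by rewrite (_ : Im (RtoC t) = 0%R) // (_ : Im (Cconj (z p)) = - Im (z p))%R //; lra.
Qed.

(** Clearing denominators turns the weight into a polynomial that vanishes at every real number,
    hence is zero. Its value at [z m] is [phi m] times a product of nonzero differences. *)
Lemma weight_zero phi : (forall t : R, weight z phi t = 0) -> forall p, phi p = 0.
Proof.
move=> h.
pose q p : {poly C} := (\prod_(j < n.+1 | j != p) ('X - (z j)%:P))%R.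
pose Q : {poly C} := (\sum_(p < n.+1) phi p *: q p)%R.
have hQ (x : C) : Q.[x]%R = (\sum_(p < n.+1) phi p * \prod_(j < n.+1 | j != p) (GRing.add x (GRing.opp (z j))))%R.
  rewrite /Q horner_sum; apply: eq_bigr => p _.
  by rewrite hornerZ /q horner_prod; congr (GRing.mul _ _); apply: eq_bigr => j _; rewrite hornerXsubC.
have Qt (t : R) : Q.[RtoC t]%R = GRing.zero.
  have -> : Q.[RtoC t]%R = GRing.mul (weight z phi t) (\prod_(j < n.+1) (GRing.add (RtoC t) (GRing.opp (z j))))%R.
    rewrite hQ /weight GRing.mulr_suml; apply: eq_bigr => p _.
    rewrite [in RHS](bigD1 p) //=; set S := (\prod_(j < n.+1 | _) _)%R.
    have nz := sub_neq0 (@real_off_poles t p).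
    rewrite -[LHS]/(Cmult (phi p) S) -[RHS]/(Cmult (phi p / (t - z p)) (Cmult (t - z p) S)).
    by field.
  by rewrite h GRing.mul0r.
have Q0 : Q = GRing.zero.
  apply: boolp.contrapT => /eqP Qn.
  (* As many distinct roots as the size of [Q], one more than its degree. *)
  pose rs := [seq RtoC (INR k) | k <- seq.iota 0 (size Q)].
  have hr : all (root Q) rs.
    by apply/allP => x /mapP [k _ ->]; rewrite /root Qt.
  have hu : uniq rs.
    by rewrite map_inj_uniq ?iota_uniq // => i j /RtoC_inj /INR_eq.
  by have := max_poly_roots Qn hr hu; rewrite size_map size_iota ltnn.
move=> m; have := hQ (z m); rewrite Q0 horner0 (bigD1 m) //= [X in GRing.add _ X]big1.
  rewrite GRing.addr0 => /esym/eqP; rewrite GRing.mulf_eq0 => /orP [/eqP //|].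
  move/GRing.prodf_eq0 => [j jm]; rewrite GRing.subr_eq0 => /eqP e.
  by move: jm; rewrite (z_Re_inj (esym (f_equal Re e))) eqxx.
move=> p pm; rewrite (bigD1 m) /=; last by rewrite eq_sym.
by rewrite GRing.subrr GRing.mul0r GRing.mulr0.
Qed.

Lemma u0_real (t : R) : Im (u0 t) = 0%R.
Proof.
suff h : Cconj (u0 t) = u0 t.
  by have := f_equal Im h; rewrite im_conj; lra.
rewrite /u0 Cconj_sum; apply: eq_bigr => p _.
have n1 := sub_neq0 (@real_off_poles t p).
have n2 : t - Cconj (z p) <> 0.
  by apply: sub_neq0 => e; have := f_equal Im e; rewrite im_conj /Im /=; have := zpos p; rewrite /Im; lra.
have ct : Cconj (RtoC t) = RtoC t by apply: C_ext; rewrite /Re /Im /=; ring.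
rewrite Cplus_conj !Cdiv_conj // !Cminus_conj !Cconj_conj ct; ring.
Qed.

(** A rational function with poles in the lower half-plane that equals [t * Cconj (weight z phi t)]
    at real [t] when the [phi p] sum to zero: [t / (t - a) = 1 + a / (t - a)], and the constants
    cancel. It is still of order [1 / |x|] at infinity. *)
Definition conj_weight (phi : 'I_n.+1 -> C) : C -> C :=
  weight (fun p => Cconj (z p)) (fun p => Cconj (phi p) * Cconj (z p)).

Lemma conj_weight_real (phi : 'I_n.+1 -> C) (t : R) : (\sum_(p < n.+1) phi p)%R = RtoC 0 ->
  conj_weight phi t = t * Cconj (weight z phi t).
Proof.
move=> h.
have ct : Cconj (RtoC t) = RtoC t by apply: C_ext; rewrite /Re /Im /=; ring.
have -> : conj_weight phi t = t * Cconj (weight z phi t) - Cconj (\sum_(p < n.+1) phi p)%R.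
  rewrite /weight !Cconj_sum /conj_weight /weight.
  rewrite -[X in _ = X - _]/(GRing.mul (RtoC t) (\sum_(p < n.+1) Cconj (phi p / (t - z p))%C)%R).
  rewrite GRing.mulr_sumr.
  rewrite -[RHS]/(GRing.add _ (GRing.opp (\sum_(p < n.+1) Cconj (phi p))%R)).
  rewrite -GRing.sumrB; apply: eq_bigr => p _.
  have n1 := sub_neq0 (@real_off_poles t p).
  have n2 : t - Cconj (z p) <> 0.
    by apply: sub_neq0 => e; have := f_equal Im e; rewrite im_conj /Im /=; have := zpos p; rewrite /Im; lra.
  rewrite -[RHS]/(t * Cconj (phi p / (t - z p)) - Cconj (phi p)).
  by rewrite Cdiv_conj // Cminus_conj ct; field.
by rewrite h; apply: C_ext; rewrite /Re /Im /=; ring.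
Qed.

Lemma large_bounds : exists R1 : R, (0 < R1)%R /\ forall x, (R1 < Cmod x)%R -> forall p,
  (1 <= Cmod (x - z p))%R /\ (1 <= Cmod (x - Cconj (z p)))%R /\
  (Cmod x <= 2 * Cmod (x - z p))%R /\ (Cmod x <= 2 * Cmod (x - Cconj (z p)))%R.
Proof.
have [Z [Z0 hZ]] := finite_max (fun p => Cmod (z p)).
exists (2 * Z + 2)%R; split=> [|x hx p]; first lra.
have h1 := hZ p; have h2 := Cmod_ge_sub x (z p); have h3 := Cmod_ge_sub x (Cconj (z p)).
by rewrite Cmod_conj in h3; lra.
Qed.

(** Since [H] vanishes at the top of every strip, its value at [x] is an integral over the vertical
    half-line above [x]. For [Im x >= 0] the modulus does not decrease along it, so the weight is at
    most [N / |x|], and the exponential decay is cancelled by the inverse exponential in the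
    resolvent. Abscissae of poles are reached by continuity. *)
Lemma extension_decay phi H Psi : is_primitive phi H ->
  (forall k, (k <= n.+1)%nat -> tends_top H k 0) ->
  (forall x, (0 <= Im x)%R -> ccont Psi x) ->
  (forall x, G x -> Psi x = resolvent up H x) ->
  exists R1 B : R, (0 < R1)%R /\ (0 <= B)%R /\
    forall x, (0 <= Im x)%R -> (R1 < Cmod x)%R -> (Cmod x * Cmod (Psi x) <= B)%R.
Proof.
move=> [hH h0] htop cPsi hPsi.
have [R1 [R10 hR]] := large_bounds.
have [B [B0 hB]] := vertical_bound up phi H.
have [M [M0 hM]] := branch_e_far up.
have [||N [N0 hN]] := @weight_bound n z phi (fun x => R1 < Cmod x)%R Cmod.
- by move=> x; lra.
- move=> p; exists 2%R => x hx; have [h1 [_ [h2 _]]] := hR x hx p; split=> //.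
  by move=> e; rewrite e Cmod_xx in h1; lra.
exists R1, (/ eps * (M * (B * N)))%R; split=> //.
have ie := Rinv_0_lt_compat _ eps0.
split; first by apply: Rmult_le_pos; [lra | apply: Rmult_le_pos; [lra | apply: Rmult_le_pos; lra]].
move=> x xi xR; rewrite -Cmod_mult.
apply: (@ccont_le (fun y => y * Psi y)).
  by apply: ccont_mul; [exact: ccont_id | exact: cPsi].
move=> d d0; have dR : (0 < Cmod x - R1)%R by lra.
have [y [hy [Gy [yi yz]]]] := branch_dom_dense x (Rmin_pos _ _ d0 dR).
exists y; split; first exact: Rlt_minl hy.
have yx := Rlt_minr hy.
have yR : (R1 < Cmod y)%R.
  by have := Cmod_ge_sub x (x - y); rewrite (_ : x - (x - y) = y); [rewrite (Cmod_sub_sym x y); lra | ring].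
rewrite -yi in xi; have y0 : (0 < Cmod y)%R by lra.
have [k [kn sk]] := strip_exists yz.
have vR t : (Im y <= t)%R -> (R1 < Cmod (Re y, t))%R.
  by move=> ht; exact: Rlt_le_trans yR (Cmod_vertical xi ht).
have hHy : (Cmod (H y) <= B * (N / Cmod y) * exp (- (- lam / eps) * Im y))%R.
  apply: hB; first exact: Rdiv_le_0_compat.
    move=> t ht; have hR' := hR _ (vR t ht); split; last split.
    - by apply: hH; exact: (@strip_dom k (Re y, t)).
    - by move=> p; have [h1 [h2 _]] := hR' p.
    - have h1 := hN _ (vR t ht); apply/Rle_div_r => //.
      apply: Rle_trans h1; apply: Rmult_le_compat_l; first exact: Cmod_ge_0.
      exact: Cmod_vertical.
  move=> e e1; have [Y hY] := htop k kn e e1; exists Y => t ht.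
  by have := hY (Re y, t) sk ht; rewrite (_ : H (Re y, t) - 0 = H (Re y, t)); last ring.
have fy : far y by move=> p; have [h1 [h2 _]] := hR y yR p.
have [_ he] := hM y fy.
rewrite (hPsi y Gy) /resolvent !Cmod_mult Cmod_opp Cmod_div; last by apply: RtoC_neq0; lra.
rewrite Cmod_Ci Cmod_R Rabs_pos_eq; last lra.
have E1 := exp_pos (- (- lam / eps) * Im y).
have -> : (/ eps * (M * (B * N)) = Cmod y * (1 / eps * (B * (N / Cmod y) * exp (- (- lam / eps) * Im y) *
    (M * exp (- (lam / eps * Im y))))))%R.
  transitivity (/ eps * (M * (B * N)) * (exp (- (- lam / eps) * Im y) * exp (- (lam / eps * Im y))))%R.
    by rewrite -exp_plus (_ : _ + _ = 0)%R; [rewrite exp_0; ring | field; lra].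
  by field; lra.
apply: Rmult_le_compat_l; first lra.
apply: Rmult_le_compat_l; first by rewrite /Rdiv; lra.
by apply: Rmult_le_compat => //; exact: Cmod_ge_0.
Qed.

Lemma below_free_primitive g dg : hol (below_free) g dg ->
  exists Q, forall x, below_free x -> cder Q x (g x).
Proof.
move=> hg; apply: (@antiderivative (below_free) g dg 0 0 hg) => x Ux.
split=> [t _ p|s hs p] [h1 h2].
  by move: h2; rewrite im_conj /Im /=; have := zpos p; rewrite /Im; lra.
apply: (Ux p); split=> //; move: h2 hs (zpos p); rewrite im_conj /Rmin /Rmax /Im /=.
by case: Rle_dec => ? /=; lra.
Qed.

(* The contour [-X, X] is pushed to the other three sides of a rectangle. *)
Lemma primitive_ends_bound g Q B X : (0 < X)%R -> (0 <= B)%R ->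
  (forall x, (0 <= Im x)%R -> cder Q x (g x)) ->
  (forall x, (0 <= Im x)%R -> (X <= Cmod x)%R -> (Cmod x * Cmod x * Cmod (g x) <= B)%R) ->
  (Cmod (Q (RtoC X) - Q (RtoC (- X))) <= 4 * B / X)%R.
Proof.
move=> X0 B0 hQ hg.
have gb x : (0 <= Im x)%R -> (X <= Cmod x)%R -> (Cmod (g x) <= B / (X * X))%R.
  move=> h1 h2; apply/Rle_div_r; first exact: Rmult_lt_0_compat.
  rewrite Rmult_comm; apply: Rle_trans (hg x h1 h2); apply: Rmult_le_compat_r; first exact: Cmod_ge_0.
  by apply: Rmult_le_compat; lra.
have vert a t : Rabs a = X -> (0 <= t <= X)%R -> (Cmod (g (a, t)) <= B / (X * X))%R.
  move=> ha ht; apply: gb; first by rewrite /Im /=; lra.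
  by rewrite -ha; exact: re_le_Cmod (a, t).
have v a : Rabs a = X -> (Cmod (Q (a, X) - Q (a, 0%R)) <= B / (X * X) * X)%R.
  move=> ha; have := @mean_value_bound (fun t => Q (a, t)) (fun t => Ci * g (a, t)) (B / (X * X)) 0 X.
  rewrite Rmin_left ?Rmax_right; try lra.
  rewrite Rminus_0_r (Rabs_pos_eq X); last lra.
  apply=> t ht; last by rewrite Cmod_mult Cmod_Ci Rmult_1_l; exact: vert.
  have := rder_comp (hQ (a, t) _) (rder_vline a t); rewrite Cmult_comm; apply.
  by rewrite /Im /=; lra.
have h : (Cmod (Q (X, X) - Q ((- X)%R, X)) <= B / (X * X) * (2 * X))%R.
  have := @mean_value_bound (fun t => Q (t, X)) (fun t => g (t, X)) (B / (X * X)) (- X) X.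
  rewrite (_ : Rabs (X - - X) = 2 * X)%R; last by rewrite Rabs_pos_eq; lra.
  apply=> t _.
    have := rder_comp (hQ (t, X) _) (rder_hline X t); rewrite Cmult_1_r; apply.
    by rewrite /Im /=; lra.
  apply: gb; first by rewrite /Im /=; lra.
  by rewrite -{1}(Rabs_pos_eq X); [exact: im_le_Cmod (t, X) | lra].
have v1 := v X (Rabs_pos_eq _ (Rlt_le _ _ X0)).
have v2 := v (- X)%R (_ : Rabs (- X) = X).
have {}v2 : (Cmod (Q ((- X)%R, X) - Q ((- X)%R, 0%R)) <= B / (X * X) * X)%R.
  by apply: v2; rewrite Rabs_Ropp Rabs_pos_eq; lra.
rewrite -[RtoC X]/((X, 0%R) : C) -[RtoC (- X)]/(((- X)%R, 0%R) : C).
rewrite (_ : Q (X, 0%R) - Q ((- X)%R, 0%R) = (Q (X, X) - Q ((- X)%R, X)) + (Q ((- X)%R, X) - Q ((- X)%R, 0%R))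
   - (Q (X, X) - Q (X, 0%R))); last ring.
apply: Rle_trans (Cmod_triangle_sub _ _) _.
have := Cmod_triangle (Q (X, X) - Q ((- X)%R, X)) (Q ((- X)%R, X) - Q ((- X)%R, 0%R)).
(* The top side has length [2 * X] and the lateral sides length [X]; on all three [g] is at most
   [B / (X * X)] in modulus. *)
have -> : (4 * B / X = B / (X * X) * (2 * X) + B / (X * X) * X + B / (X * X) * X)%R by field; lra.
lra.
Qed.

(* Wu's identity. With [Q' = x w^* Psi], [w^*] the conjugate of the weight on the
   real axis, [t |Psi|^2 + (2 / eps) Im Q] has derivative [|Psi|^2]; when
   [phi] sums to zero its variation over [-X, X] is [O(1 / X)]. *)
Theorem weight_simple (phi : 'I_n.+1 -> C) H : is_primitive phi H ->
  (forall m, tends_end H m 0) -> (\sum_(p < n.+1) phi p)%R = RtoC 0 -> forall p, phi p = 0.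
Proof.
move=> hp hend hsum; apply: weight_zero.
have htop := tends_end_tends_top hp hend.
have [Psi [dPsi [hPsi ePsi]]] := resolvent_extension hp hend.
have upU x : (0 <= Im x)%R -> below_free x := @upper_below_free x.
have cPsi x : (0 <= Im x)%R -> ccont Psi x by move=> /upU; exact: hol_ccont hPsi.
have [R1 [B [R10 [B0 hB]]]] := extension_decay hp htop cPsi ePsi.
have [dw hw] := hol_weight (fun p => Cconj (z p)) (fun p => Cconj (phi p) * Cconj (z p)).
have {}hw : hol (below_free) (conj_weight phi) dw.
  by apply: hol_sub hw; [exact: copen_below_free | move=> x Ux p; exact: not_down_cut_neq (Ux p)].
pose g x := conj_weight phi x * Psi x.
have [Q hQ] := below_free_primitive (hol_mul hw hPsi).
have {}hQ x : (0 <= Im x)%R -> cder Q x (g x) by move=> /upU /hQ.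
have [R2 [R20 hR]] := large_bounds.
have [||N [N0 hN]] := @weight_bound n (fun p => Cconj (z p)) (fun p => Cconj (phi p) * Cconj (z p))
   (fun x => R2 < Cmod x)%R Cmod.
- by move=> x; lra.
- move=> p; exists 2%R => x hx; have [_ [h1 [_ h2]]] := hR x hx p; split=> //.
  by move=> e; rewrite e Cmod_xx in h1; lra.
pose R3 := (Rmax R1 R2 + 1)%R.
have R31 : (R1 < R3)%R by rewrite /R3; have := Rmax_l R1 R2; lra.
have R32 : (R2 < R3)%R by rewrite /R3; have := Rmax_r R1 R2; lra.
have gb x : (0 <= Im x)%R -> (R3 <= Cmod x)%R -> (Cmod x * Cmod x * Cmod (g x) <= N * B)%R.
  move=> xi xR; rewrite /g Cmod_mult.
  have h1 := hN x (_ : (R2 < Cmod x)%R); have h2 := hB x xi (_ : (R1 < Cmod x)%R).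
  have {}h1 : (Cmod (conj_weight phi x) * Cmod x <= N)%R by apply: h1; lra.
  have {}h2 : (Cmod x * Cmod (Psi x) <= B)%R by apply: h2; lra.
  rewrite (_ : Cmod x * Cmod x * _ = (Cmod (conj_weight phi x) * Cmod x) * (Cmod x * Cmod (Psi x)))%R; last ring.
  by apply: Rmult_le_compat => //; apply: Rmult_le_pos; exact: Cmod_ge_0.
pose nrm t := (Re (Psi (RtoC t)) ^ 2 + Im (Psi (RtoC t)) ^ 2)%R.
pose S t := (t * nrm t + 2 / eps * Im (Q (RtoC t)))%R.
have real0 t : (0 <= Im (RtoC t))%R by rewrite /Im /=; lra.
have hPsi' t : cder Psi (RtoC t) (ode_rhs phi t (Psi (RtoC t))).
  have Gt := @real_dom t; rewrite (ePsi _ Gt).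
  apply: cder_ext_loc (cder_resolvent Gt (proj1 hp _ Gt)).
  have [d [d0 hd]] := copen_branch_dom Gt; exists d; split=> // y /hd Gy; rewrite ePsi //.
have rPsi t : rder (fun s => Psi (RtoC s)) t (ode_rhs phi t (Psi (RtoC t))).
  by have := rder_comp (hPsi' t) (rder_RtoC t); rewrite Cmult_1_r.
have rQ t : rder (fun s => Q (RtoC s)) t (g (RtoC t)).
  by have := rder_comp (hQ _ (real0 t)) (rder_RtoC t); rewrite Cmult_1_r.
have hS t : is_derive S t (nrm t).
  have [r1 r2] := rPsi t; have [_ r3] := rQ t.
  set D := ode_rhs _ _ _ in r1 r2.
  (* As [lam] and [u0 t] are real, [(lam + u0) Psi] multiplied by [i / eps] contributes nothing to
     the real part of [Cconj (Psi t) * D]; the remaining weight term is compensated by the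
     derivative of the imaginary part of [Q]. *)
  have key : (t * (2 * Re (Psi t) * Re D + 2 * Im (Psi t) * Im D) + 2 / eps * Im (g t) = 0)%R.
    have hu := u0_real t.
    rewrite /g (conj_weight_real t hsum) /D /ode_rhs /Cdiv -RtoC_inv; last lra.
    move: (Psi t) (weight z phi t) (u0 t) hu => P w u hu.
    rewrite /Re /Im /= in hu *; rewrite hu; field; lra.
  have h1 : is_derive nrm t (2 * Re (Psi t) * Re D + 2 * Im (Psi t) * Im D)%R.
    apply: is_derive_plus.
      have := is_derive_pow _ 2 _ _ r1; set v := (X in is_derive _ _ X).
      by rewrite (_ : v = 2 * Re (Psi t) * Re D)%R //; rewrite /v /=; ring.
    have := is_derive_pow _ 2 _ _ r2; set v := (X in is_derive _ _ X).
    by rewrite (_ : v = 2 * Im (Psi t) * Im D)%R //; rewrite /v /=; ring.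
  have h2 : is_derive (fun s => s * nrm s)%R t (1 * nrm t + t * (2 * Re (Psi t) * Re D + 2 * Im (Psi t) * Im D))%R.
    by apply: is_derive_mult => //; [exact: is_derive_id | exact: Rmult_comm].
  have h3 := is_derive_plus _ _ _ _ _ h2 (is_derive_scal _ _ (2 / eps)%R _ r3).
  have -> : nrm t = plus (1 * nrm t + t * (2 * Re (Psi t) * Re D + 2 * Im (Psi t) * Im D))%R
     (scal (2 / eps)%R (Im (g t))).
    rewrite -[RHS]/(1 * nrm t + t * (2 * Re (Psi t) * Re D + 2 * Im (Psi t) * Im D) +
      2 / eps * Im (g t))%R; lra.
  exact: h3.
have nrm0 t : (0 <= nrm t)%R by apply: Rplus_le_le_0_compat; exact: pow2_ge_0.
have nrmE t : nrm t = (Cmod (Psi t) * Cmod (Psi t))%R.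
  by rewrite /nrm -Cmod2_alt; ring.
have Sbound a b e : (a <= b)%R -> (0 < e)%R -> (S b - S a <= e)%R.
  (* [S] is nondecreasing, so its variation on [[a, b]] is at most that on [[-X, X]], which is at
     most [C3 / X]: each end gives [B * B / X] through [t * nrm t], and [Q] gives [2 / eps] times
     the bound of [primitive_ends_bound]. *)
  move=> ab e0; set C3 := (2 * (B * B) + 2 / eps * (4 * (N * B)))%R.
  have ie := Rinv_0_lt_compat _ eps0.
  have C30 : (0 <= C3)%R.
    have h1 := Rmult_le_pos _ _ B0 B0; have h2 := Rmult_le_pos _ _ N0 B0.
    have h3 : (0 <= 2 / eps)%R by rewrite /Rdiv; lra.
    by have := Rmult_le_pos _ _ h3 h2; rewrite /C3; lra.
  set X := (Rmax (Rmax R3 (C3 / e)) (Rabs a + Rabs b))%R.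
  have X1 : (R3 <= X)%R := Rle_trans _ _ _ (Rmax_l _ _) (Rmax_l _ _).
  have X2 : (C3 / e <= X)%R := Rle_trans _ _ _ (Rmax_r _ _) (Rmax_l _ _).
  have X3 : (Rabs a + Rabs b <= X)%R := Rmax_r _ _.
  have X0 : (0 < X)%R by lra.
  have ha := Rle_abs (- a); have hb := Rle_abs b; rewrite Rabs_Ropp in ha.
  have pa := Rabs_pos a; have pb := Rabs_pos b.
  have m1 : (S (- X)%R <= S a)%R by apply: is_derive_increasing hS nrm0; lra.
  have m2 : (S b <= S X)%R by apply: is_derive_increasing hS nrm0; lra.
  have hQX : (Cmod (Q (RtoC X) - Q (RtoC (- X))) <= 4 * (N * B) / X)%R.
    apply: (@primitive_ends_bound g) => //; first by apply: Rmult_le_pos.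
    by move=> x xi xX; apply: gb => //; lra.
  have hn u : Rabs u = X -> (X * nrm u <= B * B / X)%R.
    move=> hu; have := hB (RtoC u) (real0 u); rewrite Cmod_R hu => h.
    have {}h : (X * Cmod (Psi u) <= B)%R by apply: h; lra.
    apply: (proj1 (Rle_div_r (X * nrm u) (B * B) X X0)).
    have -> : (X * nrm u * X = (X * Cmod (Psi u)) * (X * Cmod (Psi u)))%R by rewrite nrmE; ring.
    have h0 : (0 <= X * Cmod (Psi u))%R by apply: Rmult_le_pos; [lra | exact: Cmod_ge_0].
    exact: Rmult_le_compat.
  have n1 := hn X (Rabs_pos_eq _ (Rlt_le _ _ X0)).
  have n2 := hn (- X)%R (_ : Rabs (- X) = X).
  have {}n2 : (X * nrm (- X) <= B * B / X)%R.
    by apply: n2; rewrite Rabs_Ropp Rabs_pos_eq; lra.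
  have hIm := Rle_trans _ _ _ (Rle_abs _) (Rle_trans _ _ _ (im_le_Cmod _) hQX).
  rewrite Im_sub in hIm.
  have e2 : (0 <= 2 / eps)%R by rewrite /Rdiv; lra.
  have hIm' := Rmult_le_compat_l _ _ _ e2 hIm.
  have hC : (C3 / X <= e)%R.
    by apply/Rle_div_l => //; move/(Rle_div_l _ _ _ e0): X2; rewrite Rmult_comm.
  have eC : (C3 / X = B * B / X + B * B / X + 2 / eps * (4 * (N * B) / X))%R.
    by rewrite /C3; field; lra.
  have eS : (S X - S (- X) = X * nrm X + X * nrm (- X) + 2 / eps * (Im (Q (RtoC X)) - Im (Q (RtoC (- X)))))%R.
    by rewrite /S; ring.
  lra.
have Sconst a b : S a = S b.
  have le u v : (u <= v)%R -> S u = S v.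
    move=> uv; apply: Rle_antisym; first exact: is_derive_increasing uv hS nrm0.
    by apply: le_eps => e e0; have := Sbound u v e uv e0; lra.
  by case: (Rle_dec a b) => ab; [exact: le | symmetry; apply: le; lra].
have Psi0 t : Psi (RtoC t) = 0.
  have h1 : is_derive S t 0%R.
    apply: (is_derive_ext (fun _ => S 0%R)) => [s|]; first exact: Sconst.
    exact: is_derive_const.
  have := is_derive_unique _ _ _ (hS t); rewrite (is_derive_unique _ _ _ h1) nrmE => h.
  by apply: Cmod_eq_0; case: (Rmult_integral _ _ (esym h)).
(* With [Psi] identically zero on the real axis, its derivative is zero too, and the differential
   equation leaves only the weight. *)
move=> t; have h1 : rder (fun s => Psi (RtoC s)) t 0.
  apply: (@rder_ext (fun _ => 0)) => [s|]; first by rewrite Psi0.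
  by split; rewrite /Re /Im /=; exact: is_derive_const.
have := rder_unique h1 (rPsi t); rewrite Psi0 /ode_rhs => h.
have en : RtoC eps <> 0 by apply: RtoC_neq0; lra.
transitivity (- (Ci * Ci) * weight z phi t); first by rewrite Ci2; ring.
transitivity (Ci * eps * (Ci / eps * ((lam + u0 t) * 0 - weight z phi t))); first by field.
by rewrite -h; ring.
Qed.

(** * From the resolvent to the function and the matrix of the theorem *)

Lemma Phi_fun_resolvent (phi : 'cV[C]_n.+1) ell H x :
  is_primitive (fun p => phi p ord0) H -> G x -> is_path_to z x (ell x) ->
  Phi_fun eps c z lam phi ell x = resolvent up H x.
Proof.
move=> hp Gx hx; have h := contour_int_path hp Gx hx.
rewrite /Phi_fun /resolvent -h /branch_e.
have -> : Cexp (Ci * h_phase c z lam x / eps) = / Cexp (- Ci * (lam * x + branch_f up x) / eps).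
  by rewrite -Cexp_opp h_phaseE -/up; congr Cexp; rewrite /Cdiv; ring.
rewrite -[contour_int _ _]/(contour_int (integrand up (fun p => phi p ord0)) (ell x)).
by rewrite /Cdiv; ring.
Qed.

(** If the resolvent vanished on [G], so would [H] and its derivative, the integrand; the weight
    would then vanish on the real axis and all [phi p] with it. *)
Lemma resolvent_nonzero phi H : is_primitive phi H -> (exists p, phi p <> 0) ->
  exists x, G x /\ resolvent up H x <> 0.
Proof.
move=> [hH _] [p hp]; apply: boolp.contrapT => hn; apply: hp; move: p.
apply: (weight_zero) => t.
have en : RtoC eps <> 0 by apply: RtoC_neq0; lra.
have H0 x : G x -> H x = 0.
  move=> Gx; have r0 : resolvent up H x = 0.
    by apply: boolp.contrapT => h; apply: hn; exists x.
  have n0 := branch_e_neq0 (s := up) (x := x).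
  transitivity (- (Ci * Ci) * H x); first by rewrite Ci2; ring.
  transitivity (Ci * eps * branch_e up x * resolvent up H x).
    by rewrite /resolvent; field; split.
  by rewrite r0; ring.
have Gt : G t := real_dom t.
have n0 := branch_e_neq0 (s := up) (x := t).
have e : integrand up phi t = 0.
  apply: (cder_unique (hH _ Gt)).
  have [d [d0 hd]] := copen_branch_dom Gt.
  apply: cder_ext_loc (cder_const 0 t); exists d; split=> // y /hd Gy.
  by rewrite H0.
transitivity (/ branch_e up t * integrand up phi t).
  by rewrite /integrand; field.
by rewrite e; ring.
Qed.

(** Primitives for the same [phi] agree at [x], both being the contour integral along [g]; for
    [phi = 0] the zero function is one of them. *)
Lemma primitive_zero (phi : 'I_n.+1 -> C) H x g : (forall p, phi p = 0) -> is_primitive phi H ->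
  G x -> is_path_to z x g -> H x = 0.
Proof.
move=> h hp Gx hg; rewrite -(contour_int_path hp Gx hg).
apply: (contour_int_path (H := fun _ => 0)) => //; split=> [y _|].
  suff -> : integrand up phi y = 0 by exact: cder_const.
  rewrite /integrand /weight big1; first exact: Cmult_0_r.
  by move=> p _; rewrite h; exact: Cmult_0_l.
by have [] := tends_top_lim_rel 0.
Qed.

Lemma resolvent_analytic phi H F : is_primitive phi H ->
  (forall m, tends_end H m 0) -> (forall x, G x -> F x = resolvent up H x) ->
  analytic_in_closed_uhp (dom_G z) F.
Proof.
move=> hp hend hF.
have [Psi [dPsi [[oU [hPsi _]] ePsi]]] := resolvent_extension hp hend.
exists (below_free), Psi; split; first exact: upper_below_free.
split; last by move=> x /dom_GE Gx _; rewrite ePsi // hF.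
split; first exact: copen_open.
by move=> x Ux; exists (dPsi x); apply/cder_is_derive; exact: hPsi.
Qed.

Lemma analytic_tends_end phi H F m : is_primitive phi H ->
  (forall x, G x -> F x = resolvent up H x) ->
  analytic_in_closed_uhp (dom_G z) F -> tends_end H m 0.
Proof.
move=> hp hF [U [Psi [hU [[_ hPsi] ePsi]]]].
have cPsi x : (0 <= Im x)%R -> ccont Psi x.
  by move=> /hU /hPsi [l /cder_is_derive /cder_ccont].
have ePsi' x : (0 <= Im x)%R -> G x -> Psi x = resolvent up H x.
  by move=> /hU Ux Gx; rewrite ePsi ?hF //; apply/dom_GE.
split=> hc.
  exact: (extension_tends_top hp cPsi ePsi').
apply: (extension_tends_pole hp cPsi ePsi').
exact: negative_integer_exponent.
Qed.

Lemma A_mat_primitives Rad Cl : (forall m, is_C_contour eps c z Rad m (Cl m)) ->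
  exists H : 'I_n.+1 -> C -> C,
    (forall p, is_primitive (unit_weight p) (H p)) /\
    (forall p m, tends_end (H p) m (A_mat eps c z lam Cl m p)).
Proof.
move=> hCl.
have [H hH] := boolp.choice (fun p => primitive_exists (unit_weight p)).
exists H; split=> // p m.
have [L hL] := tends_end_exists m (hH p).
suff -> : A_mat eps c z lam Cl m p = L by [].
rewrite -(contour_int_end (hH p) hL (hCl m)) /A_mat mxE; congr contour_int.
by apply: boolp.funext => w; rewrite /integrand weight_unit.
Qed.

Lemma tends_end_mulmx Rad Cl phi : (forall m, is_C_contour eps c z Rad m (Cl m)) ->
  exists H, is_primitive (fun p => (phi : 'cV[C]_n.+1) p ord0) H /\
    forall m, tends_end H m ((A_mat eps c z lam Cl *m phi)%R m ord0).
Proof.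
move=> hCl; have [H [hH hend]] := A_mat_primitives hCl.
exists (fun x => (\sum_(p < n.+1) (phi p ord0 * H p x)%C)%R); split; first exact: primitive_sum.
move=> m; have := tends_end_sum (fun p => phi p ord0) (fun p => hend p m).
suff -> : ((A_mat eps c z lam Cl *m phi)%R m ord0) =
  (\sum_(p < n.+1) (phi p ord0 * A_mat eps c z lam Cl m p)%C)%R by [].
by rewrite mxE; apply: eq_bigr => p _; exact: Cmult_comm.
Qed.

(** Both limits are the value of one contour integral; the contour is what guarantees that the end
    is actually approached. *)
Lemma tends_end_unique Rad phi H L L' m g : is_primitive phi H ->
  is_C_contour eps c z Rad m g -> tends_end H m L -> tends_end H m L' -> L = L'.
Proof.
move=> hp hg h h'.
by rewrite -(contour_int_end hp h hg) (contour_int_end hp h' hg).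
Qed.

End Resolvent.

(** * Dimension of the nullspace and proof of the equivalence *)

(** A kernel of dimension at least [2] meets every hyperplane in a nonzero vector, here the
    hyperplane of vectors with zero sum. The rows of [kermx A^T] are the transposed nullvectors of
    [A]. *)
Lemma rank_kermx1 (F : fieldType) (n : nat) (A : 'M[F]_n.+1) : \det A = 0 ->
  (forall phi : 'cV[F]_n.+1, A *m phi = 0 -> \sum_p phi p ord0 = 0 -> phi = 0) ->
  \rank (kermx A^T) = 1%nat.
Proof.
move=> dA h; set K := kermx A^T; apply/eqP; rewrite eqn_leq; apply/andP; split.
  rewrite leqNgt; apply/negP => rK.
  pose B := kermx (const_mx 1 : 'cV[F]_n.+1).
  have rB : (n <= \rank B)%nat.
    rewrite mxrank_ker; apply: leq_trans (leq_sub2l n.+1 (rank_leq_col _)).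
    by rewrite subn1.
  have : (K :&: B)%MS != 0.
    rewrite -mxrank_eq0 -lt0n -(ltn_add2l (\rank (K + B)%MS)) addn0 mxrank_sum_cap.
    (* The sum of the two spaces has rank at most [n + 1], whereas their ranks add up to at least
       [2 + n]. *)
    apply: leq_ltn_trans (rank_leq_col _) _.
    by rewrite -[n.+2]/(2 + n)%nat leq_add.
  move=> /rowV0Pn [u]; rewrite sub_capmx => /andP [/sub_kermxP uK /sub_kermxP uB] /eqP; apply.
  rewrite -[u]trmxK (h u^T) ?trmx0 //.
    by apply: trmx_inj; rewrite trmx_mul trmxK uK trmx0.
  move/matrixP/(_ ord0 ord0): uB; rewrite !mxE => uB; rewrite -[RHS]uB.
  by apply: eq_bigr => p _; rewrite !mxE GRing.mulr1.
rewrite mxrank_ker subn_gt0 mxrank_tr ltn_neqAle rank_leq_row andbT.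
apply/negP => /eqP rA; have : row_free A by rewrite /row_free rA.
by rewrite row_free_unit unitmxE dA GRing.unitr0.
Qed.
Theorem corollary2 :
  forall (n : nat) (eps : R) (c z : 'I_n.+1 -> C) (Rad lam : R)
    (Cl : 'I_n.+1 -> R -> C),
    (0 < eps)%R ->
    (forall p : 'I_n.+1, c p <> 0) ->
    \sum_(p < n.+1) (c p + Cconj (c p))%C = 0 ->
    (forall p : 'I_n.+1, (0 < Im (z p))%R) ->
    (forall p q : 'I_n.+1, (p < q)%nat -> (Re (z p) < Re (z q))%R) ->
    (forall p : 'I_n.+1, (Cmod (z p) < Rad)%R) ->
    (lam < 0)%R ->
    (forall m : 'I_n.+1, is_C_contour eps c z Rad m (Cl m)) ->
    let A := A_mat eps c z lam Cl in
    (forall (phi : 'cV[C]_n.+1) (ell : C -> R -> C),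
       (forall x : C, dom_G z x -> is_path_to z x (ell x)) ->
       let Phi := Phi_fun eps c z lam phi ell in
       (nontrivial_on (dom_G z) Phi /\ analytic_in_closed_uhp (dom_G z) Phi)
       <->
       (\det A = 0 /\ phi <> 0 /\ A *m phi = 0)) /\
    (\det A = 0 -> \rank (kermx (A^T)) = 1%nat).
Proof.
move=> n eps c z Rad lam Cl eps0 c0 csum zpos zinc zRad lam0 hCl A.
have mul0 (phi : 'cV[C]_n.+1) H : is_primitive eps lam c z (fun p => phi p ord0) H ->
    (forall m, tends_end eps c z H m 0) -> \sum_p phi p ord0 = 0 -> phi = 0.
  move=> hp hend hsum; apply/colP => p; rewrite mxE.
  exact: (weight_simple eps0 zpos zinc lam0 hp hend hsum).
split; last first.
  move=> dA; apply: rank_kermx1 => // phi Aphi hsum.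
  have [H [hp hend]] := tends_end_mulmx eps0 zpos zinc lam0 phi hCl.
  by apply: mul0 hp _ hsum => m; have := hend m; rewrite -/A Aphi mxE.
move=> phi ell hell Phi.
have [H [hp hend]] := tends_end_mulmx eps0 zpos zinc lam0 phi hCl.
have hPhi x : branch_dom z (@up_cuts n) x -> Phi x = resolvent eps lam c z (@up_cuts n) H x.
  by move=> Gx; apply: Phi_fun_resolvent => //; apply: hell; apply/dom_GE.
split=> [[[x [/dom_GE Gx Phix]] hana]|[dA [phi0 Aphi]]].
  have h0 m := analytic_tends_end eps0 zpos zinc lam0 m hp hPhi hana.
  have Aphi : A *m phi = 0.
    (* The [m]-th entry of [A *m phi] and [0] are both limits of [H] at the end of the [m]-th
       contour: the former by linearity, the latter by analyticity. *)
    apply/colP => m; rewrite mxE [RHS]mxE.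
    have := tends_end_unique zinc hp (hCl m) (hend m) (h0 m).
    by rewrite mxE.
  have phi0 : phi <> 0.
    move=> e; apply: Phix; rewrite (hPhi x Gx) /resolvent.
    have phi0 p : phi p ord0 = RtoC 0 by rewrite e mxE.
    have -> : H x = RtoC 0.
      exact (primitive_zero eps0 zinc lam0 phi0 hp Gx (hell x (proj2 (dom_GE z x) Gx))).
    by rewrite /Cdiv Cmult_0_l Cmult_0_r.
  split; last by split.
  apply/eqP; apply/negPn/negP => dn; apply: phi0.
  have uA : A \in unitmx by rewrite unitmxE GRing.unitfE.
  by rewrite -[phi](mulKmx uA) Aphi mulmx0.
have h0 m : tends_end eps c z H m 0 by have := hend m; rewrite -/A Aphi mxE.
split; last exact: (resolvent_analytic eps0 zpos zinc lam0 hp h0 hPhi).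
have [|x [Gx hx]] := resolvent_nonzero eps0 zpos zinc hp.
  apply: boolp.contrapT => hn; apply: phi0; apply/colP => p; rewrite mxE.
  by apply: boolp.contrapT => hpn; apply: hn; exists p.
by exists x; split; [apply/dom_GE | rewrite hPhi].
Qed.
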